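(* For each $s>1$ there exist $N\in\mathbb{N}$ and a $\frac1s$-Hölder continuous map $g:[0,1]\to\mathbb{R}^N$ such that $\Gamma_s=g([0,1])$ satisfies $\mathcal{H}^s(\Gamma_s)>0$ and, for $\mathcal{H}^s$-almost every $x\in\Gamma_s$, the set $\mathrm{Tan}(\Gamma_s,x)$ contains infinitely many pairwise non-homeomorphic tangents.
   Context: For nonempty $A,B\subset\mathbb{R}^N$, $\mathrm{exc}(A,B)=\sup_{a\in A}\inf_{b\in B}|a-b|$. Nonempty closed sets $X_m\subset\mathbb{R}^N$ converge to a nonempty closed set $X$ in the Attouch–Wets topology if for every $r>0$, $\mathrm{exc}(X_m\cap\overline{B}(\mathbf{0},r),X)\to0$ and $\mathrm{exc}(X\cap\overline{B}(\mathbf{0},r),X_m)\to0$. For a closed set $X$ and $x\in X$, a closed set $T\ni\mathbf{0}$ is a tangent of $X$ at $x$ if $r_m^{-1}(X-x)\to T$ in the Attouch–Wets topology for some scales $r_m\downarrow0$; $\mathrm{Tan}(X,x)$ is the set of all such tangents. $\mathcal{H}^s$ is $s$-dimensional Hausdorff measure. *)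

(* Defs.v *)
From HB Require Import structures.
From mathcomp Require Import all_boot all_order all_algebra.
From mathcomp Require Import all_classical all_reals all_analysis.
From mathcomp Require Import Rstruct Rstruct_topology.
Set Implicit Arguments. Unset Strict Implicit. Unset Printing Implicit Defensive.
Import Order.TTheory GRing.Theory Num.Theory.
Import numFieldNormedType.Exports.
Local Open Scope classical_set_scope.
Local Open Scope ring_scope.

Notation RR := Rdefinitions.R.

Definition edist (N : nat) (a b : 'rV[RR]_N) : RR :=
  Num.sqrt (\sum_(i < N) (a ord0 i - b ord0 i) ^+ 2).

Definition cball0 (N : nat) (r : RR) : set 'rV[RR]_N :=
  [set y | edist 0 y <= r].

(* exc(A,B) = sup_{a in A} inf_{b in B} |a - b|  (with exc(emptyset, B) = 0) *)
Definition exc (N : nat) (A B : set 'rV[RR]_N) : \bar RR :=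
  ereal_sup ([set 0%E] `|`
    [set ereal_inf [set (edist a b)%:E | b in B] | a in A]).

Definition AW_conv (N : nat) (Xs : nat -> set 'rV[RR]_N) (X : set 'rV[RR]_N) : Prop :=
  (forall m, closed (Xs m) /\ Xs m !=set0) /\ closed X /\ X !=set0 /\
  forall r : RR, 0 < r ->
    (forall e : RR, 0 < e -> exists M, forall m, (M <= m)%N ->
        (exc (Xs m `&` cball0 r) X <= e%:E)%E) /\
    (forall e : RR, 0 < e -> exists M, forall m, (M <= m)%N ->
        (exc (X `&` cball0 r) (Xs m) <= e%:E)%E).

Definition blowup (N : nat) (X : set 'rV[RR]_N) (x : 'rV[RR]_N) (r : RR)
  : set 'rV[RR]_N := [set r^-1 *: (y - x) | y in X].

Definition is_tangent (N : nat) (X : set 'rV[RR]_N) (x : 'rV[RR]_N)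
  (T : set 'rV[RR]_N) : Prop :=
  closed T /\ T 0 /\
  exists rs : nat -> RR,
    (forall m, 0 < rs m) /\ (forall m, rs m.+1 <= rs m) /\
    (forall e : RR, 0 < e -> exists M, forall m, (M <= m)%N -> rs m < e) /\
    AW_conv (fun m => blowup X x (rs m)) T.

Definition Tan (N : nat) (X : set 'rV[RR]_N) (x : 'rV[RR]_N) : set (set 'rV[RR]_N) :=
  [set T | is_tangent X x T].

Definition homeomorphic (N : nat) (A B : set 'rV[RR]_N) : Prop :=
  exists (f g : 'rV[RR]_N -> 'rV[RR]_N),
    (forall a, A a -> B (f a)) /\ (forall b, B b -> A (g b)) /\
    (forall a, A a -> g (f a) = a) /\ (forall b, B b -> f (g b) = b) /\
    {within A, continuous f} /\ {within B, continuous g}.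

(* diameter (diam emptyset = 0) *)
Definition diam (N : nat) (U : set 'rV[RR]_N) : \bar RR :=
  ereal_sup ([set 0%E] `|` [set (edist a b)%:E | a in U & b in U]).

Definition hausdorff_delta (N : nat) (s delta : RR) (E : set 'rV[RR]_N) : \bar RR :=
  ereal_inf [set (\sum_(0 <= i <oo) ((fine (diam (F i))) `^ s)%:E)%E |
    F in [set F : nat -> set 'rV[RR]_N |
            E `<=` \bigcup_i F i /\ forall i, (diam (F i) <= delta%:E)%E]].

(* s-dimensional Hausdorff (outer) measure, without normalising constant *)
Definition hausdorff (N : nat) (s : RR) (E : set 'rV[RR]_N) : \bar RR :=
  ereal_sup [set hausdorff_delta s delta E | delta in [set d : RR | 0 < d]].

Definition holder01 (N : nat) (alpha : RR) (g : RR -> 'rV[RR]_N) : Prop :=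
  exists C : RR, forall t u : RR, 0 <= t <= 1 -> 0 <= u <= 1 ->
    edist (g t) (g u) <= C * (`|t - u| `^ alpha).

(* Main.v *)
Require Import Defs.
From HB Require Import structures.
From mathcomp Require Import all_boot all_order all_algebra.
From mathcomp Require Import all_classical all_reals all_analysis.
From mathcomp Require Import Rstruct Rstruct_topology.
From mathcomp Require Import ring lra zify.
Import Defs.
Set Implicit Arguments. Unset Strict Implicit. Unset Printing Implicit Defensive.
Import Order.TTheory GRing.Theory Num.Theory.
Import numFieldNormedType.Exports.
Local Open Scope classical_set_scope.
Local Open Scope ring_scope.

(** Fix an odd integer L with 2 < L a for a = L^(-1/s). At each scale L^-m with
    m in a sparse set of loop scales, the clock stands still on the intervals
    [1 + L i, 2 + L i] / L^(m+1), so that the two ends of such an interval are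
    identified. The path f is the sum of the oscillations a^m phi (level m t),
    distributed over finitely many coordinates according to m modulo M, where
    phi = (sin (pi x), sin (2 pi x)) is a figure eight and level m t is the
    position of t seen at scale L^-m after the collapses of scale m and finer.
    It is 1/s-Hölder and, conversely, |f t - f u|^s dominates |t - u| unless t
    and u are close to the two ends of one of the loops. Hence f transports
    Lebesgue measure to a measure comparable with H^s, and Lebesgue-null sets
    of times have H^s-null images.

    The loop scales come in isolated pairs at distance k.+1, every k occurring
    infinitely often. By Borel-Cantelli almost every time stays away from all
    larger loops when one zooms in on such a pair, and the limit of the blow-ups
    is a properly embedded line with two families of identifications: small
    loops at x = 1, y = 2 modulo L and big loops, Q = L^k.+1 times larger,
    carrying roughly L^k small ones. A compact piece attached to the rest of
    the space at a single base point is trapped in one loop; counting the base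
    points lying in one such piece gives a number between L^k and
    L^k.+1 + 1, so that the values k = 0, 4, 8, ... give pairwise
    non-homeomorphic tangents. *)

(** * Figure eights *)

Section Trigonometry.
Variable R : realType.
Implicit Types x y z : R.

(** Stopping the clock at one scale does not by itself close a loop: the finer terms of the series
    still see two different times. They agree because the ends of a loop are integers at every finer
    scale and [phi] vanishes at integers. Times near the two ends must nevertheless be told apart,
    hence a figure eight: its branches through the origin are transversal, and since [L] is odd the
    two ends keep opposite parity at all finer scales, so they stay on different branches. For the
    lower bound one term of the series has to dominate the others. Away from its scale the coarser
    terms shrink by the ratio 2 / (L a) < 1 and the finer ones by a; splitting the scales into M
    residue classes replaces these ratios by their M-th powers, which can be made as small as
    needed. Local topology cannot distinguish the tangents: each is a line away from its base
    points, and every base point, of a small loop or a big one, is a crossing of two branches. Hence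
    an invariant that counts. Bounds on the count suffice, because the ranges for k = 0, 4, 8, ...
    are disjoint. *)

Lemma sin_mvt x y : x < y -> exists2 c : R, x < c < y & sin y - sin x = cos c * (y - x).
Proof.
move=> xy; have [|c] := @MVT R sin cos x y xy (fun z _ => is_derive_sin z).
  by apply: continuous_subspaceT => z; exact: continuous_sin.
by rewrite in_itv /= => cxy ->; exists c.
Qed.

Lemma sin_lipschitz x y : `|sin x - sin y| <= `|x - y|.
Proof.
wlog xy : x y / x <= y => [H|].
  by case: (leP x y) => [/H//|/ltW/H]; rewrite distrC (distrC y).
move: xy; rewrite le_eqVlt => /orP[/eqP ->|/sin_mvt[c _ e]].
  by rewrite !subrr.
rewrite distrC e (distrC x) normrM ler_piMl //.
by rewrite ler_norml cos_geN1 cos_le1.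
Qed.

(** With [z = x / 2] the mean value theorem gives [sin z >= z * cos z], and [cos x >= 0] forces
    [cos z ^+ 2 >= 1 / 2]; hence [sin x = 2 * sin z * cos z >= z]. *)
Lemma sin_ge_half x : 0 <= x <= pi / 2 -> x / 2 <= sin x.
Proof.
move=> /andP[x0 xpi]; move: x0; rewrite le_eqVlt => /orP[/eqP <-|x0].
  by rewrite sin0 mul0r.
set z := x / 2; have xE : x = z + z by rewrite /z; lra.
have p0 := @pi_ge0 R.
have z0 : 0 < z by rewrite /z; lra.
have [c /andP[c0 cz] e] := sin_mvt z0.
have cosz : 0 <= cos z by apply: cos_ge0_pihalf; lra.
have cosx : 0 <= cos x by apply: cos_ge0_pihalf; lra.
have cosc : cos z <= cos c.
  have := @ltr_cos R c z; rewrite !in_itv /=.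
  move=> H; apply: ltW; rewrite H //; apply/andP; split; lra.
have c2 := cos2Dsin2 z.
have s1 : sin z >= z * cos z by move: e; rewrite sin0 !subr0 => ->; nra.
have e1 : cos x = cos z * cos z - sin z * sin z by rewrite {1}xE trigo.cosD.
have e2 : sin x = sin z * cos z + cos z * sin z by rewrite {1}xE trigo.sinD.
have h : 1 <= 2 * (cos z * cos z) by move: c2; rewrite !expr2; lra.
rewrite e2.
have h3 : z * cos z * cos z <= sin z * cos z by apply: ler_wpM2r.
nra.
Qed.

End Trigonometry.

Section FigureEight.
Variable R : realType.
Implicit Types x y z : R.

Definition phi (c : bool) (x : R) : R := sin (c.+1%:R * (pi * x)).

Lemma phi_le1 c x : `|phi c x| <= 1.
Proof. by rewrite ler_norml sin_geN1 sin_le1. Qed.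

Lemma phi_lipschitz c x y : `|phi c x - phi c y| <= 2 * pi * `|x - y|.
Proof.
apply: le_trans (sin_lipschitz _ _) _.
rewrite -mulrBr -mulrBr !normrM (ger0_norm (pi_ge0 R)) mulrA.
apply: ler_wpM2r => //; apply: ler_wpM2r; first exact: pi_ge0.
by rewrite ger0_norm // ler_nat; case: c.
Qed.

Lemma sin_pi_int (i : int) : sin (pi * i%:~R) = 0 :> R.
Proof.
have H (n : nat) : sin (pi * n%:R) = 0 :> R.
  by have := alternatingn (@sinDpi R) n 0; rewrite sin0 mulr0 add0r mulr_natr.
case: i => n; first exact: H.
by rewrite NegzE mulrNz mulrN sinN H oppr0.
Qed.

Lemma cos_pi_int2 (i : int) : cos (pi * i%:~R) * cos (pi * i%:~R) = 1 :> R.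
Proof.
by have := cos2Dsin2 (pi * i%:~R : R); rewrite sin_pi_int expr0n addr0 expr2.
Qed.

Lemma phi_int c (i : int) : phi c i%:~R = 0.
Proof.
rewrite /phi; have -> : c.+1%:R * (pi * i%:~R) = pi * (i *+ c.+1)%:~R :> R.
  by rewrite mulrCA rmorphMn /= mulr_natl.
exact: sin_pi_int.
Qed.

Lemma phiD_int (i : int) x :
  phi false (i%:~R + x) = cos (pi * i%:~R) * phi false x /\
  phi true (i%:~R + x) = phi true x.
Proof.
have h1 : sin (pi * i%:~R : R) = 0 by exact: sin_pi_int.
have h2 := cos_pi_int2 i.
rewrite /phi; split.
  by rewrite !mul1r mulrDr trigo.sinD h1 mul0r add0r.
have -> : 2 * (pi * (i%:~R + x)) = (pi * i%:~R + pi * i%:~R) + 2 * (pi * x) :> R.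
  by ring.
by rewrite trigo.sinD trigo.sinD trigo.cosD h1 h2 !mul0r !mulr0 !subr0 addr0 mul0r add0r mul1r.
Qed.

Lemma phi_false_ge x : 0 <= x <= 1 / 2 -> x <= phi false x.
Proof.
move=> x01; have p2 := @pi_ge2 R.
have /sin_ge_half H : 0 <= pi * x <= pi / 2 by nra.
rewrite /phi mul1r; apply: le_trans H; nra.
Qed.

Lemma phi_true_ge x : 0 <= x <= 1 / 4 -> x <= phi true x.
Proof.
move=> x01; have p2 := @pi_ge2 R.
have /sin_ge_half H : 0 <= 2 * (pi * x) <= pi / 2 by nra.
rewrite /phi; apply: le_trans H; nra.
Qed.

Lemma phiN c x : phi c (- x) = - phi c x.
Proof. by rewrite /phi !mulrN sinN. Qed.

(** [cos (2 * x) = 2 * cos x ^+ 2 - 1] is below -1/2 once [|cos x| < 1 / 2]: the two harmonics of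
    [phi] are never stationary together. *)
Lemma cos_dichotomy x : 1 <= `|cos x| * 2 \/ 1 <= `|cos (2 * x)| * 2.
Proof.
have [h|h] := leP 1 (`|cos x| * 2); [by left|right].
have -> : 2 * x = x + x by ring.
have c2 := cos2Dsin2 x; have : `|cos x| ^+ 2 = cos x ^+ 2 by rewrite real_normK // num_real.
rewrite trigo.cosD; have := normr_ge0 (cos x); have := ler_norm (- (cos x * cos x - sin x * sin x)).
rewrite normrN; move: c2; rewrite !expr2; nra.
Qed.

Lemma sinB_prod x y : sin x - sin y = 2 * (cos ((x + y) / 2) * sin ((x - y) / 2)).
Proof.
set p := (x + y) / 2; set q := (x - y) / 2.
have -> : x = p + q by rewrite /p /q; field.
have -> : y = p - q by rewrite /p /q; field.
by rewrite trigo.sinD sinB; ring.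
Qed.

Lemma sin_pi_ge x : `|x| <= 7 / 8 -> `|x| / 8 <= `|sin (pi * x)|.
Proof.
wlog x0 : x / 0 <= x => [H hx|].
  have [/H|/ltW x0] := leP 0 x; first exact.
  by have := H (- x); rewrite normrN mulrN sinN normrN; apply => //; lra.
rewrite (ger0_norm x0) => x1; apply: le_trans (ler_norm _).
have -> : sin (pi * x) = phi false x by rewrite /phi mul1r.
have [h|h] := leP x (1 / 2).
  by apply: le_trans (phi_false_ge _); lra.
have -> : phi false x = phi false (1 - x).
  rewrite /phi !mul1r mulrBr mulr1 addrC sinDpi -mulrN.
  by rewrite mulrN sinN opprK.
by apply: le_trans (phi_false_ge _); lra.
Qed.

(** Sum-to-product formulas give the differences [2 cos A sin D] and [2 cos (2 A) sin (2 D)], and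
    one of the two cosines is at least 1/2 in absolute value. The bound 7/8 keeps [x - y] away from
    1, where both coordinates may agree. *)
Lemma phi_separated x y : `|x - y| <= 7 / 8 ->
  exists c, `|x - y| / 16 <= `|phi c x - phi c y|.
Proof.
move=> xy; set A := pi * (x + y) / 2; set D := pi * (x - y) / 2.
have e0 : phi false x - phi false y = 2 * (cos A * sin D).
  rewrite /phi !mul1r sinB_prod -mulrDr -mulrBr.
  by rewrite /A /D.
have e1 : phi true x - phi true y = 2 * (cos (2 * A) * sin (pi * (x - y))).
  rewrite /phi /= sinB_prod; congr (2 * (cos _ * sin _)); rewrite ?/A; by field.
have DE : D = pi * ((x - y) / 2) by rewrite /D mulrA.
have := normr_ge0 (x - y).
have n2 : `|(x - y) / 2| = `|x - y| / 2 by rewrite normrM [X in _ * X]ger0_norm // invr_ge0.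
case: (cos_dichotomy A) => h n0.
  exists false; rewrite e0 !normrM (ger0_norm (_ : 0 <= 2)) //.
  have : `|x - y| / 16 <= `|sin D|; last by have := normr_ge0 (sin D); nra.
  have : `|(x - y) / 2| <= 1 / 2 by rewrite n2; lra.
  move=> h5; have : `|(x - y) / 2| <= 7 / 8 by lra.
  by move=> /sin_pi_ge; rewrite -DE n2; lra.
exists true; rewrite e1 !normrM (ger0_norm (_ : 0 <= 2)) //.
have := sin_pi_ge xy; have := normr_ge0 (sin (pi * (x - y))); nra.
Qed.

Lemma sqr1_norm (e : R) : e * e = 1 -> `|e| = 1.
Proof.
move=> h; have : `|e| * `|e| = 1 by rewrite -normrM h normr1.
by have := normr_ge0 e; nra.
Qed.

(* The figure eight crosses itself transversally at the origin, which it
   visits exactly at integer times, along branches alternating with parity. *)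
Lemma phi_transversal (i : int) (o : nat) x y : odd o ->
  `|x| <= 1 / 4 -> `|y| <= 1 / 4 ->
  exists c, `|x| <= `|phi c (i%:~R + x) - phi c ((i + o%:Z)%:~R + y)| /\
            `|y| <= `|phi c (i%:~R + x) - phi c ((i + o%:Z)%:~R + y)|.
Proof.
move=> oo hx hy.
have [f1 t1] := phiD_int i x; have [f2 t2] := phiD_int (i + o%:Z) y.
have eN : cos (pi * (i + o%:Z)%:~R) = - cos (pi * i%:~R) :> R.
  rewrite intrD mulrDr mulr_natr (alternatingn (@cosDpi R)).
  by rewrite -signr_odd oo expr1 mulN1r.
have e1 := sqr1_norm (cos_pi_int2 i).
have pos z : 0 <= z <= 1 / 4 -> z <= phi false z /\ z <= phi true z.
  by move=> hz; split; [apply: phi_false_ge|apply: phi_true_ge]; lra.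
have F : `|phi false (i%:~R + x) - phi false ((i + o%:Z)%:~R + y)| =
         `|phi false x + phi false y|.
  by rewrite f1 f2 eN mulNr opprK -mulrDr normrM e1 mul1r.
have T : `|phi true (i%:~R + x) - phi true ((i + o%:Z)%:~R + y)| =
         `|phi true x - phi true y| by rewrite t1 t2.
have px := pos `|x|; have py := pos `|y|.
have {}px : `|x| <= phi false `|x| /\ `|x| <= phi true `|x| by apply: px; rewrite normr_ge0.
have {}py : `|y| <= phi false `|y| /\ `|y| <= phi true `|y| by apply: py; rewrite normr_ge0.
have Q c z : phi c `|z| = phi c z \/ phi c `|z| = - phi c z.
  by case: (ger0P z) => _; [left|right; rewrite phiN].
have nx := normr_ge0 x; have ny := normr_ge0 y.
(* Up to sign, the first harmonic adds the two displacements and the second subtracts them; the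
   signs of x and y tell which of the two has no cancellation. *)
have [sx|sx] := leP 0 x; have [sy|sy] := leP 0 y.
- exists false; rewrite F; move: px py; rewrite (ger0_norm sx) (ger0_norm sy) => px py.
  rewrite ger0_norm; lra.
- exists true; rewrite T; move: px py; rewrite (ger0_norm sx) (ltr0_norm sy) !phiN => px py.
  rewrite ger0_norm; lra.
- exists true; rewrite T; move: px py; rewrite (ger0_norm sy) (ltr0_norm sx) !phiN => px py.
  rewrite ler0_norm; lra.
- exists false; rewrite F; move: px py; rewrite (ltr0_norm sy) (ltr0_norm sx) !phiN => px py.
  rewrite ler0_norm; lra.
Qed.

End FigureEight.

(** * Clocks with stopped intervals *)

Section Collapse.
Variables (R : realType) (L : nat).
Hypothesis L13 : 13 <= L%:R :> R.
Implicit Types (x y r : R) (i : int).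

(** Slope 2 on [2, 3] makes up for the unit lost on [1, 2], so that the map is the identity again
    from 3 on and can be repeated with period [L]. *)
Definition plateau r :=
  if r <= 1 then r else if r <= 2 then 1 else if r <= 3 then 2 * r - 3 else r.

Lemma plateauP r : [\/ r <= 1 /\ plateau r = r, 1 <= r <= 2 /\ plateau r = 1,
  2 <= r <= 3 /\ plateau r = 2 * r - 3 | 3 <= r /\ plateau r = r].
Proof.
rewrite /plateau; case: (leP r 1) => r1; first by constructor 1.
case: (leP r 2) => r2; first by constructor 2; split=> //; lra.
by case: (leP r 3) => r3; [constructor 3|constructor 4]; split=> //; lra.
Qed.

Lemma plateau_bounds r : r - 1 <= plateau r <= r.
Proof. by case: (plateauP r) => -[? ->]; lra. Qed.

Lemma plateau_lipschitz x y : x <= y -> 0 <= plateau y - plateau x <= 2 * (y - x).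
Proof. by move=> ?; case: (plateauP x) => -[? ->]; case: (plateauP y) => -[? ->]; lra. Qed.

Lemma plateau_id r : r <= 1 \/ 3 <= r -> plateau r = r.
Proof. by case: (plateauP r) => -[? ->] [?|?]; lra. Qed.

Lemma plateau_flat r : 1 <= r <= 2 -> plateau r = 1.
Proof. by case: (plateauP r) => -[? ->] ?; lra. Qed.

(** If the gap exceeds 7/8, more than 3/4 is lost, and length is lost on [1, 2] only, so x and y are
    near its ends. The value 7/8 is the range of [phi_separated]; 9/8 is the largest gap that a loss
    of 1 brings down to 1/8. *)
Lemma plateau_rigid x y : 1 / 2 < y - x <= 9 / 8 -> plateau y - plateau x < 1 / 8 ->
  y - x <= 7 / 8 \/ `|x - 1| <= 1 / 4 /\ `|y - 2| <= 1 / 4.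
Proof.
move=> h1 h2; have [?|h3] := leP (y - x) (7 / 8); [by left|right].
suff : -(1/4) <= x - 1 <= 1/4 /\ -(1/4) <= y - 2 <= 1/4 by rewrite !ler_norml => -[-> ->].
move: h2; case: (plateauP x) => -[? ->]; case: (plateauP y) => -[? ->]; lra.
Qed.

(* Nondecreasing, constant on the intervals [1, 2] + L Z, and equal to the
   identity outside the intervals [1, 3] + L Z. *)
Definition collapse y : R :=
  let k := (Num.floor (y / L%:R))%:~R in L%:R * k + plateau (y - L%:R * k).

Lemma cell_index y : exists i, 0 <= y - L%:R * i%:~R < L%:R /\
  collapse y = L%:R * i%:~R + plateau (y - L%:R * i%:~R).
Proof.
have l13 := L13.
exists (Num.floor (y / L%:R)); split => //.
have := floor_le (y / L%:R); have := floorD1_gt (y / L%:R).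
rewrite intrD1; move: (Num.floor _)%:~R => k.
have L0 : 0 < L%:R :> R by lra.
rewrite ltr_pdivrMr // ler_pdivlMr // => h1 h2; nra.
Qed.

Lemma collapseDL y i : collapse (y + L%:R * i%:~R) = collapse y + L%:R * i%:~R.
Proof.
have l13 := L13.
have L0 : L%:R != 0 :> R by apply: lt0r_neq0; lra.
rewrite /collapse; set k := Num.floor (y / _).
have -> : Num.floor ((y + L%:R * i%:~R) / L%:R) = k + i.
  have -> : (y + L%:R * i%:~R) / L%:R = y / L%:R + i%:~R by field.
  by rewrite floorDrz ?intr_int // intrKfloor.
rewrite intrD [RHS]addrAC -mulrDr; congr (_ + plateau _); ring.
Qed.

Lemma collapse_cell i y : 0 <= y - L%:R * i%:~R <= L%:R ->
  collapse y = L%:R * i%:~R + plateau (y - L%:R * i%:~R).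
Proof.
have l13 := L13.
move=> hy; have [k [hk ->]] := cell_index y.
have [->//|nik] := eqVneq i k.
have L0 : 0 < L%:R :> R by lra.
have : (i%:~R - k%:~R : R) * L%:R <= y - L%:R * k%:~R by lra.
have : - L%:R <= (i%:~R - k%:~R : R) * L%:R by lra.
have : k%:~R <= i%:~R - 1 :> R \/ i%:~R + 1 <= k%:~R :> R.
  have [?|?] := ltP k i; [left|right].
    by rewrite -(intrB _ _ 1) ler_int; lia.
  by rewrite -(intrD _ _ 1) ler_int; lia.
move=> [h|h] h1 h2; first by exfalso; nra.
have ki : k%:~R = i%:~R + 1 :> R.
  have : (k%:~R - i%:~R : R) * L%:R <= L%:R by lra.
  nra.
have yE : y = L%:R * k%:~R by rewrite ki; nra.
by rewrite yE ki subrr !plateau_id; [ring|right; lra|left; lra].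
Qed.

Lemma collapse_lipschitz x y : x <= y -> 0 <= collapse y - collapse x <= 2 * (y - x).
Proof.
have l13 := L13.
have L0 : 0 < L%:R :> R by lra.
move=> xy; have [i [hi ->]] := cell_index x; have [k [hk ->]] := cell_index y.
have [<-|nik] := eqVneq i k.
  have := @plateau_lipschitz (x - L%:R * i%:~R) (y - L%:R * i%:~R); lra.
have ik : i%:~R + 1 <= k%:~R :> R.
  rewrite -(intrD _ _ 1) ler_int.
  suff : (i < k)%R by lia.
  rewrite lt_neqAle nik /= -(ler_int R).
  have [//|h] := leP (i%:~R : R) k%:~R.
  have : k%:~R + 1 <= i%:~R :> R.
    rewrite -(intrD _ _ 1) ler_int; move: h; rewrite ltr_int; lia.
  nra.
have a1 := @plateau_lipschitz (x - L%:R * i%:~R) L%:R.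
have a2 := @plateau_lipschitz 0 (y - L%:R * k%:~R).
have p0 : plateau 0 = 0 by apply: plateau_id; left; lra.
have pL : plateau L%:R = L%:R by apply: plateau_id; right; lra.
rewrite p0 in a2; rewrite pL in a1; nra.
Qed.

Lemma collapse_bounds y : y - 1 <= collapse y <= y.
Proof.
have l13 := L13.
have [i [_ ->]] := cell_index y.
by have := plateau_bounds (y - L%:R * i%:~R); lra.
Qed.

Lemma collapse_id y : `|y| <= 1 / 4 -> collapse y = y.
Proof.
have l13 := L13.
rewrite ler_norml => hy; have [y0|y0] := leP 0 y.
  by rewrite (@collapse_cell 0) ?mulr0 ?subr0 ?plateau_id; lra.
have e1 : ((-1)%:~R : R) = -1 by rewrite rmorphN.
by rewrite (@collapse_cell (-1)) e1 ?plateau_id; try right; lra.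
Qed.

Lemma collapse_plateau i : collapse (1 + L%:R * i%:~R) = collapse (2 + L%:R * i%:~R).
Proof.
have l13 := L13.
rewrite !collapseDL !(@collapse_cell 0) ?mulr0 ?subr0 ?plateau_flat //; lra.
Qed.

Lemma collapse_rigid x y : 1 / 2 < y - x <= 9 / 8 -> collapse y - collapse x < 1 / 8 ->
  y - x <= 7 / 8 \/
  exists i, `|x - (1 + L%:R * i%:~R)| <= 1 / 4 /\ `|y - (2 + L%:R * i%:~R)| <= 1 / 4.
Proof.
have l13 := L13.
move=> xy; have [i [hi ->]] := cell_index x.
set x' := x - _ in hi *; have [h|h] := leP (y - L%:R * i%:~R) L%:R.
  rewrite (@collapse_cell i y); last by rewrite /x' in hi; lra.
  move=> h2.
  have [||a1|[a1 a2]] := @plateau_rigid x' (y - L%:R * i%:~R); rewrite /x' in h2 *.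
  - lra.
  - lra.
  - by left; rewrite /x' in a1; lra.
  right; exists i; rewrite /x' in a1.
  have <- : x - L%:R * i%:~R - 1 = x - (1 + L%:R * i%:~R) by ring.
  by have <- : y - L%:R * i%:~R - 2 = y - (2 + L%:R * i%:~R) by ring.
(* Here y is in the next cell, within 9/8 of its start, where [plateau] loses at most 1/8: the gap
   cannot have dropped below 1/8. *)
rewrite (@collapse_cell (i + 1) y) intrD1; last by rewrite /x' in hi; lra.
rewrite [plateau x']plateau_id; last by right; rewrite /x'; lra.
have : y - L%:R * (i%:~R + 1) - 1 / 8 <= plateau (y - L%:R * (i%:~R + 1)).
  have : 0 <= y - L%:R * (i%:~R + 1) <= 9 / 8 by rewrite /x' in hi; lra.
  by case: (plateauP (y - L%:R * (i%:~R + 1))) => -[? ->]; lra.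
rewrite /x'; lra.
Qed.

End Collapse.

(** * Positions after all finer collapses *)

Section Levels.
Variables (R : realType) (L : nat) (b : nat -> bool).
Hypothesis L13 : 13 <= L%:R :> R.
Implicit Types (x y t u : R) (i : int) (n d : nat).

(** Argument and value are positions in units of [L ^- n.+1]; the division by [L] that passes to
    scale n comes afterwards. *)
Definition step n y : R := if b n then collapse L y else y.

Lemma step_lipschitz n x y : x <= y -> 0 <= step n y - step n x <= 2 * (y - x).
Proof.
rewrite /step; case: (b n) => xy; last by lra.
by have := collapse_lipschitz L13 xy.
Qed.

Lemma step_bounds n y : y - 1 <= step n y <= y.
Proof.
by rewrite /step; case: (b n); [exact: collapse_bounds|lra].
Qed.

Lemma stepDL n y i : step n (y + L%:R * i%:~R) = step n y + L%:R * i%:~R.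
Proof. by rewrite /step; case: (b n) => //; exact: collapseDL. Qed.

Lemma step_id n y : `|y| <= 1 / 4 -> step n y = y.
Proof. by rewrite /step; case: (b n) => // /(collapse_id L13). Qed.

Fixpoint approx d n y : R :=
  if d is d'.+1 then step n (approx d' n.+1 (L%:R * y)) / L%:R else y.

Lemma approx_le d n y : approx d.+1 n y <= approx d n y.
Proof.
have l13 := L13; have L0 : 0 < L%:R :> R by lra.
elim: d n y => [|d IH] n y.
  by rewrite /= ler_pdivrMr // [y * _]mulrC; have /andP[] := step_bounds n (L%:R * y).
rewrite -[approx d.+2 n y]/(step n (approx d.+1 n.+1 (L%:R * y)) / L%:R).
rewrite -[approx d.+1 n y]/(step n (approx d n.+1 (L%:R * y)) / L%:R).
rewrite ler_pM2r ?invr_gt0 //.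
by have := step_lipschitz n (IH n.+1 (L%:R * y)); lra.
Qed.

(** 1/12 solves [e = (1 + e) / 13], so a total loss of at most 1/12 reproduces itself from scale to
    scale for every [L] from 13 on. *)
Lemma approx_near d n y : y - 1 / 12 <= approx d n y <= y.
Proof.
have l13 := L13; have L0 : 0 < L%:R :> R by lra.
elim: d n y => [|d IH] n y /=; first by lra.
have := IH n.+1 (L%:R * y); have := step_bounds n (approx d n.+1 (L%:R * y)).
by rewrite ler_pdivrMr // ler_pdivlMr //; nra.
Qed.

Lemma approx_mono d n x y : x <= y -> approx d n x <= approx d n y.
Proof.
have l13 := L13; have L0 : 0 < L%:R :> R by lra.
elim: d n x y => [//|d IH] n x y xy /=.
rewrite ler_pM2r ?invr_gt0 //.
have : L%:R * x <= L%:R * y by rewrite ler_pM2l.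
by move=> /(IH n.+1)/(step_lipschitz n); lra.
Qed.

Lemma approxDi d n y i : approx d n (y + i%:~R) = approx d n y + i%:~R.
Proof.
have l13 := L13; have L0 : L%:R != 0 :> R by apply: lt0r_neq0; lra.
elim: d n y i => [//|d IH] n y i /=.
have -> : L%:R * (y + i%:~R) = L%:R * y + (L%:Z * i)%:~R.
  by rewrite intrM; ring.
rewrite IH intrM stepDL; by field.
Qed.

(* The position of t at scale L ^- n, after collapsing all loops whose own
   scale is L ^- n or finer. *)
Definition level n t : R := limn (fun d => approx d n (L%:R ^+ n * t)).

Lemma level_cvg n t : approx d n (L%:R ^+ n * t) @[d --> \oo] --> level n t.
Proof.
apply: nonincreasing_is_cvgn.
  by apply/nonincreasing_seqP => d; exact: approx_le.
exists (L%:R ^+ n * t - 1 / 12) => _ [d _ <-].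
by have /andP[] := approx_near d n (L%:R ^+ n * t).
Qed.

Lemma level_near n t : L%:R ^+ n * t - 1 / 12 <= level n t <= L%:R ^+ n * t.
Proof.
apply/andP; split.
  apply: (ler_cvg_to (cvg_cst _) (@level_cvg n t)); apply: nearW => d.
  by have /andP[] := approx_near d n (L%:R ^+ n * t).
apply: (ler_cvg_to (@level_cvg n t) (cvg_cst _)); apply: nearW => d.
by have /andP[] := approx_near d n (L%:R ^+ n * t).
Qed.

Lemma level_mono n t u : t <= u -> level n t <= level n u.
Proof.
have l13 := L13; have L0 : 0 < L%:R :> R by lra.
move=> tu; apply: (ler_cvg_to (@level_cvg n t) (@level_cvg n u)).
apply: nearW => d; apply: approx_mono.
by rewrite ler_pM2l // exprn_gt0.
Qed.

Lemma levelDi n t i : level n (t + i%:~R / L%:R ^+ n) = level n t + i%:~R.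
Proof.
have l13 := L13; have L0 : L%:R != 0 :> R by apply: lt0r_neq0; lra.
apply: (cvg_unique _ (@level_cvg n _)) => //.
have -> : (fun d => approx d n (L%:R ^+ n * (t + i%:~R / L%:R ^+ n))) =
    (fun d => approx d n (L%:R ^+ n * t) + i%:~R).
  apply/funext => d; rewrite -approxDi; congr approx.
  by rewrite mulrDr mulrCA divff ?expf_neq0 // mulr1.
by apply: cvgD; [exact: level_cvg|exact: cvg_cst].
Qed.

(** Makes the levels of loop ends explicit: they are integers at every scale finer than that of the
    loop. *)
Lemma level_int n i : level n (i%:~R / L%:R ^+ n) = i%:~R.
Proof.
rewrite -[_ / _]add0r levelDi.
suff -> : level n 0 = 0 by rewrite add0r.
have l13 := L13; have L0 : 0 < L%:R :> R by lra.
apply: (cvg_unique _ (@level_cvg n _)) => //.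
rewrite mulr0 (_ : (fun d => _) = cst 0); first exact: cvg_cst.
apply/funext => d; elim: d n => [//|d IH] n /=.
by rewrite mulr0 IH step_id ?mul0r // normr0; lra.
Qed.

Lemma levelE n t : level n t = step n (level n.+1 t) / L%:R.
Proof.
have l13 := L13; have L0 : 0 < L%:R :> R by lra.
have H1 : approx d.+1 n (L%:R ^+ n * t) @[d --> \oo] --> level n t.
  by have := @level_cvg n t; rewrite -cvg_shiftS.
apply: (cvg_unique _ H1) => //=.
apply: cvgMr_tmp; apply/cvgrPdist_lt => e e0.
have := @level_cvg n.+1 t => /cvgrPdist_lt/(_ (e / 2)) H.
have e20 : 0 < e / 2 by lra.
near=> d.
have : `|level n.+1 t - approx d n.+1 (L%:R ^+ n.+1 * t)| < e / 2.
  by near: d; exact: H.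
rewrite mulrA -exprS; set p := level _ _; set q := approx _ _ _.
rewrite !ltr_norml => ?; have [h|/ltW h] := leP p q.
  by have := step_lipschitz n h; lra.
by have := step_lipschitz n h; lra.
Unshelve. all: by end_near.
Qed.

End Levels.

(** * Separation of times up to the loops *)

Section Separation.
Variables (R : realType) (L : nat) (b : nat -> bool).
Hypothesis L13 : 13 <= L%:R :> R.
Hypothesis L_odd : odd L.
Implicit Types (x y t u : R) (i : int) (m n j : nat).

Local Notation level := (level L b).
Local Notation q := (2 / L%:R : R).

Definition loop_start m i : R := (1 + L%:R * i%:~R) / L%:R ^+ m.+1.
Definition loop_end m i : R := (2 + L%:R * i%:~R) / L%:R ^+ m.+1.

Let L_gt0 : 0 < L%:R :> R. Proof. by apply: lt_le_trans L13. Qed.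

Lemma L_arch (e : R) : 0 < e -> exists n, 1 < L%:R ^+ n * e.
Proof.
move=> e0; have l13 := L13; pose n := Num.truncn e^-1; exists n.+1.
have H : e^-1 < n.+1%:R by apply: truncnS_gt; rewrite invr_ge0 ltW.
rewrite -ltr_pdivrMr // div1r; apply: lt_le_trans H _.
rewrite -natrX ler_nat ltnW // ltn_expl //.
by rewrite -(ltr_nat R); lra.
Qed.

Lemma level_contract n j t u :
  `|level n t - level n u| <= q ^+ j * `|level (n + j) t - level (n + j) u|.
Proof.
wlog tu : t u / t <= u => [H|].
  case: (leP t u) => [/H//|/ltW/H].
  by rewrite (distrC (level n u)) (distrC (level (n + j) u)).
elim: j => [|j IH]; first by rewrite expr0 mul1r addn0.
apply: le_trans IH _; rewrite exprSr -mulrA ler_pM2l; last first.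
  by rewrite exprn_gt0 // divr_gt0 // L_gt0.
have L0 := L_gt0.
rewrite addnS; have h1 := level_mono b L13 (n + j) tu; have h2 := level_mono b L13 (n + j).+1 tu.
rewrite distrC [in X in _ <= X]distrC !ger0_norm ?subr_ge0 //.
rewrite !(levelE b L13 (n + j)) -mulrBl mulrAC ler_pM2r ?invr_gt0 //.
by have /andP[] := step_lipschitz b L13 (n + j) h2.
Qed.

Lemma level_dist n t u : L%:R ^+ n * `|t - u| - 1 / 12 <= `|level n t - level n u| <=
  L%:R ^+ n * `|t - u| + 1 / 12.
Proof.
wlog tu : t u / t <= u => [H|].
  case: (leP t u) => [/H//|/ltW/H].
  by rewrite (distrC (level n u)) (distrC u).
have := level_near b L13 n t; have := level_near b L13 n u.
have := level_mono b L13 n tu => h.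
rewrite (distrC t) (distrC (level n t)) !ger0_norm ?subr_ge0 // mulrBr; lra.
Qed.

Lemma intP_loop i : ((1 + L%:Z * i)%:~R = 1 + L%:R * i%:~R :> R) *
  ((2 + L%:Z * i)%:~R = 2 + L%:R * i%:~R :> R).
Proof. by rewrite !intrD !intrM. Qed.

Lemma scale_up m j x : x / L%:R ^+ m = x * L%:R ^+ j / L%:R ^+ (m + j).
Proof.
have L0 : L%:R != 0 :> R by apply: lt0r_neq0; exact: L_gt0.
by rewrite exprD invfM mulrACA divff ?mulr1 // expf_neq0.
Qed.

Lemma level_start m j i : level (m.+1 + j) (loop_start m i) = ((1 + L%:Z * i) * L%:Z ^+ j)%:~R.
Proof.
rewrite /loop_start (scale_up _ j) -(intP_loop i).1 -[RHS](level_int b L13 (m.+1 + j)).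
by congr (level _ (_ / _)); rewrite intrM rmorphXn.
Qed.

Lemma level_end m j i : level (m.+1 + j) (loop_end m i) = ((2 + L%:Z * i) * L%:Z ^+ j)%:~R.
Proof.
rewrite /loop_end (scale_up _ j) -(intP_loop i).2 -[RHS](level_int b L13 (m.+1 + j)).
by congr (level _ (_ / _)); rewrite intrM rmorphXn.
Qed.

(** At scales finer than m both ends are integers, where [phi] vanishes; at scale m the collapse
    merges them, and the coarser levels depend only on level m. *)
Lemma phi_loop m i n c : b m ->
  phi c (level n (loop_start m i)) = phi c (level n (loop_end m i)).
Proof.
move=> bm; have [nm|nm] := leqP n m; last first.
  by rewrite -(subnKC nm) level_start level_end !phi_int.
congr phi; rewrite -(subKn nm); move: (m - n)%N (leq_subr n m) => d.
elim: d => [|d IH] dm; last first.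
  rewrite (levelE b L13) [RHS](levelE b L13) -subSn // subSS IH //; exact: ltnW.
rewrite subn0 (levelE b L13) [RHS](levelE b L13) /step bm.
have := level_start m 0 i; have := level_end m 0 i; rewrite addn0 => -> ->.
by rewrite !expr0 !mulr1 !intP_loop collapse_plateau.
Qed.

(** [step] is monotone and fixes 1/4 and -1/4. Applied at the first scale where a displacement
    exceeds 1/4: one scale earlier it is still bounded below. *)
Lemma level_step_up n t : 1 / 4 < `|level n.+1 t| -> 1 / (4 * L%:R) <= `|level n t|.
Proof.
have L0 := L_gt0; have a1 : `|1 / 4| <= 1 / 4 :> R by rewrite ger0_norm; lra.
have a2 : `|- (1 / 4)| <= 1 / 4 :> R by rewrite normrN.
have e1 := step_id b L13 n a1; have e2 := step_id b L13 n a2.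
have -> : 1 / (4 * L%:R) = (1 / 4) / L%:R :> R.
  by rewrite !mul1r invfM.
rewrite (levelE b L13 n) normrM [X in _ <= _ * X]gtr0_norm ?invr_gt0 // ler_pM2r ?invr_gt0 //.
move: (level _ _) => x; rewrite ltr_normr => /orP[h|h].
  have := step_lipschitz b L13 n (ltW h); rewrite e1 => ?.
  by apply: le_trans (ler_norm _); lra.
have h' : x <= - (1 / 4) by lra.
have := step_lipschitz b L13 n h'; rewrite e2 => ?.
by rewrite -normrN; apply: le_trans (ler_norm _); lra.
Qed.

Definition near_loop (e : R) t u := exists m i, b m /\
  (`|t - loop_start m i| <= e /\ `|u - loop_end m i| <= e \/
   `|u - loop_start m i| <= e /\ `|t - loop_end m i| <= e).

(** The input for the domination of term k: a lower bound at scale k and geometric decay towards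
    coarser scales. Finer terms are controlled by their amplitudes. *)
Definition separated_at k t u :=
  (exists c, 1 / (128 * L%:R) <= `|phi c (level k t) - phi c (level k u)|) /\ (forall n c, (n <= k)%N ->
     `|phi c (level n t) - phi c (level n u)| <= 2 * pi * q ^+ (k - n)).

Lemma separated_atC k t u : separated_at k t u -> separated_at k u t.
Proof.
move=> [[c h1] h2]; split; first by exists c; rewrite distrC.
by move=> n d nk; rewrite distrC; exact: h2.
Qed.

Lemma separated_at_close k t u : 1 / (8 * L%:R) <= `|level k t - level k u| <= 7 / 8 ->
  separated_at k t u /\ `|t - u| <= 2 / L%:R ^+ k.
Proof.
have L0 := L_gt0 => /andP[h1 h2].
have p0 := @pi_ge0 R; split; first split.
- have [c hc] := phi_separated h2; exists c; apply: le_trans hc.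
  rewrite (_ : 1 / (128 * L%:R) = 1 / (8 * L%:R) / 16); last by field; lra.
  by rewrite ler_pM2r ?invr_gt0.
- move=> n c nk; apply: le_trans (phi_lipschitz _ _ _) _.
  apply: ler_wpM2l; first by rewrite mulr_ge0.
  have := level_contract n (k - n) t u; rewrite subnKC // => H; apply: le_trans H _.
  by apply: ler_piMr; [rewrite exprn_ge0 // divr_ge0 // ltW|lra].
rewrite ler_pdivlMr ?exprn_gt0 // mulrC.
by have := level_dist k t u; lra.
Qed.

(* Two points either stay apart at the first scale where they are
   distinguishable, or are separated by a collapsed loop; in the latter case
   they are followed along the two branches through its base point. *)
Lemma separation t u : `|t - u| <= 1 / 4 -> t = u \/ near_loop 0 t u \/
  exists k, separated_at k t u /\
    (`|t - u| <= 2 / L%:R ^+ k \/ near_loop (1 / L%:R ^+ k) t u).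
Proof.
wlog tu : t u / t <= u => [H htu|].
  have [h|/ltW/H] := leP t u; first exact (H _ _ h htu).
  rewrite (distrC u) => /(_ htu)[->|[[m [i [bm h]]]|[k [h1 h2]]]]; [by left|right; left|right; right].
    by exists m, i; split=> //; tauto.
  exists k; split; first exact: separated_atC.
  case: h2 => [|[m [i [bm h]]]]; [move=> ?; left=> //|right].
  by exists m, i; split=> //; tauto.
have L0 := L_gt0; have l13 := L13 => htu.
move: tu; rewrite le_eqVlt => /orP[/eqP|tu]; [by left|right].
have [m0 m0P hmin] : exists2 m, 1 / 2 < `|level m t - level m u| &
    forall n, 1 / 2 < `|level n t - level n u| -> (m <= n)%N.
  have Hex : exists m, 1 / 2 < `|level m t - level m u|.
    have [|n hn] := @L_arch `|t - u|; first by rewrite normr_gt0 subr_eq0 lt_eqF.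
    by exists n; have := level_dist n t u; lra.
  by case: (ex_minnP Hex) => k hk kmin; exists k.
case: m0 => [|m] in m0P hmin.
  (* Scale 0 is excluded, the difference there being at most 1/4 + 1/12 < 1/2. This is why only
     times at distance at most 1/4 are compared. *)
  by have := level_dist 0 t u; rewrite expr0 mul1r; lra.
have dm : `|level m t - level m u| <= 1 / 2.
  by have [//|/hmin] := leP (`|level m t - level m u|) (1 / 2); rewrite ltnn.
have [h|h] := leP (1 / (8 * L%:R)) (`|level m t - level m u|).
  have [|h1 h2] := @separated_at_close m t u; first by rewrite h; lra.
  by right; exists m; split=> //; left.
set x := level m.+1 t; set y := level m.+1 u.
have xy : x <= y by exact: level_mono (ltW tu).
have xy2 : 1 / 2 < y - x by move: m0P; rewrite distrC ger0_norm ?subr_ge0.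
have {}h : step L b m y - step L b m x < 1 / 8.
  move: h; rewrite !(levelE b L13 m) -mulrBl normrM (gtr0_norm (_ : 0 < L%:R^-1)) ?invr_gt0 //.
  rewrite distrC ger0_norm; last by have := step_lipschitz b L13 m xy; lra.
  by rewrite ltr_pdivrMr // (_ : 1 / (8 * L%:R) * L%:R = 1 / 8); last by field; lra.
have bm : b m by apply/negPn/negP => /negbTE bm; move: h; rewrite /step bm; lra.
have := step_bounds b L13 m y; have := step_bounds b L13 m x.
rewrite /step bm in h *; move=> b1 b2.
have [||hd|[i [hx hy]]] := collapse_rigid L13 (x := x) (y := y); [lra|lra| |].
  have [|h1 h2] := @separated_at_close m.+1 t u.
    rewrite distrC ger0_norm ?subr_ge0 // -/x -/y.
    rewrite hd andbT ler_pdivrMr; [nra|lra].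
  by right; exists m.+1; split=> //; left.
set t0 := loop_start m i; set u0 := loop_end m i.
(* Both times are followed as displacements from the loop ends, whose levels are integers from scale
   [m.+1] on. *)
have shift j : level (m.+1 + j) t = ((1 + L%:Z * i) * L%:Z ^+ j)%:~R + level (m.+1 + j) (t - t0) /\
    level (m.+1 + j) u = ((2 + L%:Z * i) * L%:Z ^+ j)%:~R + level (m.+1 + j) (u - u0).
  have L0' : L%:R != 0 :> R by apply: lt0r_neq0.
  split; rewrite addrC -levelDi //; congr (level _ _).
    rewrite /t0 /loop_start (scale_up _ j) -(intP_loop i).1 intrM rmorphXn /=; ring.
  rewrite /u0 /loop_end (scale_up _ j) -(intP_loop i).2 intrM rmorphXn /=; ring.
have [t1 u1] : `|level m.+1 (t - t0)| <= 1 / 4 /\ `|level m.+1 (u - u0)| <= 1 / 4.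
  have := shift 0%N; rewrite addn0 !expr0 !mulr1 !intP_loop => -[s1 s2].
  move: hx hy; rewrite /x /y s1 s2 => hx hy.
  by split; [move: hx|move: hy]; rewrite addrAC subrr add0r.
have [e1|ne] := pselect (t = t0 /\ u = u0).
  left; exists m, i; split => //; left.
  by rewrite -/t0 -/u0 e1.1 e1.2 !subrr normr0.
right.
pose far j := (1 / 4 < `|level (m.+1 + j) (t - t0)|) || (1 / 4 < `|level (m.+1 + j) (u - u0)|).
have Hex : exists j, far j.
  have near0 n (s : R) : L%:R ^+ n * `|s| - 1 / 12 <= `|level n s|.
    have l0 : level n 0 = 0 :> R by have := level_int b L13 n 0; rewrite mul0r => e0; exact: e0.
    by have := level_dist n s 0; rewrite l0 !subr0 => /andP[].
  have grow (s : R) : s != 0 -> exists j, 1 / 4 < `|level (m.+1 + j) s|.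
    move=> s0; have [|n hn] := @L_arch `|s|; first by rewrite normr_gt0.
    exists n; have := near0 (m.+1 + n)%N s.
    have : L%:R ^+ n * `|s| <= L%:R ^+ (m.+1 + n) * `|s|.
      by rewrite ler_wpM2r // ler_weXn2l ?leq_addl //; lra.
    lra.
  have [e|/eqP e] := pselect (t = t0).
    have [e'|/eqP e'] := pselect (u = u0); first by case: ne.
    by have [|j hj] := grow (u - u0); [rewrite subr_eq0|exists j; rewrite /far hj orbT].
  by have [|j hj] := grow (t - t0); [rewrite subr_eq0|exists j; rewrite /far hj].
case: (ex_minnP Hex) => -[|j] farj jmin.
  by move: farj; rewrite /far addn0; lra.
have [nt nu] : `|level (m.+1 + j) (t - t0)| <= 1 / 4 /\ `|level (m.+1 + j) (u - u0)| <= 1 / 4.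
  have : ~~ far j by apply/negP => /jmin; rewrite ltnn.
  by rewrite /far negb_or -!leNgt => /andP[].
have [st su] := shift j.
exists (m.+1 + j)%N; split; first split.
(* At this scale the levels of the loop ends differ by [L ^ j]; its oddness puts them on different
   branches of the figure eight. *)
- have oL : odd (L ^ j) by rewrite oddX L_odd orbT.
  have [c [hc1 hc2]] := phi_transversal ((1 + L%:Z * i) * L%:Z ^+ j) oL nt nu.
  exists c; rewrite st su.
  have -> : (2 + L%:Z * i) * L%:Z ^+ j = (1 + L%:Z * i) * L%:Z ^+ j + (L ^ j)%:Z.
    by rewrite (_ : (L ^ j)%:Z = L%:Z ^+ j); [ring|rewrite -!natz natrX].
  have le4 : 1 / (128 * L%:R) <= 1 / (4 * L%:R) :> R.
    rewrite !mul1r lef_pV2 ?posrE; [|lra|lra]; lra.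
  move: farj; rewrite /far addnS => /orP[] /level_step_up h'.
    by apply: le_trans hc1; apply: le_trans h'.
  by apply: le_trans hc2; apply: le_trans h'.
- move=> n c nk; set k := (m.+1 + j)%N.
  have p0 := @pi_ge0 R.
  (* At coarser scales each time is compared with its own loop end, and the two ends have the same
     [phi] by [phi_loop]. *)
  have lip s s0 : `|level k s - level k s0| <= 1 / 4 ->
      `|phi c (level n s) - phi c (level n s0)| <= 2 * pi * (q ^+ (k - n) * (1 / 4)).
    move=> hs; apply: le_trans (phi_lipschitz _ _ _) _.
    apply: ler_wpM2l; first by rewrite mulr_ge0.
    have := level_contract n (k - n) s s0; rewrite subnKC // => H; apply: le_trans H _.
    apply: ler_wpM2l => //; by rewrite exprn_ge0 // divr_ge0 // ltW.
  have lt : `|level k t - level k t0| <= 1 / 4.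
    by rewrite st /k level_start addrAC subrr add0r.
  have lu : `|level k u - level k u0| <= 1 / 4.
    by rewrite su /k level_end addrAC subrr add0r.
  have h1 := lip _ _ lt; have h2 := lip _ _ lu.
  have e := phi_loop i n c bm; rewrite -/t0 -/u0 in e.
  have Q0 : 0 <= q ^+ (k - n) by rewrite exprn_ge0 // divr_ge0 // ltW.
  have PQ : 0 <= pi * q ^+ (k - n) by exact: mulr_ge0.
  move: h1 h2; rewrite e !ler_norml; move: (phi c _) (phi c _) (phi c _) PQ.
  rewrite !mulrA => z1 z2 z3; move: (pi * _) => w; lra.
have close (s : R) : `|level (m.+1 + j) s| <= 1 / 4 -> `|s| <= 1 / L%:R ^+ (m.+1 + j).
  move=> hs; rewrite ler_pdivlMr ?exprn_gt0 // mulrC.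
  have := level_near b L13 (m.+1 + j) s; have : 0 < L%:R ^+ (m.+1 + j) :> R by rewrite exprn_gt0.
  move: hs; rewrite ler_norml => hs L0' hl.
  by rewrite -[X in X * _ <= _]gtr0_norm // -normrM ler_norml; lra.
right; exists m, i; split=> //; left; split; exact: close.
Qed.

End Separation.

(** * The snowflake path *)

Definition ndist (m n : nat) : nat := ((m - n) + (n - m))%N.

Lemma geometric_dist_sum (R : realType) (s : R) (i0 K : nat) : 0 <= s < 1 ->
  \sum_(i < K) s ^+ ndist i i0 <= (1 + s) / (1 - s).
Proof.
move=> s01; have s1 : 0 < 1 - s by lra.
have A j : (j <= i0)%N -> \sum_(i < j) s ^+ ndist i i0 <= s ^+ (i0 - j).+1 / (1 - s).
  elim: j => [|j IH] ji; first by rewrite big_ord0 divr_ge0 ?exprn_ge0; lra.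
  rewrite big_ord_recr /=; move: (IH (ltnW ji)).
  have -> : ndist j i0 = (i0 - j)%N by rewrite /ndist; lia.
  rewrite subnSK //; set x := s ^+ (i0 - j); set S := \sum_(i < j) _.
  rewrite exprS -/x !ler_pdivlMr //; lra.
have B d : \sum_(i < i0 + d) s ^+ ndist i i0 <= (1 + s - s ^+ d) / (1 - s).
  elim: d => [|d IH].
    rewrite addn0 expr0; apply: le_trans (A _ (leqnn _)) _.
    by rewrite subnn expr1 ler_pM2r ?invr_gt0 //; lra.
  rewrite addnS big_ord_recr /=; move: IH.
  have -> : ndist (i0 + d) i0 = d by rewrite /ndist; lia.
  set x := s ^+ d; set S := \sum_(i < i0 + d) _.
  rewrite exprS -/x !ler_pdivlMr //; lra.
have [h|h] := leqP i0 K.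
  rewrite -(subnKC h); apply: le_trans (B _) _.
  rewrite ler_pM2r ?invr_gt0 //; have : 0 <= s ^+ (K - i0) by rewrite exprn_ge0; lra.
  lra.
apply: le_trans (A _ (ltnW h)) _; rewrite ler_pM2r ?invr_gt0 //.
have : s ^+ (i0 - K).+1 <= 1 by rewrite exprn_ile1; lra.
lra.
Qed.

Section SeriesBounds.
Variables (R : realType) (w : nat -> R) (B s : R) (i0 : nat).
Hypothesis s01 : 0 <= s < 1.
Hypothesis wB : forall i, `|w i| <= B * s ^+ ndist i i0.
Hypothesis w_cvg : cvgn (series w).

Let B_ge0 : 0 <= B.
Proof.
have := wB i0; rewrite (_ : ndist i0 i0 = 0%N) ?expr0 ?mulr1.
  exact: le_trans.
by rewrite /ndist subnn.
Qed.

Lemma series_upper : `|limn (series w)| <= B * ((1 + s) / (1 - s)).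
Proof.
apply: (ler_cvg_to (cvg_norm w_cvg) (cvg_cst _)); apply: nearW => K.
rewrite /series /= big_mkord; apply: le_trans (ler_norm_sum _ _ _) _.
apply: le_trans (ler_wpM2l B_ge0 (geometric_dist_sum i0 K s01)).
by rewrite mulr_sumr; apply: ler_sum.
Qed.

Lemma series_lower : `|w i0| - B * (2 * s / (1 - s)) <= `|limn (series w)|.
Proof.
have s01' := s01; apply: (ler_cvg_to (cvg_cst _) (cvg_norm w_cvg)).
exists i0.+1 => // K /= iK.
rewrite /series /= big_mkord (bigD1 (Ordinal iK)) //=.
set S := \sum_(_ < _ | _) _.
suff : `|S| <= B * (2 * s / (1 - s)).
  by move=> h; have := lerB_normD (w i0) S; lra.
apply: le_trans (ler_norm_sum _ _ _) _.
have h := geometric_dist_sum i0 K s01.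
rewrite (bigD1 (Ordinal iK)) //= in h.
rewrite [ndist i0 i0](_ : _ = 0%N) ?expr0 in h; last by rewrite /ndist subnn.
have -> : 2 * s / (1 - s) = (1 + s) / (1 - s) - 1 by field; lra.
rewrite -lerBrDl in h; apply: le_trans (ler_wpM2l B_ge0 h).
by rewrite mulr_sumr; apply: ler_sum.
Qed.

End SeriesBounds.

Section Coordinates.
Variables (R : realType) (L : nat) (b : nat -> bool) (a : R) (M : nat).
Hypothesis L13 : 13 <= L%:R :> R.
Hypothesis a01 : 0 < a < 1.
Hypothesis La2 : 2 < L%:R * a.
Hypothesis M_gt0 : (0 < M)%N.
Implicit Types (t u : R) (c : bool) (k : nat).

Local Notation level := (level L b).

Definition coord k c t : R :=
  limn (series (fun i => a ^+ (k + M * i) * phi c (level (k + M * i) t))).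

(** Finer terms gain a factor a per scale. Coarser ones contract by [2 / L] but have a larger
    amplitude, hence [2 / L / a], which is below 1 because [2 < L * a]. *)
Definition decay : R := Num.max a (2 / L%:R / a).

Lemma decay01 : 0 <= decay < 1.
Proof.
have l13 := L13; have a01' := a01; have la := La2.
rewrite /decay le_max; have -> /= : 0 <= a by lra.
rewrite gt_max; apply/andP; split; first by lra.
by rewrite ltr_pdivrMr ?ltr_pdivrMr; [nra|lra|lra].
Qed.

Lemma coord_cvg k c t :
  cvgn (series (fun i => a ^+ (k + M * i) * phi c (level (k + M * i) t))).
Proof.
have a01' := a01; apply: normed_cvg.
apply: (series_le_cvg (v_ := geometric 1 a)) => [n|n|n|] //=.
- by rewrite mulr_ge0 ?exprn_ge0; lra.
- rewrite mul1r normrM ger0_norm ?exprn_ge0; [|lra|lra].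
  apply: le_trans (_ : a ^+ (k + M * n) <= _).
    by rewrite ler_piMr ?phi_le1 ?exprn_ge0 //; lra.
  rewrite ler_wiXn2l //; [lra|lra|].
  by apply: leq_trans (leq_addl _ _); rewrite leq_pmull.
by apply: is_cvg_geometric_series; rewrite ger0_norm; lra.
Qed.

Definition term k c t u i := a ^+ (k + M * i) *
  (phi c (level (k + M * i) t) - phi c (level (k + M * i) u)).

Lemma coordB k c t u : coord k c t - coord k c u = limn (series (term k c t u)) /\
  cvgn (series (term k c t u)).
Proof.
have E : term k c t u = (fun i => a ^+ (k + M * i) * phi c (level (k + M * i) t)) -
    (fun i => a ^+ (k + M * i) * phi c (level (k + M * i) u)).
  by apply/funext => i; rewrite /term mulrBr.
rewrite E; split; last by apply: is_cvg_seriesB; exact: coord_cvg.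
by rewrite lim_seriesB //; exact: coord_cvg.
Qed.

(* Scales finer than L ^- k are controlled by the amplitude a ^ n, coarser
   ones by the contraction of the levels. *)
Lemma term_decay k (A : R) c t u : 2 <= A ->
  (forall n, (n <= k)%N -> `|phi c (level n t) - phi c (level n u)| <=
     A * (2 / L%:R) ^+ (k - n)) ->
  forall n, `|a ^+ n * (phi c (level n t) - phi c (level n u))| <=
    A * a ^+ k * decay ^+ ndist n k.
Proof.
have l13 := L13; have a01' := a01; move=> A2 H n.
have a0 : a != 0 by apply: lt0r_neq0; lra.
have L0 : L%:R != 0 :> R by apply: lt0r_neq0; lra.
rewrite normrM ger0_norm ?exprn_ge0; [|lra|lra].
have [nk|nk] := leqP n k.
  have -> : ndist n k = (k - n)%N by rewrite /ndist; lia.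
  have /(ler_wpM2l (_ : 0 <= a ^+ n)) := H n nk; rewrite ?exprn_ge0 //; last lra.
  move=> /(_ isT) h; apply: le_trans h _.
  have -> : a ^+ n * (A * (2 / L%:R) ^+ (k - n)) = A * a ^+ k * (2 / L%:R / a) ^+ (k - n).
    rewrite -[in a ^+ k](subnKC nk) exprD (expr_div_n _ a).
    have : a ^+ (k - n) != 0 by rewrite expf_neq0.
    by move: (a ^+ (k - n)) ((2 / L%:R) ^+ (k - n)) => z1 z2 z0; field.
  apply: ler_wpM2l; first by rewrite mulr_ge0 ?exprn_ge0; lra.
  have q0 : 0 <= 2 / L%:R / a by rewrite !divr_ge0; lra.
  have qd : 2 / L%:R / a <= decay by rewrite /decay le_max lexx orbT.
  by apply: lerXn2r => //; rewrite nnegrE //; exact: le_trans qd.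
have -> : ndist n k = (n - k)%N by rewrite /ndist; lia.
apply: le_trans (_ : a ^+ n * 2 <= _).
  apply: ler_wpM2l; first by rewrite exprn_ge0; lra.
  apply: le_trans (ler_normB _ _) _.
  by have := phi_le1 c (level n t); have := phi_le1 c (level n u); lra.
have ak0 : 0 <= a ^+ k by rewrite exprn_ge0; lra.
have ad : a <= decay by rewrite /decay le_max lexx.
have h : a ^+ (n - k) <= decay ^+ (n - k).
  by apply: lerXn2r => //; rewrite nnegrE; lra.
have u0 : 0 <= a ^+ k * a ^+ (n - k) by rewrite mulr_ge0 ?exprn_ge0; lra.
have := ler_wpM2l ak0 h; rewrite -[in X in _ -> X <= _](subnKC (ltnW nk)) exprD -(mulrA A).
by move: (a ^+ k * _) (a ^+ k * _) u0 => x y; nra.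
Qed.

Lemma coord_decay k c n (A : R) t u : 2 <= A ->
  (forall m, (m <= n)%N -> `|phi c (level m t) - phi c (level m u)| <=
     A * (2 / L%:R) ^+ (n - m)) ->
  `|coord k c t - coord k c u| <= A * ((1 + decay) / (1 - decay)) * a ^+ n.
Proof.
have a01' := a01; move=> A2 HA.
have [-> cv] := coordB k c t u.
have H := term_decay A2 HA.
(* The first scale of this residue class that is not below n; rounding up makes the distance from i
   to i0 at most that from scale [k + M * i] to n. *)
pose i0 := ((n - k + M.-1) %/ M)%N.
rewrite mulrAC; apply: (@series_upper _ _ _ _ i0 decay01 _ cv) => i.
apply: le_trans (H _) _; apply: ler_wpM2l.
  by rewrite mulr_ge0 ?exprn_ge0; lra.
have [d0 d1] := andP decay01; apply: ler_wiXn2l => //; first exact: ltW.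
have := divn_eq (n - k + M.-1) M; have := ltn_mod (n - k + M.-1) M; rewrite M_gt0 -/i0.
move: (_ %% M)%N => r rM e; have [ii|ii] := leqP i i0.
  have [d dE] : exists d, i0 = (i + d)%N by exists (i0 - i)%N; rewrite subnKC.
  have : (d <= d * M)%N by rewrite leq_pmulr.
  case: d => [|d] in dE *; rewrite /ndist dE in e *; first by lia.
  have : (d <= d * M)%N by rewrite leq_pmulr.
  by rewrite mulnDl mulSn (mulnC M i) in e *; lia.
have [d dE] : exists d, i = (i0 + d)%N by exists (i - i0)%N; rewrite subnKC // ltnW.
have : (d <= M * d)%N by rewrite leq_pmull.
by rewrite /ndist dE mulnDr (mulnC M i0); lia.
Qed.

Lemma coord_upper k c n t u : `|t - u| <= 1 / L%:R ^+ n ->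
  `|coord k c t - coord k c u| <= 8 * pi * ((1 + decay) / (1 - decay)) * a ^+ n.
Proof.
have l13 := L13; have p2 := @pi_ge2 R => tu.
have L0 : 0 < L%:R :> R by lra.
apply: coord_decay => [|m mn]; first by lra.
apply: le_trans (phi_lipschitz _ _ _) _.
have := level_contract b L13 m (n - m) t u; rewrite subnKC // => h.
have h2 : `|level n t - level n u| <= 2.
  have := level_dist b L13 n t u.
  have : L%:R ^+ n * `|t - u| <= 1.
    by rewrite mulrC -ler_pdivlMr ?exprn_gt0.
  lra.
have h3 : 0 <= (2 / L%:R : R) ^+ (n - m) by rewrite exprn_ge0 // divr_ge0 // ltW.
have h4 := ler_wpM2l h3 h2.
have h5 : `|level m t - level m u| <= (2 / L%:R) ^+ (n - m) * 2 by exact: le_trans h h4.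
have h6 : 0 <= 2 * pi :> R by lra.
have := ler_wpM2l h6 h5; move: (_ ^+ (n - m)) h3 => z h3 h7.
have : 0 <= pi * z by rewrite mulr_ge0 //; lra.
lra.
Qed.

Lemma coord_bounded k c t u :
  `|coord k c t - coord k c u| <= 8 * pi * ((1 + decay) / (1 - decay)).
Proof.
have p2 := @pi_ge2 R; rewrite -[leRHS]mulr1 -[1](expr0 a).
apply: coord_decay => [|m]; first by lra.
rewrite leqn0 => /eqP ->; rewrite expr0 mulr1; apply: le_trans (ler_normB _ _) _.
by have := phi_le1 c (level 0 t); have := phi_le1 c (level 0 u); lra.
Qed.

(** Within the class of k the other terms sit at distances that are multiples of M, so they sum to
    at most a two-sided geometric series of ratio [decay ^+ M]. *)
Lemma coord_lower k t u : separated_at L b k t u -> exists c,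
  a ^+ k * (1 / (128 * L%:R) - 2 * pi * (2 * decay ^+ M / (1 - decay ^+ M))) <=
  `|coord (k %% M) c t - coord (k %% M) c u|.
Proof.
have a01' := a01; have p2 := @pi_ge2 R.
move=> [[c hc] H]; exists c.
have [-> cv] := coordB (k %% M) c t u.
pose i0 := (k %/ M)%N.
have kE : (k %% M + M * i0)%N = k by rewrite /i0 mulnC addnC -divn_eq.
have H' := @term_decay k (2 * pi) c t u _ (H^~ c).
have [d0 d1] := andP decay01.
apply: le_trans (@series_lower _ _ (2 * pi * a ^+ k) (decay ^+ M) i0 _ _ cv).
- rewrite /term kE normrM ger0_norm ?exprn_ge0; [|lra|lra].
  rewrite mulrBr [X in _ - X]mulrCA mulrA lerD2r ler_pM2l // exprn_gt0; lra.
- by rewrite exprn_ge0 //= exprn_ilt1 // -lt0n.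
- move=> i; rewrite /term; apply: le_trans (H' _ _) _; first by lra.
  rewrite -exprM; apply: ler_wpM2l; first by rewrite !mulr_ge0 ?exprn_ge0; lra.
  suff -> : ndist (k %% M + M * i) k = (M * ndist i i0)%N by [].
  by rewrite -[X in ndist _ X]kE /ndist !subnDl mulnDr !mulnBr.
Qed.

Lemma coord_loop k c m i : b m ->
  coord k c (loop_start R L m i) = coord k c (loop_end R L m i).
Proof.
move=> bm; congr (limn (series _)); apply/funext => n.
by rewrite phi_loop.
Qed.

End Coordinates.

Lemma near_loop_le (R : realType) (L : nat) b (e1 e2 t u : R) : e1 <= e2 ->
  near_loop L b e1 t u -> near_loop L b e2 t u.
Proof.
move=> e12 [m [i [bm h]]]; exists m, i; split => //.
by case: h => -[h1 h2]; [left|right]; split; apply: le_trans e12.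
Qed.

Section SnowflakeExponent.
Variables (R : realType) (s : R) (L : nat) (b : nat -> bool) (M : nat).
Hypothesis s1 : 1 < s.
Hypothesis L13 : 13 <= L%:R :> R.
Hypothesis L_odd : odd L.
Let a : R := L%:R^-1 `^ s^-1.
Hypothesis La2 : 2 < L%:R * a.
Hypothesis M_gt0 : (0 < M)%N.
Hypothesis M_large : 2 * pi * (2 * decay L a ^+ M / (1 - decay L a ^+ M)) <= 1 / (256 * L%:R).

Let L_gt0 : 0 < L%:R :> R. Proof. exact: lt_le_trans L13. Qed.

Lemma ratio_exp n : (L%:R ^+ n)^-1 `^ s^-1 = a ^+ n.
Proof.
have L0 := L_gt0; rewrite -exprVn -[in LHS]powR_mulrn; last by rewrite invr_ge0 ltW.
rewrite -[RHS]powR_mulrn; last exact: powR_ge0.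
by rewrite /a -!powRrM mulrC.
Qed.

Lemma ratio01 : 0 < a < 1.
Proof.
have L0 := L_gt0; have s1' := s1; have l13 := L13.
have s0 : 0 < s^-1 by rewrite invr_gt0; lra.
rewrite powR_gt0 ?invr_gt0 //=.
have -> : 1 = 1 `^ s^-1 :> R by rewrite powR1.
rewrite gt0_ltr_powR ?nnegrE ?invr_ge0 ?ltW //.
by rewrite invf_lt1; lra.
Qed.

Lemma ratio_expK n : (a ^+ n) `^ s = 1 / L%:R ^+ n.
Proof.
have L0 := L_gt0; have s1' := s1; have s0 : s != 0 by apply: lt0r_neq0; lra.
by rewrite -ratio_exp -powRrM mulVf // powRr1 ?div1r // invr_ge0 exprn_ge0 // ltW.
Qed.

Lemma scale_between (d : R) : 0 < d <= 1 -> exists n, 1 / L%:R ^+ n.+1 < d <= 1 / L%:R ^+ n.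
Proof.
have L0 := L_gt0 => /andP[d0 d1].
have Hex : exists n, 1 / L%:R ^+ n < d.
  have [n hn] := L_arch L13 d0; exists n.
  by rewrite ltr_pdivrMr ?exprn_gt0 // mulrC.
case: (ex_minnP Hex) => -[|n] hn nmin.
  by move: hn; rewrite expr0; lra.
exists n; rewrite hn leNgt /=; apply/negP => /nmin; by rewrite ltnn.
Qed.

(** [a ^+ n] is the power 1/s of [L ^- n], so [coord_upper] is a Hölder bound up to the factor
    [a^-1] lost in rounding the distance to a scale; distances above 1 use boundedness. *)
Lemma coord_holder : exists2 C, 0 <= C & forall k c t u,
  `|coord L b a M k c t - coord L b a M k c u| <= C * `|t - u| `^ s^-1.
Proof.
have L0 := L_gt0; have s1' := s1; have a01 := ratio01.
have [d0 d1] := andP (decay01 L13 a01 La2); have p2 := @pi_ge2 R.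
set D := 8 * pi * ((1 + decay L a) / (1 - decay L a)).
have D0 : 0 <= D by rewrite /D; apply: mulr_ge0; [lra|apply: divr_ge0; lra].
have aV : 1 <= a^-1 by rewrite invf_ge1; lra.
have s0 : 0 <= s^-1 by rewrite invr_ge0; lra.
exists (D / a) => [|k c t u]; first by apply: divr_ge0 => //; lra.
have [->|tu] := eqVneq t u.
  by rewrite subrr normr0 mulr_ge0 ?powR_ge0 // divr_ge0 //; lra.
have tu0 : 0 < `|t - u| by rewrite normr_gt0 subr_eq0.
rewrite -mulrA; have [h|h] := leP `|t - u| 1.
  have [|n /andP[n1 n2]] := @scale_between `|t - u|; first by rewrite tu0.
  apply: le_trans (coord_upper b L13 a01 La2 M_gt0 _ _ n2) _; rewrite -/D.
  apply: ler_wpM2l => //; rewrite mulrC ler_pdivlMr; last by lra.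
  rewrite -exprSr -ratio_exp; apply: ge0_ler_powR => //; last by rewrite -div1r ltW.
  by rewrite nnegrE invr_ge0; apply: exprn_ge0; exact: ltW.
apply: le_trans (coord_bounded b L13 a01 La2 M_gt0 _ _ _ _) _; rewrite -/D.
rewrite -[leLHS]mulr1; apply: ler_wpM2l => //.
apply: (le_trans aV); rewrite -[leLHS]mulr1; apply: ler_wpM2l; first lra.
have -> : 1 = 1 `^ s^-1 :> R by rewrite powR1.
by apply: ge0_ler_powR; rewrite ?nnegrE //; lra.
Qed.

Lemma coord_separated : exists2 K, 0 < K & forall t u e, `|t - u| <= 1 / 4 -> 0 <= e ->
  (forall k c, (k < M)%N -> `|coord L b a M k c t - coord L b a M k c u| <= e) ->
  `|t - u| <= K * e `^ s \/ near_loop L b (K * e `^ s) t u.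
Proof.
have L0 := L_gt0; have s1' := s1; have a01 := ratio01.
pose c0 : R := 1 / (256 * L%:R).
have c00 : 0 < c0 by rewrite /c0 divr_gt0 //; lra.
(* c0 is half of the main term [1 / (128 * L)], the other half absorbing the remaining terms. From
   [a ^+ k * c0 <= e], raising to the power s bounds [2 / L ^+ k]. *)
exists (2 / c0 `^ s); first by rewrite divr_gt0 // powR_gt0.
move=> t u e tu e0 He; set r := _ * _.
have r0 : 0 <= r by rewrite /r mulr_ge0 ?powR_ge0 // divr_ge0 // powR_ge0.
have [->|[h|[k [ks h]]]] := separation b L13 L_odd tu.
- by left; rewrite subrr normr0.
- by right; exact: near_loop_le h.
have [c hc] := coord_lower L13 a01 La2 M_gt0 ks.
have ak0 : 0 < a ^+ k by rewrite exprn_gt0; lra.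
have hd : a ^+ k * c0 <= e.
  apply: le_trans (He (k %% M)%N c (ltn_pmod k M_gt0)).
  apply: le_trans hc; apply: ler_wpM2l; first exact: ltW.
  have : c0 + c0 = 1 / (128 * L%:R) by rewrite /c0; field; lra.
  by have := M_large; rewrite -/c0; lra.
have hr : 2 / L%:R ^+ k <= r.
  have -> : 2 / L%:R ^+ k = 2 / c0 `^ s * (a ^+ k * c0) `^ s.
    rewrite powRM ?(ltW ak0) ?(ltW c00) // ratio_expK.
    have : L%:R ^+ k != 0 :> R by rewrite lt0r_neq0 // exprn_gt0.
    have : c0 `^ s != 0 by rewrite lt0r_neq0 // powR_gt0.
    by move: (c0 `^ s) (L%:R ^+ k) => x y x0 y0; field; rewrite x0 y0.
  apply: ler_wpM2l; first by rewrite divr_ge0 ?powR_ge0.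
  by apply: ge0_ler_powR; rewrite ?nnegrE ?(mulr_ge0 (ltW ak0) (ltW c00)) //; lra.
case: h => h; [left; exact: le_trans hr|right].
apply: near_loop_le h; apply: le_trans hr.
by rewrite ler_pM2r ?invr_gt0 ?exprn_gt0 //; lra.
Qed.

End SnowflakeExponent.

Lemma snowflake_parameters (R : realType) (s : R) : 1 < s -> exists L M : nat, let a := L%:R^-1 `^ s^-1 in
  [/\ 13 <= L%:R :> R, odd L, 2 < L%:R * a, (0 < M)%N &
    2 * pi * (2 * decay L a ^+ M / (1 - decay L a ^+ M)) <= 1 / (256 * L%:R)].
Proof.
move=> s1; pose e : R := 1 - s^-1.
have s0 : 0 < s^-1 < 1 by rewrite invr_gt0 invf_lt1 ?s1 ?andbT; lra.
(* The power e of y is 2 and [L * a] is the power e of [L], so [2 < L * a] as soon as [y < L]. *)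
pose y : R := 2 `^ e^-1; pose n := (Num.truncn y).+1.
have yn : y < n%:R by apply: truncnS_gt; exact: powR_ge0.
pose L := (n.*2 + 13)%N.
have L13 : 13 <= L%:R :> R by rewrite (ler_nat _ 13) leq_addl.
have oL : odd L by rewrite oddD odd_double.
pose a : R := L%:R^-1 `^ s^-1.
have La2 : 2 < L%:R * a.
  have L0 : 0 < L%:R :> R by lra.
  have -> : L%:R * a = L%:R `^ e.
    rewrite /a -powR_inv1; last lra.
    rewrite -powRrM mulN1r -{1}(powRr1 (_ : 0 <= L%:R)); last lra.
    by rewrite -powRD // (lt0r_neq0 L0) implybT.
  have -> : 2 = y `^ e :> R.
    by rewrite /y -powRrM mulVf ?powRr1 // lt0r_neq0 // /e; lra.
  apply: gt0_ltr_powR; rewrite ?nnegrE ?powR_ge0 //; [rewrite /e; lra|].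
  by apply: lt_trans yn _; rewrite ltr_nat /L; lia.
have a01 := ratio01 s1 L13.
have d01 := decay01 L13 a01 La2.
set d := decay L a in d01.
have p2 := @pi_ge2 R.
(* For [z <= 1 / 2], [2 * pi * (2 * z / (1 - z))] is at most [8 * pi * z]. *)
pose eps : R := Num.min (1 / 2) (1 / (256 * L%:R) / (8 * pi)).
have eps0 : 0 < eps by rewrite lt_min !divr_gt0 //; lra.
have [M0 _ HM] : \forall M \near \oo, d ^+ M < eps.
  have /cvg_expr/cvgrPdist_lt/(_ _ eps0) : `|d| < 1 by rewrite ger0_norm; lra.
  apply: filterS => M /=; rewrite sub0r normrN ger0_norm // exprn_ge0 //; lra.
have {}HM := HM M0.+1 (leqnSn _).
have ML : 2 * pi * (2 * d ^+ M0.+1 / (1 - d ^+ M0.+1)) <= 1 / (256 * L%:R).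
  have z0 : 0 <= d ^+ M0.+1 by rewrite exprn_ge0; lra.
  move: HM; rewrite lt_min => /andP[z1 z2]; move: (d ^+ _) z0 z1 z2 => z z0 z1.
  rewrite ltr_pdivlMr; last by lra.
  move=> z2; apply: le_trans (ltW z2).
  rewrite mulrA ler_pdivrMr; last by lra.
  have : 0 <= pi * z by rewrite mulr_ge0 //; lra.
  nra.
by exists L, M0.+1; split.
Qed.

Section EuclideanDistance.
Variable N : nat.
Implicit Types x y : 'rV[RR]_N.

Lemma edist_ge0 x y : 0 <= edist x y.
Proof. exact: sqrtr_ge0. Qed.

Lemma edistC x y : edist x y = edist y x.
Proof. by congr Num.sqrt; apply: eq_bigr => i _; rewrite -sqrrN opprB. Qed.

Lemma coord_le_edist x y i : `|x ord0 i - y ord0 i| <= edist x y.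
Proof.
rewrite -sqrtr_sqr ler_wsqrtr // (bigD1 i) //= lerDl.
by apply: sumr_ge0 => j _; exact: sqr_ge0.
Qed.

Lemma edist_le_coord x y (e : RR) : 0 <= e ->
  (forall i, `|x ord0 i - y ord0 i| <= e) -> edist x y <= N%:R * e.
Proof.
move=> e0 H; have [N0|N0] := posnP N.
  rewrite /edist big1 ?sqrtr0 ?N0 ?mul0r // => i _.
  by have := ltn_ord i; rewrite [X in (_ < X)%N]N0.
rewrite -[leRHS]ger0_norm ?mulr_ge0 // -sqrtr_sqr ler_wsqrtr //.
apply: le_trans (_ : \sum_(i < N) e ^+ 2 <= _).
  apply: ler_sum => i _; rewrite -[leLHS]ger0_norm ?sqr_ge0 // normrX.
  by apply: lerXn2r; rewrite ?nnegrE.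
rewrite sumr_const card_ord exprMn -[leLHS]mulr_natl. rewrite ler_wpM2r ?sqr_ge0 //.
by rewrite -natrX ler_nat expnS expn1 leq_pmulr.
Qed.

Lemma edist_scale (c : RR) x y : 0 <= c -> edist (c *: x) (c *: y) = c * edist x y.
Proof.
move=> c0; rewrite /edist -[c in RHS]ger0_norm // -sqrtr_sqr -sqrtrM ?sqr_ge0 //.
rewrite mulr_sumr; congr Num.sqrt; apply: eq_bigr => i _.
by rewrite !mxE -mulrBr exprMn.
Qed.

Lemma edistB x y z : edist (x - z) (y - z) = edist x y.
Proof.
congr Num.sqrt; apply: eq_bigr => i _; rewrite !mxE; congr (_ ^+ 2); ring.
Qed.

End EuclideanDistance.

Definition scaled_holder (N : nat) (s C : RR) (f : RR -> 'rV[RR]_N) :=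
  forall t u, edist (f t) (f u) <= C * `|t - u| `^ s^-1.

Definition loop_separated (N L : nat) (b : nat -> bool) (s K : RR) (f : RR -> 'rV[RR]_N) :=
  forall t u, `|t - u| <= 1 / 4 -> let r := K * edist (f t) (f u) `^ s in
    `|t - u| <= r \/ near_loop L b r t u.

Definition curve (s : RR) L b M (t : RR) : 'rV[RR]_(M.*2) :=
  \row_(i < M.*2) coord L b (L%:R^-1 `^ s^-1) M (i./2) (odd i) t.

Lemma curve_exists (s : RR) : 1 < s -> exists L : nat,
  [/\ 13 <= L%:R :> RR, odd L & forall b, exists N (f : RR -> 'rV[RR]_N) C K,
    [/\ 0 <= C, 0 < K, scaled_holder s C f, loop_separated L b s K f &
      forall m i, b m -> f (loop_start RR L m i) = f (loop_end RR L m i)]].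
Proof.
move=> s1; have [L [M [L13 oL La2 M0 ML]]] := snowflake_parameters s1.
exists L; split=> // b.
have [C C0 HC] := coord_holder b s1 L13 La2 M0.
have [K K0 HK] := coord_separated b s1 L13 oL La2 M0 ML.
exists _, (curve s L b M), ((M.*2)%:R * C), K; split=> //.
- exact: mulr_ge0.
- move=> t u; rewrite -mulrA; apply: edist_le_coord => [|i].
    by apply: mulr_ge0 => //; exact: powR_ge0.
  by rewrite !mxE; exact: HC.
- move=> t u tu /=; apply: HK => // [|k c kM]; first exact: edist_ge0.
  have jlt : (k.*2 + c < M.*2)%N by case: (c); lia.
  have := coord_le_edist (curve s L b M t) (curve s L b M u) (Ordinal jlt).
  rewrite !mxE /=; have -> : (k.*2 + c)./2 = k by case: (c); lia.
  by have -> : odd (k.*2 + c) = c by rewrite oddD odd_double; case: (c).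
by move=> m i bm; apply/rowP => j; rewrite !mxE coord_loop.
Qed.

(** * Hausdorff measure *)

Section LoopPoints.
Variables (R : realType) (L : nat).
Hypothesis L13 : 13 <= L%:R :> R.
Implicit Types (i j k : int) (m n : nat).

Definition loop_point m (c : bool) i : R := (c.+1%:R + L%:R * i%:~R) / L%:R ^+ m.+1.

Lemma near_loop_points b (e t u : R) : near_loop L b e t u -> exists m i c, b m /\
  `|t - loop_point m c i| <= e /\ `|u - loop_point m (~~ c) i| <= e.
Proof. by move=> [m [i [bm [[h1 h2]|[h1 h2]]]]]; exists m, i; [exists false|exists true]. Qed.

Let L_gt0 : 0 < L%:R :> R. Proof. exact: lt_le_trans L13. Qed.

Lemma loop_point_dist m c i : `|loop_point m c i - loop_point m (~~ c) i| = 1 / L%:R ^+ m.+1.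
Proof.
have l0 := L_gt0; rewrite /loop_point -mulrBl normrM [X in _ * X]gtr0_norm ?invr_gt0 ?exprn_gt0 //.
congr (_ * _); case: c => /=; rewrite addrAC opprD addrA subrK.
  by rewrite ger0_norm; lra.
by rewrite ler0_norm; lra.
Qed.

Lemma not_dvd_L (c : bool) k : c.+1%:Z = L%:Z * k -> False.
Proof.
have : (13 <= L)%N by rewrite -(ler_nat R).
by case: c => /= h; have [k0|k0] := leP k 0; nia.
Qed.

(** Both points lie on the grid of mesh [L ^- n.+1], so they coincide. If m were smaller than n, the
    first numerator would be divisible by [L] on this grid, whereas the second is 1 or 2 modulo
    [L]. *)
Lemma loop_point_le m n c d i j : (m <= n)%N ->
  `|loop_point m c i - loop_point n d j| < 1 / L%:R ^+ n.+1 ->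
  [/\ m = n, c = d & i = j].
Proof.
have l0 := L_gt0; move=> /subnKC; move: (n - m)%N => k <-.
have Ek : L%:R ^+ k != 0 :> R by rewrite expf_neq0 // lt0r_neq0.
have Em : L%:R ^+ m.+1 != 0 :> R by rewrite expf_neq0 // lt0r_neq0.
have -> : loop_point m c i - loop_point (m + k) d j =
    ((c.+1%:Z + L%:Z * i) * L%:Z ^+ k - (d.+1%:Z + L%:Z * j))%:~R / L%:R ^+ (m + k).+1.
  rewrite /loop_point -addSn exprD intrB !intrM !intrD !intrM rmorphXn /=.
  by field; rewrite Ek Em.
rewrite normrM [X in _ * X]gtr0_norm ?invr_gt0 ?exprn_gt0 // ltr_pM2r ?invr_gt0 ?exprn_gt0 //.
rewrite -intr_norm (ltr_int _ _ 1) => h.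
have {h} e : (c.+1%:Z + L%:Z * i) * L%:Z ^+ k = d.+1%:Z + L%:Z * j by lia.
clear Ek Em; case: k e => [|k] e; last first.
  exfalso; apply: (@not_dvd_L d ((c.+1%:Z + L%:Z * i) * L%:Z ^+ k - j)).
  by rewrite mulrBr mulrCA -exprS e; ring.
rewrite expr0 mulr1 in e; rewrite addn0.
have L0 : (0 < L)%N by rewrite -(ltr_nat R).
have cd : c = d.
  case: c d e => -[] //= e; exfalso.
    by apply: (@not_dvd_L false (j - i)); rewrite mulrBr; lia.
  by apply: (@not_dvd_L false (i - j)); rewrite mulrBr; lia.
split=> //; move: e; rewrite cd => /addrI/mulfI; apply.
by rewrite -lt0n in L0 *; case: (L) L0.
Qed.

Lemma loop_point_inj m n c d i j (r : R) : 0 <= r ->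
  10 * r < 1 / L%:R ^+ m.+1 -> 10 * r < 1 / L%:R ^+ n.+1 ->
  `|loop_point m c i - loop_point n d j| <= 2 * r ->
  [/\ m = n, c = d & i = j].
Proof.
move=> r0 rm rn h; have [mn|/ltnW nm] := leqP m n.
  by apply: loop_point_le => //; lra.
rewrite distrC in h.
by have [|-> -> ->] := @loop_point_le n m d c j i nm; first by lra.
Qed.

(** A member farther than [12 * r] from t is reached through a loop longer than [10 * r] with one
    end within r of t. Such an end determines the loop, so all far members gather at the same other
    end. *)
Lemma two_clusters b (S : set R) (r : R) : 0 <= r ->
  (forall t u, S t -> S u -> `|t - u| <= r \/ near_loop L b r t u) ->
  exists t0 u0, forall u, S u -> `|u - t0| <= 12 * r \/ `|u - u0| <= 12 * r.
Proof.
move=> r0 H; have [[t St]|nS] := pselect (exists t, S t); last first.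
  by exists 0, 0 => u Su; case: nS; exists u.
have [[u0 [Su0 u0t]]|nu0] := pselect (exists u0, S u0 /\ ~ `|u0 - t| <= 12 * r); last first.
  by exists t, t => u Su; left; apply: contrapT => h; apply: nu0; exists u.
exists t, u0 => u Su; have [|ut] := pselect (`|u - t| <= 12 * r); [by left|right].
have far v : S v -> ~ `|v - t| <= 12 * r -> exists m i c,
    [/\ 10 * r < 1 / L%:R ^+ m.+1, `|t - loop_point m c i| <= r & `|v - loop_point m (~~ c) i| <= r].
  move=> Sv /negP; rewrite -ltNge => vt; case: (H t v St Sv) => [|/near_loop_points].
    by rewrite distrC => ?; exfalso; lra.
  move=> [m [i [c [_ [h1 h2]]]]]; exists m, i, c; split => //.
  rewrite -(loop_point_dist m c i).
  move: vt h1 h2; move: (loop_point _ _ _) (loop_point _ _ _) => p q.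
  rewrite !ler_norml ltr_normr => /orP vt h1 h2; rewrite ltr_normr; apply/orP.
  by case: vt => vt; [right|left]; lra.
have [m [i [c [m1 m2 m3]]]] := far _ Su0 u0t.
have [n [j [d [n1 n2 n3]]]] := far _ Su ut.
have [||||mn cd ij] := @loop_point_inj m n c d i j r => //.
  by move: m2 n2; rewrite !ler_norml; lra.
by move: m3 n3; rewrite mn cd ij !ler_norml; lra.
Qed.

End LoopPoints.

(** * Positive Hausdorff measure *)

Section HausdorffPositive.
Variables (N L : nat) (b : nat -> bool) (s K : RR) (f : RR -> 'rV[RR]_N).
Hypothesis L13 : 13 <= L%:R :> RR.
Hypothesis K_gt0 : 0 < K.
Hypothesis f_sep : loop_separated L b s K f.

Lemma diam_ge0 (U : set 'rV[RR]_N) : (0 <= diam U)%E.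
Proof. by apply: ereal_sup_ubound; left. Qed.

Lemma edist_le_diam (U : set 'rV[RR]_N) x y (d : RR) : (diam U <= d%:E)%E -> U x -> U y ->
  edist x y <= fine (diam U).
Proof.
move=> Ud Ux Uy.
have h : ((edist x y)%:E <= diam U)%E.
  by apply: ereal_sup_ubound; right; exists x => //; exists y.
have fU : diam U \is a fin_num.
  by rewrite ge0_fin_numE ?diam_ge0 //; apply: le_lt_trans Ud _; rewrite ltry.
by rewrite -lee_fin fineK.
Qed.

(** Mass distribution: the times sent into a covering set lie in two intervals of total length 48 K
    times the s-th power of its diameter, and these intervals cover [0, 1/4]. A single delta is
    enough, the measure being a supremum. *)
Lemma hausdorff_gt0 : 0 < s -> (0 < (hausdorff s (f @` `[0, 1 / 4]))%R)%E.
Proof.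
move=> s0; have K0 := K_gt0.
suff H : ((1 / (192 * K))%:E <= (hausdorff_delta s 1 (f @` `[0, 1 / 4]))%R)%E.
  apply: lt_le_trans (le_trans H _).
    by rewrite lte_fin divr_gt0 // mulr_gt0.
  by apply: ereal_sup_ubound; exists 1 => /=.
apply: le_ereal_inf_tmp => _ [F [FA Fd] <-].
pose r i := K * (fine (diam (F i))) `^ s.
have r0 i : 0 <= r i by rewrite /r mulr_ge0 ?powR_ge0 ?ltW.
have cl i : exists tu : RR * RR, forall u, (`[0, 1 / 4] `&` f @^-1` F i) u ->
    `|u - tu.1| <= 12 * r i \/ `|u - tu.2| <= 12 * r i.
  have [t u [t01 Ft] [u01 Fu]|t0 [u0 h]] := two_clusters L13 (b := b)
      (S := `[0, 1 / 4] `&` f @^-1` F i) (r0 i); last by exists (t0, u0).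
  have tu4 : `|t - u| <= 1 / 4.
    by move: t01 u01; rewrite /= !in_itv /= ler_norml; lra.
  have rle : K * edist (f t) (f u) `^ s <= r i.
    apply: ler_wpM2l; first exact: ltW.
    apply: ge0_ler_powR; first exact: ltW.
    - by rewrite nnegrE edist_ge0.
    - by rewrite nnegrE; apply: fine_ge0; exact: diam_ge0.
    - exact: (edist_le_diam (Fd i) Ft Fu).
  case: (f_sep tu4) => h; [left; exact: le_trans rle|right; exact: near_loop_le h].
have [T HT] := choice cl.
pose I i : set RR := `[(T i).1 - 12 * r i, (T i).1 + 12 * r i] `|`
  `[(T i).2 - 12 * r i, (T i).2 + 12 * r i].
have mI i : measurable (I i : set (measurableTypeR RR)) by apply: measurableU; exact: measurable_itv.
have muI i : (lebesgue_measure (I i) <= (48 * K)%:E * (fine (diam (F i)) `^ s)%:E)%E.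
  have len (z : RR) :
      (lebesgue_measure (`[(z - 12 * r i)%R, (z + 12 * r i)%R]%classic : set RR) <= (24 * r i)%:E)%E.
    have r0' := r0 i; rewrite lebesgue_measure_itv /=.
    by case: ifP => _; rewrite -?EFinB lee_fin; lra.
  apply: le_trans (measureU2 _ _ _) _; [exact: measurable_itv|exact: measurable_itv|].
  apply: le_trans (leeD (len _) (len _)) _.
  by rewrite -EFinD -EFinM lee_fin /r; lra.
have sub : `[0, 1 / 4] `<=` \bigcup_i I i.
  move=> u u01; have [|i _ Fi] := FA (f u); first by exists u.
  exists i => //; case: (HT i u) => //; rewrite ler_distl => h; [left|right];
  by rewrite /= in_itv.
have := measure_sigma_subadditive lebesgue_measure mI (measurable_itv `[0, 1 / 4]) sub.
have e4 : lebesgue_measure (`[0%R, (1 / 4)%R]%classic : set RR) = (1 / 4)%:E.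
  by rewrite lebesgue_measure_itv /= lte_fin ifT ?EFinN ?sube0 //; lra.
rewrite [X in (X <= _)%E]e4 => h.
have {}h : ((1 / 4)%:E <= (48 * K)%:E *
    \sum_(0 <= i <oo) (fine (diam (F i)) `^ s)%:E)%E.
  rewrite -nneseriesZl; last by move=> i _; rewrite lee_fin powR_ge0.
  apply: le_trans h _; apply: lee_nneseries => i _ //; exact: muI.
have e : (1 / (192 * K)) = (48 * K)^-1 * (1 / 4) by field; lra.
by rewrite e EFinM lee_pdivrMl //; lra.
Qed.

End HausdorffPositive.

Lemma hausdorff_image0 (N : nat) (s C : RR) (f : RR -> 'rV[RR]_N) (A : set RR) : 0 < s ->
  scaled_holder s C f -> lebesgue_measure A = 0%E -> hausdorff s (f @` A) = 0%E.
Proof.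
move=> s0; wlog C0 : C / 0 < C => [H fC A0|fC A0].
  have C1 : C <= `|C| + 1 by have := ler_norm C; lra.
  have C2 : 0 < `|C| + 1 by apply: ltr_wpDl.
  apply: (H _ C2) => // t u; apply: le_trans (fC t u) _.
  by apply: ler_wpM2r => //; exact: powR_ge0.
have small : forall d e : RR, 0 < d -> 0 < e -> (hausdorff_delta s d (f @` A) <= e%:E)%E.
  move=> d e d0 e0.
  (* The first bound controls the sum of the powers of the diameters, the second keeps each diameter
     below d. *)
  pose eta : RR := Num.min (e / C `^ s) ((d / C) `^ s).
  have eta0 : 0 < eta by rewrite lt_min divr_gt0 ?powR_gt0 ?divr_gt0.
  have : (lebesgue_measure A < eta%:E)%E by rewrite A0 lte_fin.
  move=> /ereal_inf_lt[_ [I [mI AI] <-]] Ilt.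
  have lenI i : exists2 l : RR, 0 <= l & wlength idfun (I i) = l%:E /\
      (forall t u, I i t -> I i u -> `|t - u| <= l).
    have /ocitvP[->|[[x y] /= xy ->]] := mI i.
      by exists 0 => //; rewrite wlength0; split.
    exists (y - x); first by lra.
    rewrite wlength_itv_bnd ?ltW //; split => // t u; rewrite /= !in_itv /= ler_norml; lra.
  have [l l0 /all_and2[lE lI]] : exists2 l : nat -> RR, forall i, 0 <= l i &
      forall i, wlength idfun (I i) = (l i)%:E /\
      (forall t u, I i t -> I i u -> `|t - u| <= l i).
    have [l h] := choice (fun i => let: ex_intro2 x h1 h2 := lenI i in ex_intro _ x (conj h1 h2)).
    by exists l => i; have [] := h i.
  have sumE : (\sum_(0 <= k <oo) wlength idfun (I k) = \sum_(0 <= k <oo) (l k)%:E)%E.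
    by apply: eq_eseriesr => k _; rewrite lE.
  rewrite sumE in Ilt.
  have l_eta i : l i <= eta.
    rewrite -lee_fin; apply: le_trans (ltW Ilt).
    apply: le_trans (nneseries_lim_ge i.+1 _); last by move=> k _ _; rewrite lee_fin.
    rewrite big_mkord big_ord_recr /= leeDr // sume_ge0 // => k _.
    by rewrite lee_fin.
  have dI i : (diam (f @` I i) <= (C * l i `^ s^-1)%:E)%E.
    apply: ge_ereal_sup => _ [->|[_ [t It <-] [_ [u Iu <-] <-]]].
      by rewrite lee_fin mulr_ge0 ?powR_ge0 ?ltW.
    rewrite lee_fin; apply: le_trans (fC t u) _; apply: ler_wpM2l; first exact: ltW.
    apply: ge0_ler_powR; rewrite ?nnegrE //; last exact: lI.
    by rewrite invr_ge0 ltW.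
  apply: le_trans (_ : \sum_(0 <= k <oo) (fine (diam (f @` I k)) `^ s)%:E <= _)%E.
    apply: ereal_inf_lbound; exists (fun k => f @` I k) => //; split.
      by move=> _ [t /AI[k _ Ik] <-]; exists k => //; exists t.
    move=> k; apply: le_trans (dI k) _; rewrite lee_fin mulrC -ler_pdivlMr //.
    have -> : d / C = ((d / C) `^ s) `^ s^-1.
      by rewrite -powRrM mulfV ?powRr1 ?divr_ge0 ?ltW // lt0r_neq0.
    apply: ge0_ler_powR; rewrite ?nnegrE //; [by rewrite invr_ge0 ltW|exact: powR_ge0|].
    by apply: le_trans (l_eta k) _; rewrite ge_min lexx orbT.
  apply: le_trans (_ : (C `^ s)%:E * \sum_(0 <= k <oo) (l k)%:E <= _)%E.
    rewrite -nneseriesZl; last by move=> k _; rewrite lee_fin.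
    apply: lee_nneseries => [k _ _|k _]; first by rewrite lee_fin powR_ge0.
    rewrite -EFinM lee_fin.
    have -> : C `^ s * l k = (C * l k `^ s^-1) `^ s.
      by rewrite powRM ?powR_ge0 ?ltW // -powRrM mulVf ?powRr1 // lt0r_neq0.
    apply: ge0_ler_powR; first exact: ltW.
    - by rewrite nnegrE; apply: fine_ge0; exact: diam_ge0.
    - by rewrite nnegrE; apply: mulr_ge0; [exact: ltW|exact: powR_ge0].
    have fd : diam (f @` I k) \is a fin_num.
      by rewrite ge0_fin_numE ?diam_ge0 //; apply: le_lt_trans (dI k) _; rewrite ltry.
    by rewrite -lee_fin fineK.
  rewrite -lee_pdivlMl ?powR_gt0 //; apply: le_trans (ltW Ilt) _.
  by rewrite -EFinM lee_fin mulrC ge_min lexx.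
apply/eqP; rewrite eq_le; apply/andP; split.
  apply: ge_ereal_sup => _ [d d0 <-]; apply/lee_addgt0Pr => e e0.
  by rewrite add0e; exact: small.
have h0 : (0 <= hausdorff_delta s 1%R (f @` A))%E.
  apply: le_ereal_inf_tmp => _ [F _ <-]; apply: nneseries_ge0 => k _ _.
  by rewrite lee_fin; exact: powR_ge0.
by apply: (le_trans h0); apply: ereal_sup_ubound; exists 1 => /=.
Qed.

(** * Sparse loop scales *)

(* Loops are present at the scales L ^- l and L ^- (l + k), l = block j,
   k = gap j; every gap k occurs for infinitely many j, and no other loop has
   its scale within a factor L ^ j of these two. *)
Definition block (j : nat) : nat := 4 * j ^ 2.
Definition gap (j : nat) : nat := (logn 2 j.+1).+1.
Definition loop_scale (n : nat) : bool :=
  has (fun j => (n == block j) || (n == block j + gap j)%N) (iota 0 n.+1).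

Lemma block_ge j : (j <= block j)%N.
Proof. rewrite /block; nia. Qed.

Lemma gap_le j : (gap j <= j.+1)%N.
Proof. by rewrite /gap; apply: ltn_logl. Qed.

Lemma loop_scaleP n : reflect (exists j, n = block j \/ n = (block j + gap j)%N) (loop_scale n).
Proof.
apply: (iffP hasP) => [[j _ /orP[]/eqP h]|[j h]]; first by exists j; left.
  by exists j; right.
exists j; last by case: h => ->; rewrite eqxx ?orbT.
by rewrite mem_iota add0n leq0n /=; case: h => ->; rewrite /block; nia.
Qed.

(** Blocks j and j + 1 are [8 j + 4] apart, which leaves room for a gap of at most [j + 1] and for
    the margins. *)
Lemma loop_scale_isolated n j : loop_scale n ->
  [\/ n = block j, n = (block j + gap j)%N, (n + j < block j)%N | (block j + gap j + j < n)%N].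
Proof.
move=> /loop_scaleP[i h]; have [ij|ji|<-] := ltngtP i j.
- constructor 3; have := gap_le i; case: h => ->; rewrite /block; nia.
- constructor 4; have := gap_le j; case: h => ->; rewrite /block; nia.
- by case: h; [constructor 1|constructor 2].
Qed.

(** Take for [j.+1] an odd number above 2 J times a power of 2 with exponent one less than the
    required gap. *)
Lemma gap_infinite k J : (0 < k)%N -> exists2 j, (J <= j)%N & gap j = k.
Proof.
case: k => // k _; exists (2 ^ k * (2 * J).+1).-1.
  by have := expn_gt0 2 k; nia.
rewrite /gap prednK ?muln_gt0 ?expn_gt0 // lognM ?expn_gt0 // pfactorK //.
by rewrite logn_coprime ?addn0 // coprime2n /= mul2n odd_double.
Qed.

Section GenericTimes.
Variables (R : realType) (L : nat).
Hypothesis L13 : 13 <= L%:R :> R.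

(** The grid of mesh [L ^- (block j - j)] contains the ends of all loops of scale m with
    [m + j < block j]. The tolerance is [2 ^ j] at the scale of the block, hence unbounded after
    rescaling, yet the total length is of order [(2 / L) ^ j] and summable. *)
Definition near_coarse_loop (j : nat) : set R :=
  \big[setU/set0]_(P < (L ^ (block j - j)).+1)
    `[P%:R / L%:R ^+ (block j - j) - 2 ^+ j / L%:R ^+ block j,
      P%:R / L%:R ^+ (block j - j) + 2 ^+ j / L%:R ^+ block j]%classic.

Definition generic_time (t : R) := exists J, forall j (P : int), (J <= j)%N ->
  2 ^+ j / L%:R ^+ block j < `|t - P%:~R / L%:R ^+ (block j - j)|.

Lemma measurable_near_coarse_loop j : measurable (near_coarse_loop j : set (measurableTypeR R)).
Proof. by apply: bigsetU_measurable => P _; exact: measurable_itv. Qed.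

Lemma tolerance_lt j : 2 ^+ j / L%:R ^+ block j = (2 / L%:R) ^+ j / L%:R ^+ (block j - j) :> R.
Proof.
have l13 := L13; have L0 : L%:R != 0 :> R by apply: lt0r_neq0; lra.
rewrite -{1}(subnK (block_ge j)) exprD expr_div_n -mulrA; congr (_ * _).
by rewrite invfM mulrC.
Qed.

Lemma mu_near_coarse_loop j :
  (lebesgue_measure (near_coarse_loop j) <= (4 * (2 / L%:R) ^+ j)%:E)%E.
Proof.
have l13 := L13; have L0 : 0 < L%:R :> R by lra.
set e : R := 2 ^+ j / L%:R ^+ block j.
have e0 : 0 <= e by rewrite /e divr_ge0 // exprn_ge0 // ltW.
have len (z : R) : (lebesgue_measure (`[(z - e)%R, (z + e)%R]%classic : set R) <= (2 * e)%:E)%E.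
  rewrite lebesgue_measure_itv /=.
  by case: ifP => _; rewrite -?EFinB lee_fin; lra.
rewrite /near_coarse_loop; set n := (L ^ _).+1.
have -> : 4 * (2 / L%:R) ^+ j = (L ^ (block j - j))%:R * (4 * e).
  have E0 : L%:R ^+ (block j - j) != 0 :> R by rewrite expf_neq0 // lt0r_neq0.
  by rewrite /e tolerance_lt natrX; field.
apply: le_trans (_ : (n%:R * (2 * e))%:E <= _)%E; last first.
  rewrite lee_fin /n -natr1; have : 1 <= (L ^ (block j - j))%:R :> R.
    by rewrite natrX exprn_ege1 //; lra.
  by move: (_%:R) => x x1; nra.
elim: n => [|n IH].
  by rewrite big_ord0 measure0 mul0r.
rewrite big_ord_recr /=; apply: le_trans (measureU2 _ _ _) _.
- by apply: bigsetU_measurable => P _; exact: measurable_itv.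
- exact: measurable_itv.
apply: le_trans (leeD IH (len _)) _.
by rewrite -EFinD lee_fin -natr1; lra.
Qed.

Lemma generic_time_ae : exists A : set (measurableTypeR R),
  [/\ measurable A, lebesgue_measure A = 0%E &
    forall t : R, 0 <= t <= 1 / 4 -> ~ A t -> generic_time t].
Proof.
have l13 := L13; have L0 : 0 < L%:R :> R by lra.
have q1 : 0 <= 2 / L%:R :> R by rewrite divr_ge0 // ltW.
have q2 : 2 / L%:R < 1 / 6 :> R by rewrite ltr_pdivrMr //; lra.
exists (lim_sup_set near_coarse_loop); split.
- apply: bigcap_measurable => // n _; apply: bigcup_measurable => p _.
  exact: measurable_near_coarse_loop.
- apply: lim_sup_set_cvg0; first exact: measurable_near_coarse_loop.
  apply: (@le_lt_trans _ _ (\sum_(0 <= j <oo) (4 * (2 / L%:R : R) ^+ j)%:E)%E).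
    apply: lee_nneseries => [j _ _|j _]; first exact: measure_ge0.
    exact: mu_near_coarse_loop.
  have cv : cvgn (series (geometric 4 (2 / L%:R : R))).
    by apply: is_cvg_geometric_series; rewrite ger0_norm; lra.
  rewrite (_ : (\sum_(0 <= j <oo) (4 * (2 / L%:R : R) ^+ j)%:E)%E =
    (limn (series (geometric 4 (2 / L%:R : R))))%:E) ?ltry //.
  rewrite -EFin_lim //; congr (limn _); apply/funext => n.
  by rewrite /series /= sumEFin.
move=> t t01 nA.
have [J hJ] : exists J, forall j, (J <= j)%N -> ~ near_coarse_loop j t.
  apply: contrapT => h; apply: nA => J _.
  have [j [Jj nj]] : exists j, (J <= j)%N /\ near_coarse_loop j t.
    apply: contrapT => h2; apply: h; exists J => j Jj nj; apply: h2; by exists j.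
  by exists j.
(* With j positive the tolerance is below a sixth of the mesh, so that grid points outside [0, 1]
   are too far from t to matter. *)
exists J.+1 => j P Jj; rewrite ltNge; apply/negP => hP.
apply: (hJ j); first exact: ltnW.
set n := (block j - j)%N in hP *.
have E0 : 0 < L%:R ^+ n :> R by rewrite exprn_gt0.
have tol : 2 ^+ j / L%:R ^+ block j < 1 / L%:R ^+ n / 6 :> R.
  rewrite tolerance_lt -/n mulrAC ltr_pM2r ?invr_gt0 // mul1r.
  case: j {hP n E0} Jj => // j _; rewrite exprS.
  have : (2 / L%:R) ^+ j <= 1 :> R by rewrite exprn_ile1 //; lra.
  have : 0 <= (2 / L%:R) ^+ j :> R by rewrite exprn_ge0.
  move: (2 / L%:R) (_ ^+ j) q1 q2 => x y x0 x6 y0 y1; nra.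
have E1 : 1 <= L%:R ^+ n :> R by rewrite exprn_ege1 //; lra.
have hV : 1 / L%:R ^+ n <= 1 :> R by rewrite ler_pdivrMr // mul1r.
move: hP; rewrite ler_distl => hP.
have P0 : 0 <= P.
  rewrite leNgt; apply/negP => P0.
  have : P%:~R <= -1 :> R by rewrite -(intrN _ 1) ler_int; clear -P0; lia.
  move=> h; have : P%:~R / L%:R ^+ n <= - (1 / L%:R ^+ n) :> R.
    by rewrite mul1r -mulN1r ler_pM2r ?invr_gt0.
  have : 0 < 1 / L%:R ^+ n :> R by rewrite divr_gt0.
  lra.
have P1 : P <= (L ^ n)%:Z.
  rewrite -(ler_int R) -[leRHS]/((L ^ n)%:R) natrX -[leRHS]mul1r -ler_pdivrMr //; lra.
have Plt : (`|P| < (L ^ n).+1)%N by clear -P0 P1; lia.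
rewrite /near_coarse_loop -/n (bigD1 (Ordinal Plt)) //=; left.
rewrite in_itv /=; have -> : `|P|%:R = P%:~R :> R by rewrite -[in RHS](gez0_abs P0).
exact: hP.
Qed.

End GenericTimes.

(** * Lobes *)

Section Lobes.
Variables (R : realType) (V : normedModType R).
Implicit Types (T A B Lam : set V) (p : V).

(** The closure of the rest meets [Lam] at most in p; the second point y rules out the trivial
    piece. *)
Definition is_lobe T Lam p := [/\ Lam `<=` T, compact Lam, Lam p,
  exists2 y, Lam y & y <> p & closed ((T `\` Lam) `|` [set p])].

(** Only the base points have to lie in [Lam], not the lobes attached there; the base of [Lam]
    itself may be counted. *)
Definition has_lobe_bases T n := exists Lam p, is_lobe T Lam p /\
  exists2 ps : 'I_n -> V, injective ps & forall i, Lam (ps i) /\ exists Lam', is_lobe T Lam' (ps i).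

Lemma homeomorphism_lobe A B (f g : V -> V) Lam p : closed B ->
  (forall a, A a -> B (f a)) -> (forall y, B y -> A (g y)) ->
  (forall a, A a -> g (f a) = a) -> (forall y, B y -> f (g y) = y) ->
  {within A, continuous f} -> {within B, continuous g} ->
  is_lobe A Lam p -> is_lobe B (f @` Lam) (f p).
Proof.
move=> clB fAB gBA gf fg cf cg [LA cL Lp [y Ly yp] cl]; split.
- by move=> _ [x /LA/fAB Bx <-].
- apply: continuous_compact cL; exact: continuous_subspaceW cf.
- by exists p.
- exists (f y); first by exists y.
  by move=> e; apply: yp; rewrite -(gf y) ?e ?gf //; exact: LA.
have -> : (B `\` f @` Lam) `|` [set f p] = B `&` g @^-1` ((A `\` Lam) `|` [set p]).
  apply/seteqP; split => z.
    move=> [[Bz nz]|->]; split=> //=; last by right; rewrite gf //; exact: LA.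
    - left; split; first exact: gBA.
      by move=> Lgz; apply: nz; exists (g z) => //; exact: fg.
    - by apply: fAB; exact: LA.
  move=> [Bz /= [[Ag nL]|e]]; last by right; rewrite -e /= fg.
  left; split=> // -[x Lx e]; apply: nL; rewrite -e gf //; exact: LA.
(* The preimage under g is closed relative to B only; that B is closed makes it closed in the
   space. *)
have /closed_subspaceP : closed (g @^-1` ((A `\` Lam) `|` [set p]) : set (subspace B)).
  by apply: preimage_closed => // x _; exact: cg.
move=> [W clW e]; rewrite setIC -e; exact: closedI.
Qed.

Lemma homeomorphism_lobe_bases A B (f g : V -> V) n : closed B ->
  (forall a, A a -> B (f a)) -> (forall y, B y -> A (g y)) ->
  (forall a, A a -> g (f a) = a) -> (forall y, B y -> f (g y) = y) ->
  {within A, continuous f} -> {within B, continuous g} ->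
  has_lobe_bases A n -> has_lobe_bases B n.
Proof.
move=> clB fAB gBA gf fg cf cg [Lam [p [hL [ps psI hps]]]].
have H Lam' p' := @homeomorphism_lobe A B f g Lam' p' clB fAB gBA gf fg cf cg.
exists (f @` Lam), (f p); split; first exact: H.
have LA : Lam `<=` A by case: hL.
exists (f \o ps) => [i j /= e|i].
  by apply: psI; rewrite -(gf (ps i)) ?e ?gf //; apply: LA; case: (hps j); case: (hps i).
have [Li [Lam' hL']] := hps i; split; first by exists (ps i).
by exists (f @` Lam'); exact: H.
Qed.

End Lobes.

(** * A line with two families of loops *)

Section LoopedLine.
Variables (R : realType) (V : normedModType R) (L Q' : nat) (h : R -> V).
Hypothesis L13 : (13 <= L)%N.
Hypothesis Q'_gt0 : (0 < Q')%N.
Let Q := (L * Q')%N.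

Definition loop_pair (x y : int) := exists i : int,
  (x = 1 + L%:Z * i /\ y = 2 + L%:Z * i) \/
  (x = (1 + L%:Z * i) * Q%:Z /\ y = (2 + L%:Z * i) * Q%:Z).

Lemma not_dvd (a k : int) : 0 < a < 13 -> a <> L%:Z * k.
Proof. have := L13; move=> l13 /andP[a0 a13] e; have [k0|k0] := leP k 0; nia. Qed.

Lemma loop_pair_lt x y : loop_pair x y -> x < y <= x + Q%:Z.
Proof.
have := L13; have := Q'_gt0; move=> q0 l13 [i [[-> ->]|[-> ->]]].
  by rewrite /Q; nia.
have -> : (2 + L%:Z * i) * Q%:Z = (1 + L%:Z * i) * Q%:Z + Q%:Z by ring.
rewrite /Q; nia.
Qed.

(** Ends of big loops are multiples of [L], those of small loops are 1 or 2 modulo [L], so they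
    never coincide; and a small loop, of length 1, has no integer in its interior. *)
Lemma loop_pair_mixed (i j : int) (x := 1 + L%:Z * i) (u := (1 + L%:Z * j) * Q%:Z)
  (v := (2 + L%:Z * j) * Q%:Z) : [\/ x + 1 < u, v < x | u < x /\ x + 1 < v].
Proof.
have lt1 : u < v by rewrite /u /v /Q; have := L13; have := Q'_gt0; nia.
have n1 (d k : int) : 0 < d < 13 -> L%:Z * i + d <> k * Q%:Z.
  by move=> hd e; apply: (@not_dvd d (Q'%:Z * k - i)) => //; rewrite /Q in e; nia.
have := n1 1 (1 + L%:Z * j) isT; have := n1 2 (1 + L%:Z * j) isT.
have := n1 1 (2 + L%:Z * j) isT; have := n1 2 (2 + L%:Z * j) isT.
rewrite -/u -/v => h1 h2 h3 h4.
have h5 : x = L%:Z * i + 1 by rewrite /x addrC.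
move: lt1 h1 h2 h3 h4 h5; clear.
move: (L%:Z * i) u v x => w u v x *.
have [?|?] := ltP (x + 1) u; first by constructor 1.
have [?|?] := ltP v x; first by constructor 2.
by constructor 3; lia.
Qed.

Lemma loop_pair_nested x y u v : loop_pair x y -> loop_pair u v ->
  [\/ x = u /\ y = v, v < x, y < u | (x < u /\ v < y) \/ (u < x /\ y < v)].
Proof.
have q0 : (0 < Q%:Z) by rewrite /Q; have := L13; have := Q'_gt0; nia.
have D (i j : int) : i < j -> 2 + L%:Z * i < 1 + L%:Z * j.
  have := L13; nia.
move=> [i [[-> ->]|[-> ->]]] [j [[-> ->]|[-> ->]]].
- by case: (ltgtP i j) => [/D|/D|->]; [constructor 3|constructor 2|constructor 1].
- have -> : 2 + L%:Z * i = 1 + L%:Z * i + 1 by ring.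
  by case: (loop_pair_mixed i j) => [?|?|[? ?]]; [constructor 3|constructor 2|constructor 4; right].
- have -> : 2 + L%:Z * j = 1 + L%:Z * j + 1 by ring.
  by case: (loop_pair_mixed j i) => [?|?|[? ?]]; [constructor 2|constructor 3|constructor 4; left].
case: (ltgtP i j) => [/D ?|/D ?|->]; [constructor 3|constructor 2|by constructor 1];
by rewrite ltr_pM2r.
Qed.

Lemma loop_pair_uniq x y z : loop_pair x y -> loop_pair x z -> y = z.
Proof.
move=> h1 h2; have := loop_pair_lt h1; have := loop_pair_lt h2.
by case: (loop_pair_nested h1 h2) => [[]|?|?|[[??]|[??]]]; lia.
Qed.

Lemma loop_pair_notrans x y z : loop_pair x y -> loop_pair y z -> False.
Proof.
move=> h1 h2; have := loop_pair_lt h1; have := loop_pair_lt h2.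
by case: (loop_pair_nested h1 h2) => [[]|?|?|[[??]|[??]]]; lia.
Qed.

Hypothesis h_continuous : continuous h.
Hypothesis h_proper : forall r : R, exists B : R, forall w, `|h w| <= r -> `|w| <= B.

Definition glued (w v : R) := exists x y, [/\ loop_pair x y, w = x%:~R & v = y%:~R].

Hypothesis h_fibres : forall w v, h w = h v <-> [\/ w = v, glued w v | glued v w].

Lemma proper_image_closed (D : set R) : closed D -> closed (h @` D).
Proof.
move=> cD y cy; have [B hB] := h_proper (`|y| + 1).
have cDB : compact (h @` (`[- B, B] `&` D)).
  apply: continuous_compact; first exact: continuous_subspaceT.
  by apply: compact_closedI => //; exact: segment_compact.
have [w [_ Dw] <-] : (h @` (`[- B, B] `&` D)) y; last by exists w.
apply: (compact_closed _ cDB); first exact: norm_hausdorff.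
move=> U nU; have [_ [[w Dw <-] [Uw]]] := cy _ (filterI nU (nbhsx_ballx y 1 ltr01)).
rewrite -ball_normE /ball_ /= => yw; exists (h w); split => //; exists w => //; split => //.
rewrite /= in_itv /= -ler_norml; apply: hB.
have := ler_normB y (y - h w); rewrite subKr; lra.
Qed.

Let T : set V := range h.

Lemma glued_eq w v : glued w v -> h w = h v.
Proof. by move=> g; apply/h_fibres; constructor 2. Qed.

(** The rest of the space with the base added is the image of two closed half-lines, closed by
    properness. Nesting prevents a gluing between the inside of the loop and its outside. *)
Lemma loop_lobe x y : loop_pair x y -> is_lobe T (h @` `[x%:~R, y%:~R]) (h x%:~R).
Proof.
move=> xy; have /andP[ltxy _] := loop_pair_lt xy.
have xyR : x%:~R < y%:~R :> R by rewrite ltr_int.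
have hxy : h x%:~R = h y%:~R by apply: glued_eq; exists x, y.
have inside w v : h w = h v -> (w <= x%:~R \/ y%:~R <= w) -> x%:~R <= v <= y%:~R -> h v = h x%:~R.
  move=> /h_fibres e hw hv.
  have vxy : v = x%:~R \/ v = y%:~R \/ (x%:~R < v < y%:~R).
    have [->|nx] := eqVneq v x%:~R; first by left.
    have [->|ny] := eqVneq v y%:~R; first by right; left.
    by right; right; rewrite !lt_neqAle ny eq_sym nx.
  case: vxy e hv => [->//|[->|/andP[h1 h2]]] e hv; first by rewrite -hxy.
  exfalso; case: e => [e|[u [z [uz e1 e2]]]|[u [z [uz e1 e2]]]].
  - by move: hw; rewrite e; lra.
  - have /andP[ltuz _] := loop_pair_lt uz.
    rewrite e2 !ltr_int in h1 h2; move: hw; rewrite e1 !ler_int.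
    by case: (loop_pair_nested xy uz) => [[? ?]|?|?|[[? ?]|[? ?]]] [?|?]; lia.
  - have /andP[ltuz _] := loop_pair_lt uz.
    rewrite e1 !ltr_int in h1 h2; move: hw; rewrite e2 !ler_int.
    by case: (loop_pair_nested xy uz) => [[? ?]|?|?|[[? ?]|[? ?]]] [?|?]; lia.
split.
- by move=> _ [w _ <-]; exists w.
- by apply: continuous_compact; [exact: continuous_subspaceT|exact: segment_compact].
- by exists x%:~R => //=; rewrite in_itv /= lexx ltW.
- pose m : R := (x%:~R + y%:~R) / 2.
  have m1 : x%:~R < m < y%:~R by rewrite /m; apply/andP; split; lra.
  exists (h m); first by exists m => //=; rewrite in_itv /=; lra.
  move=> /h_fibres[e|[u [z [uz e1 e2]]]|[u [z [uz e1 e2]]]].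
  + by move: m1; rewrite e; lra.
  + move/intr_inj in e2; rewrite -e2 in uz; exact: (loop_pair_notrans uz xy).
  + move/intr_inj in e1; rewrite -e1 in uz.
    by move: m1; rewrite e2 (loop_pair_uniq uz xy) ltxx andbF.
suff -> : (T `\` h @` `[x%:~R, y%:~R]) `|` [set h x%:~R] =
    h @` ([set w | w <= x%:~R] `|` [set w | y%:~R <= w]).
  by apply: proper_image_closed; apply: closedU; [exact: closed_le|exact: closed_ge].
apply/seteqP; split => z.
  move=> [[[w _ <-] nz]|->]; last by exists x%:~R => //; left => /=.
  exists w => //; apply: contrapT => /not_orP[/= h1 h2]; apply: nz; exists w => //.
  by rewrite /= in_itv /=; lra.
move=> [w /= hw <-]; have [[v]|nz] := pselect ((h @` `[x%:~R, y%:~R]) (h w)); last first.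
  by left; split=> //; exists w.
rewrite /= in_itv /= => hv e; right; rewrite /= -e.
by apply: (inside w v).
Qed.

(** The preimages S of the lobe and F of the rest with p are closed, cover the line and meet only
    over p; so on an interval avoiding the fibre of p, S is all or nothing. Being bounded, S misses
    both outer half-lines. If p were no base of a loop, its fibre would be one point and the lobe
    would reduce to p. *)
Lemma lobe_sub Lam p : is_lobe T Lam p -> exists x y,
  [/\ loop_pair x y, p = h x%:~R & Lam `<=` h @` `[x%:~R, y%:~R]].
Proof.
move=> [LT cL Lp [y0 Ly0 y0p] cl].
pose S := h @^-1` Lam; pose F := h @^-1` ((T `\` Lam) `|` [set p]).
have clS : closed S.
  by apply: preimage_closed => [w _|]; [exact: h_continuous|exact: compact_closed cL].
have clF : closed F by apply: preimage_closed => [w _|//]; exact: h_continuous.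
have SF w : S w \/ F w.
  by have [|n] := pselect (S w); [left|right; left; split=> //; exists w].
have SFp w : S w -> F w -> h w = p by move=> Sw [[]|].
have [B hB] : exists B : R, forall w, S w -> `|w| <= B.
  have [M [_ HM]] := compact_bounded cL.
  have [B hB] := h_proper (`|M| + 1); exists B => w Sw; apply: hB.
  by apply: (HM (`|M| + 1)) => //; have := ler_norm M; lra.
have [x0 _ hx0] := LT _ Lp.
have conn (I : set R) : is_interval I -> (forall w, I w -> h w <> p) ->
    (exists2 w, I w & ~ S w) -> forall w, I w -> ~ S w.
  move=> /connected_intervalP cI nI [w0 Iw0 nSw0] w Iw Sw.
  apply: nSw0; suff : (I `&` S) w0 by case.
  rewrite (cI (I `&` S)) //.
  - by exists w.
  - exists (~` F); first exact: closed_openC.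
    apply/seteqP; split => v [Iv Sv]; split => //; first by move=> /(SFp _ Sv)/(nI _ Iv).
    by case: (SF v).
  - by exists S.
have left (a : R) : (forall w, w < a -> h w <> p) -> forall w, w < a -> ~ S w.
  move=> H; apply: (conn [set w | w < a]) => //.
    by move=> u v _ /= va z; lra.
  have n1 := ler_norm (- a); have n2 := ler_norm B; have n3 := normr_ge0 B; have n4 := normr_ge0 a;
  rewrite normrN in n1.
  exists (- (`|a| + `|B| + 1)); first by rewrite /=; lra.
  by move=> /hB; rewrite ler_norml; lra.
have right (a : R) : (forall w, a < w -> h w <> p) -> forall w, a < w -> ~ S w.
  move=> H; apply: (conn [set w | a < w]) => //.
    by move=> u v /= ua _ z; lra.
  have n1 := ler_norm a; have n2 := ler_norm B; have n3 := normr_ge0 a; have n4 := normr_ge0 B.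
  exists (`|a| + `|B| + 1); first by rewrite /=; lra.
  by move=> /hB; rewrite ler_norml; lra.
have [w0 _ hw0] := LT _ Ly0.
have Sw0 : S w0 by rewrite /S /= hw0.
have npw0 : h w0 <> p by rewrite hw0.
have [[x [y [xy hx]]]|none] := pselect (exists x y, loop_pair x y /\ h x%:~R = p).
  exists x, y; split=> //.
  have hxy : h x%:~R = h y%:~R by apply: glued_eq; exists x, y.
  have only w : h w = p -> w = x%:~R \/ w = y%:~R.
    rewrite -hx => /h_fibres[->|[u [z [uz e1 e2]]]|[u [z [uz e1 e2]]]]; first by left.
      by move/intr_inj in e2; rewrite -e2 in uz; case: (loop_pair_notrans uz xy).
    move/intr_inj in e1; rewrite -e1 in uz.
    by right; rewrite e2 (loop_pair_uniq uz xy).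
  have /andP[ltxy _] := loop_pair_lt xy.
  have xyR : x%:~R < y%:~R :> R by rewrite ltr_int.
  move=> q Lq; have [w _ hw] := LT _ Lq; exists w => //=.
  have Sw : S w by rewrite /S /= hw.
  rewrite in_itv /= !leNgt; apply/andP; split; apply/negP => ww.
    by apply: (left x%:~R) ww Sw => v hv /only[]; lra.
  by apply: (right y%:~R) ww Sw => v hv /only[]; lra.
exfalso; have only w : h w = p -> w = x0.
  rewrite -hx0 => /h_fibres[//|[u [z [uz e1 e2]]]|[u [z [uz e1 e2]]]];
    case: none; exists u, z; split=> //.
    by rewrite -hx0 e2; apply: glued_eq; exists u, z.
  by rewrite -hx0 e1.
have [ww|ww|ww] := ltgtP w0 x0.
- by apply: (left x0) ww Sw0 => v hv /only; lra.
- by apply: (right x0) ww Sw0 => v hv /only; lra.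
- by apply: npw0; rewrite ww.
Qed.

Lemma lobe_bases_upper n : has_lobe_bases T n -> (n <= Q.+1)%N.
Proof.
move=> [Lam [p [hL [ps psI hps]]]].
have [x [y [xy _ sub]]] := lobe_sub hL; have /andP[ltxy yQ] := loop_pair_lt xy.
(* A base point is the image of an integer and gluing relates integers only, so its preimages are
   integers; [x, y] has at most [Q.+1] of them. *)
have H i : exists z : int, [/\ x <= z, z <= y & h z%:~R = ps i].
  have [/sub[w] + hw] := hps i; rewrite /= in_itv /= => wxy.
  move=> [Lam' /lobe_sub[u [v [uv e _]]]].
  move: hw; rewrite e => /h_fibres e'.
  have [z wz] : exists z : int, w = z%:~R.
    case: e' => [->|[a [c [_ -> _]]]|[a [c [_ _ ->]]]]; first by exists u.
      by exists a.
    by exists c.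
  rewrite wz !ler_int in wxy; case/andP: wxy => z1 z2; exists z; split=> //.
  by rewrite -wz; apply/h_fibres.
have [z hz] := choice H.
pose F i : 'I_Q.+1 := inord `|z i - x|.
have FI : injective F.
  move=> i j; rewrite /F => e; apply: psI; have [a1 a2 <-] := hz i; have [c1 c2 <-] := hz j.
  have := congr1 (@nat_of_ord _) e; rewrite !inordK; try by clear -a1 a2 c1 c2 yQ; lia.
  by move=> e'; congr (h _%:~R); clear -a1 a2 c1 c2 yQ e'; lia.
by have := leq_card F FI; rewrite !card_ord.
Qed.

Lemma lobe_bases_lower : has_lobe_bases T Q'.
Proof.
have q0 := Q'_gt0; have l13 := L13.
have outer : loop_pair Q%:Z (2 * Q%:Z) by exists 0; right; split; ring.
exists (h @` `[Q%:Z%:~R, (2 * Q%:Z)%:~R]), (h Q%:Z%:~R); split; first exact: loop_lobe.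
pose a (i : 'I_Q') : int := 1 + L%:Z * (Q'%:Z + i%:Z).
have pa i : loop_pair (a i) (2 + L%:Z * (Q'%:Z + i%:Z)) by exists (Q'%:Z + i%:Z); left.
exists (fun i => h (a i)%:~R) => [i j|i].
  move=> /h_fibres[/intr_inj|[u [z [uz /intr_inj e1 /intr_inj e2]]]|
    [u [z [uz /intr_inj e1 /intr_inj e2]]]].
  - move=> e; apply/val_inj; move: e; rewrite /a; have := l13; move=> l0 e /=.
    have : L%:Z * i%:Z = L%:Z * j%:Z by lia.
    by move/mulfI => H; have [] : i%:Z = j%:Z by apply: H; lia.
  - by rewrite -e2 in uz; case: (loop_pair_notrans uz (pa j)).
  - by rewrite -e2 in uz; case: (loop_pair_notrans uz (pa i)).
split; last by eexists; exact: loop_lobe (pa i).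
exists (a i)%:~R => //=; rewrite in_itv /= !ler_int /a.
have := ltn_ord i; rewrite /Q => iQ; nia.
Qed.

End LoopedLine.

(** * Blow-ups and their limits *)

Section PointwiseCluster.
Import ArrowAsProduct.

(** Tychonoff's theorem for the product of the intervals [[- B i, B i]]: a neighbourhood of a
    cluster point restricts finitely many coordinates. *)
Lemma pointwise_cluster (R : realType) (I : eqType) (u : nat -> I -> R) (B : I -> R) :
  (forall J i, `|u J i| <= B i) ->
  exists h : I -> R, forall (s : seq I) (e : R) M, 0 < e ->
    exists2 J, (M <= J)%N & forall i, i \in s -> `|u J i - h i| < e.
Proof.
move=> uB.
have cpt := @tychonoff I (fun _ => R) (fun i => `[- B i, B i]%classic)
  (fun i => @segment_compact R _ _).
have FA : (u @ \oo) [set f : forall _ : I, R | forall i, `[- B i, B i]%classic (f i)].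
  by exists 0%N => // J _ i /=; rewrite in_itv /= -ler_norml.
have [h [_ hcl]] := cpt _ (fmap_proper_filter u _) FA.
exists h => s e M e0.
have nb : nbhs (h : forall _ : I, R) [set f | forall i, i \in s -> `|f i - h i| < e].
  elim: s => [|i s IH]; first by apply: filterS filterT => f _ i.
  have ni : nbhs (h : forall _ : I, R) [set f | `|f i - h i| < e].
    have /= := @proj_continuous I (fun _ => R) i h [set x | `|x - h i| < e].
    apply; apply/nbhs_ballP; exists e => //= x; rewrite -ball_normE /ball_ /=.
    by rewrite distrC.
  apply: filterS (filterI ni IH) => f [fi fs] j; rewrite inE => /orP[/eqP ->//|].
  exact: fs.
have tl : (u @ \oo) [set f | exists2 J, (M <= J)%N & u J = f].
  by exists M => // J /= MJ; exists J.
have [f [[J MJ <-] hf]] := hcl _ _ tl nb.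
by exists J.
Qed.

End PointwiseCluster.

(** Arzelà-Ascoli: a pointwise cluster point inherits the equicontinuity, so closeness on a finite
    grid spreads to bounded sets. The scalars [theta] enter as the extra index [None], so that one
    subsequence serves both. *)
Lemma uniform_subsequence (R : realType) (I : finType) (G : nat -> I -> R -> R)
    (theta : nat -> R) (P : nat -> Prop) (Lam : R) :
  (forall J, exists2 j, (J <= j)%N & P j) ->
  (forall e, 0 < e -> exists2 d, 0 < d &
     forall j i w v, `|w - v| <= d -> `|G j i w - G j i v| <= e) ->
  (forall i w, exists B, forall j, P j -> `|G j i w| <= B) ->
  (forall j, P j -> `|theta j| <= Lam) ->
  exists (h : I -> R -> R) (theta' : R) (j : nat -> nat),
    [/\ forall m, P (j m), forall m, (j m < j m.+1)%N &
      forall e B, 0 < e -> exists M, forall m, (M <= m)%N ->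
        `|theta (j m) - theta'| <= e /\
        forall i w, `|w| <= B -> `|G (j m) i w - h i w| <= e].
Proof.
move=> Pinf equi bnd thB.
have [ch chP] := choice (fun J => let: ex_intro2 j h1 h2 := Pinf J in ex_intro _ j (conj h1 h2)).
pose u J (x : option (I * R)) : R :=
  if x is Some (i, w) then G (ch J) i w else theta (ch J).
have [Bd hBd] : exists Bd : option (I * R) -> R, forall x J, `|u J x| <= Bd x.
  have [Bd hBd] := choice (fun x : option (I * R) =>
    (match x as x0 return exists B, forall J, `|u J x0| <= B with
     | Some (i, w) => let: ex_intro B hB := bnd i w in ex_intro _ B (fun J => hB (ch J) (chP J).2)
     | None => ex_intro _ Lam (fun J => thB (ch J) (chP J).2) end)).
  by exists Bd.
have [g hg] := @pointwise_cluster R _ u Bd (fun J x => hBd x J).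
pose h i w := g (Some (i, w)).
have near1 (s : seq (option (I * R))) e M : 0 < e ->
    exists j, [/\ P j, (M <= j)%N & (forall i w, Some (i, w) \in s -> `|G j i w - h i w| < e) /\
      (None \in s -> `|theta j - g None| < e)].
  move=> e0; have [J MJ HJ] := hg s e M e0; exists (ch J); have [c1 c2] := chP J.
  split=> //; first exact: leq_trans MJ c1.
  by split=> [i w /HJ|/HJ].
have equih e : 0 < e -> exists2 d, 0 < d &
    forall i w v, `|w - v| <= d -> `|h i w - h i v| <= e.
  move=> e0; have e20 : 0 < e / 2 by lra.
  have [d d0 hd] := equi _ e20; exists d => // i w v wv.
  have e40 : 0 < e / 4 by lra.
  have [j [_ _ [Hj _]]] := near1 [:: Some (i, w); Some (i, v)] _ 0%N e40.
  have := Hj i w; have := Hj i v; rewrite !inE !eqxx orbT => /(_ isT) h1 /(_ isT) h2.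
  have := hd j i w v wv; move: h1 h2; rewrite !ltr_norml !ler_norml; lra.
pose grid m : seq (option (I * R)) := None ::
  [seq Some (i, (p%:R - (m.+1 ^ 2)%:R) / m.+1%:R) | i <- enum I, p <- iota 0 (2 * m.+1 ^ 2).+1].
have [sel selP] : exists sel : nat -> nat -> nat, forall m M, [/\ P (sel m M), (M <= sel m M)%N &
    (forall i w, Some (i, w) \in grid m -> `|G (sel m M) i w - h i w| < 1 / m.+1%:R) /\
    `|theta (sel m M) - g None| < 1 / m.+1%:R].
  have [sel selP] := choice (fun mM : nat * nat =>
    near1 (grid mM.1) (1 / mM.1.+1%:R) mM.2 (divr_gt0 ltr01 (ltr0Sn _ _))).
  exists (fun m M => sel (m, M)) => m M; have [s1 s2 [s3 s4]] := selP (m, M).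
  by split=> //; split=> //; apply: s4; rewrite inE eqxx.
pose j := fix j m := if m is m'.+1 then sel m (j m').+1 else sel 0%N 0%N.
have jP m : exists M, j m = sel m M by case: m => [|m]; eexists.
exists h, (g None), j; split=> [m|m|e B e0].
- by have [M ->] := jP m; have [] := selP m M.
- by rewrite /=; have [_ ? _] := selP m.+1 (j m).+1.
have e30 : 0 < e / 3 by lra.
have e3e : e / 3 < e by lra.
have tri (g1 g2 h1 h2 : R) : `|g1 - g2| <= e / 3 -> `|h1 - h2| <= e / 3 ->
    `|g2 - h2| < e / 3 -> `|g1 - h1| <= e.
  by rewrite !ler_norml ltr_norml; lra.
have [d1 d10 H1] := equi _ e30; have [d2 d20 H2] := equih _ e30.
pose x : R := Num.max (Num.max (`|B|) (1 / d1)) (Num.max (1 / d2) (1 / (e / 3))).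
exists (Num.truncn x).+1 => m mM.
have xm : x < m.+1%:R.
  have : x < (Num.truncn x).+1%:R by apply: truncnS_gt; rewrite /x !le_max normr_ge0.
  by move=> h1; apply: lt_le_trans h1 _; rewrite ler_nat ltnW.
have m0 : 0 < m.+1%:R :> R by rewrite ltr0Sn.
move: xm; rewrite /x !gt_max => /andP[/andP[xB x1] /andP[x2 x3]].
have inv (z : R) : 0 < z -> 1 / z < m.+1%:R -> 1 / m.+1%:R < z.
  by move=> z0; rewrite !ltr_pdivrMr // mulrC.
have {}x1 := inv _ d10 x1; have {}x2 := inv _ d20 x2; have {}x3 := inv _ e30 x3.
have [M jE] := jP m; rewrite jE; have [_ _ [S1 S2]] := selP m M.
split; first by apply: ltW; apply: lt_trans S2 _; exact: lt_trans e3e.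
move=> i w wB.
have wm : `|w| < m.+1%:R by apply: le_lt_trans wB _; apply: le_lt_trans xB; exact: ler_norm.
pose y := w * m.+1%:R + (m.+1 ^ 2)%:R.
have y0 : 0 <= y <= (2 * m.+1 ^ 2)%:R.
  move: wm; rewrite /y natrM !natrX ltr_norml; move: (m.+1%:R : R) m0 => z z0 wz.
  clear -z0 wz.
  have h1 : 0 <= z * (w + z) by apply: mulr_ge0; lra.
  have h2 : 0 <= z * (z - w) by apply: mulr_ge0; lra.
  by rewrite expr2; lra.
pose p := Num.truncn y.
have /andP[y00 y01] := y0; have pb : p%:R <= y < p.+1%:R by exact: truncn_itv.
have pin : (p < (2 * m.+1 ^ 2).+1)%N.
  by rewrite ltnS -(ler_nat R); case/andP: pb => pb1 _; apply: le_trans pb1 _; case/andP: y0.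
pose v : R := (p%:R - (m.+1 ^ 2)%:R) / m.+1%:R.
have vg : Some (i, v) \in grid m.
  rewrite inE; apply/orP; right; apply/allpairsP; exists (i, p).
  by split; [rewrite mem_enum|rewrite mem_iota|].
have wv : `|w - v| <= 1 / m.+1%:R.
  have -> : w - v = (y - p%:R) / m.+1%:R.
    by rewrite /v /y; field; rewrite lt0r_neq0.
  rewrite normrM [X in _ * X]gtr0_norm ?invr_gt0 // ler_pM2r ?invr_gt0 //.
  rewrite ler_norml; move: pb; rewrite -natr1; clear; lra.
have a1 := H1 (sel m M) i w v (le_trans wv (ltW x1)).
have a2 := H2 i w v (le_trans wv (ltW x2)).
apply: tri a1 a2 _; exact: lt_trans (S1 i v vg) x3.
Qed.

(** * Rescaled time *)

Section Rescaling.
Variables (R : realType) (L : nat) (t0 : R).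
Hypothesis L13 : 13 <= L%:R :> R.
Implicit Types (j m : nat) (w v r : R) (x y : int).

Let L_gt0 : 0 < L%:R :> R. Proof. exact: lt_le_trans L13. Qed.

(** [t0] rounded down to a multiple of [L ^- block j], the period of the larger loops of the block,
    in units of [L ^- depth j]; subtracting it preserves the pattern of loops. *)
Definition anchor j : int := L%:Z ^+ (gap j).+1 * Num.floor (L%:R ^+ block j * t0).
Definition depth j : nat := (block j + (gap j).+1)%N.
(* The clock of the blow-up at block j: integer times are the multiples of
   L ^- depth j, shifted so that the loops of the block start at the same
   integers for every j. *)
Definition time j w : R := ((anchor j)%:~R + w) / L%:R ^+ depth j.
Definition base j : R := L%:R ^+ depth j * t0 - (anchor j)%:~R.

Lemma time_base j : time j (base j) = t0.
Proof.
have E : L%:R ^+ depth j != 0 :> R by rewrite expf_neq0 // lt0r_neq0.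
by rewrite /time /base addrC subrK mulrC mulKf.
Qed.

Lemma timeB j w v : time j w - time j v = (w - v) / L%:R ^+ depth j.
Proof. by rewrite /time -mulrBl; congr (_ / _); ring. Qed.

Lemma base_bounds j : 0 <= base j <= L%:R ^+ (gap j).+1.
Proof.
have L0 := L_gt0; rewrite /base /anchor /depth exprD intrM rmorphXn /=.
set x := L%:R ^+ block j * t0; set Y : R := L%:R ^+ (gap j).+1.
have -> : L%:R ^+ block j * Y * t0 = Y * x by rewrite /x; ring.
have Y0 : 0 <= Y by rewrite exprn_ge0 // ltW.
have f1 := floor_le x; have := floorD1_gt x; rewrite intrD1 => f2.
by move: (Num.floor x)%:~R f1 f2 => z z1 z2; apply/andP; split; nra.
Qed.

Lemma rescale_near_loop j k r w v : gap j = k.+1 ->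
  near_loop L loop_scale r (time j w) (time j v) ->
  let rho := r * L%:R ^+ depth j in
  [\/ exists m c i, [/\ (m + j < block j)%N, `|time j w - loop_point R L m c i| <= r &
       `|time j v - loop_point R L m (~~ c) i| <= r],
     exists x y, [/\ loop_pair L (L ^ k) x y \/ loop_pair L (L ^ k) y x,
       `|w - x%:~R| <= rho & `|v - y%:~R| <= rho] |
     `|w - v| <= 2 * rho + (L%:R ^+ j)^-1 ].
Proof.
move=> jk /near_loop_points[m [i [c [bm [h1 h2]]]]] rho.
have L0 := L_gt0; have Ln : 0 < L%:R ^+ depth j :> R by rewrite exprn_gt0.
have grid z (x : int) (u : R) : u = ((anchor j)%:~R + x%:~R) / L%:R ^+ depth j ->
    `|time j z - u| <= r -> `|z - x%:~R| <= rho.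
  move=> ->; rewrite -/(time j x%:~R) timeB normrM [X in _ * X]gtr0_norm ?invr_gt0 //.
  by rewrite ler_pdivrMr.
have Lint e : (L%:Z ^+ e)%:~R = L%:R ^+ e :> R by rewrite rmorphXn.
have [mE|mE|mE|mE] := loop_scale_isolated j bm.
- constructor 2; pose fl := Num.floor (L%:R ^+ block j * t0).
  pose X (d : bool) : int := (d.+1%:Z + L%:Z * (i - fl)) * (L * L ^ k)%N%:Z.
  have XE d : loop_point R L m d i = ((anchor j)%:~R + (X d)%:~R) / L%:R ^+ depth j.
    rewrite /loop_point mE /anchor -/fl jk /depth addnS jk -addSn exprD /X.
    rewrite PoszM -[Posz (L ^ k)]natz natrX natz -exprS !intrM !intrD !intrM intrB !Lint.
    have E1 : L%:R ^+ (block j).+1 != 0 :> R by rewrite expf_neq0 // lt0r_neq0.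
    have E2 : L%:R ^+ k.+1 != 0 :> R by rewrite expf_neq0 // lt0r_neq0.
    by rewrite -!pmulrn; field; rewrite E1 E2.
  exists (X c), (X (~~ c)); split.
  + by case: (c); [right|left]; exists (i - fl); right.
  + by apply: grid h1; exact: XE.
  + by apply: grid h2; exact: XE.
- constructor 2; pose fl := Num.floor (L%:R ^+ block j * t0).
  pose X (d : bool) : int := d.+1%:Z + L%:Z * (i - L%:Z ^+ k.+1 * fl).
  have XE d : loop_point R L m d i = ((anchor j)%:~R + (X d)%:~R) / L%:R ^+ depth j.
    rewrite /loop_point mE /anchor -/fl jk /depth jk addnS /X.
    rewrite !intrM !intrD !intrM intrB !intrM !Lint; congr (_ / _).
      by rewrite -!pmulrn; ring.
    by rewrite !addnS.
  exists (X c), (X (~~ c)); split.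
  + by case: (c); [right|left]; exists (i - L%:Z ^+ k.+1 * fl); left.
  + by apply: grid h1; exact: XE.
  + by apply: grid h2; exact: XE.
- by constructor 1; exists m, c, i.
constructor 3.
have h3 := loop_point_dist L13 m c i.
have h4 : `|time j w - time j v| <= 2 * r + 1 / L%:R ^+ m.+1.
  move: h1 h2; rewrite -h3; move: (loop_point _ _ m c i) (loop_point _ _ m (~~ c) i) => p q.
  have := ler_normD (time j w - p) (p - q); have := ler_normD (time j w - p + (p - q)) (q - time j v).
  rewrite (distrC q); set X := `|_ + (q - _)|; have -> : X = `|time j w - time j v|.
    by rewrite /X; congr `|_|; ring.
  by clear; lra.
move: h4; rewrite timeB normrM [X in _ * X]gtr0_norm ?invr_gt0 // ler_pdivrMr // => h4.
apply: le_trans h4 _; rewrite mulrDl -mulrA lerD2l.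
have -> : m.+1 = (depth j + (j + (m - (block j + gap j + j.+1)).+1))%N.
  by rewrite /depth; move: mE; clear; lia.
rewrite exprD mul1r invfM -mulrA [_^-1 * L%:R ^+ depth j]mulrC mulrA mulVf ?mul1r ?lt0r_neq0 //.
rewrite lef_pV2 ?posrE ?exprn_gt0 //.
by apply: ler_weXn2l; [have := L13; lra|exact: leq_addr].
Qed.

Lemma time_loop j k x y : gap j = k.+1 -> loop_pair L (L ^ k) x y -> exists m i,
  [/\ loop_scale m, time j x%:~R = loop_start R L m i & time j y%:~R = loop_end R L m i].
Proof.
move=> jk [i xy]; pose fl := Num.floor (L%:R ^+ block j * t0).
have Lint e : (L%:Z ^+ e)%:~R = L%:R ^+ e :> R by rewrite rmorphXn.
have LN e : (L ^ e)%:Z%:~R = L%:R ^+ e :> R by rewrite -pmulrn natrX.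
case: xy => -[-> ->].
  exists (block j + gap j)%N, (i + L%:Z ^+ k.+1 * fl).
  split; first by apply/loop_scaleP; exists j; right.
    rewrite /time /loop_start /anchor -/fl jk /depth jk !addnS; congr (_ / _).
    by rewrite !(intrD, intrM) !Lint -!pmulrn; ring.
  rewrite /time /loop_end /anchor -/fl jk /depth jk !addnS; congr (_ / _).
  by rewrite !(intrD, intrM) !Lint -!pmulrn; ring.
have E1 : L%:R ^+ (block j).+1 != 0 :> R by rewrite expf_neq0 // lt0r_neq0.
have E2 : L%:R ^+ k.+1 != 0 :> R by rewrite expf_neq0 // lt0r_neq0.
have DE : L%:R ^+ depth j = L%:R ^+ (block j).+1 * L%:R ^+ k.+1 :> R.
  by rewrite /depth jk addnS -addSn exprD.
have QE : (L * L ^ k)%N%:Z%:~R = L%:R ^+ k.+1 :> R by rewrite -pmulrn natrM natrX exprS.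
have AE : (anchor j)%:~R = L%:R * L%:R ^+ k.+1 * fl%:~R :> R.
  by rewrite /anchor -/fl jk intrM Lint -exprS.
exists (block j), (i + fl); split; first by apply/loop_scaleP; exists j; left.
  rewrite /time /loop_start DE AE intrM QE !(intrD, intrM) -!pmulrn.
  by field; rewrite E1 E2.
rewrite /time /loop_end DE AE intrM QE !(intrD, intrM) -!pmulrn.
by field; rewrite E1 E2.
Qed.

Lemma coarse_loop_far j m c i r w v : (m + j < block j)%N ->
  `|time j w - loop_point R L m c i| <= r -> `|time j v - loop_point R L m (~~ c) i| <= r ->
  L%:R ^+ j <= `|w - v| + 2 * (r * L%:R ^+ depth j).
Proof.
move=> mj h1 h2; have L0 := L_gt0; have Ln : 0 < L%:R ^+ depth j :> R by rewrite exprn_gt0.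
have h3 := loop_point_dist L13 m c i.
have h4 : 1 / L%:R ^+ m.+1 <= `|time j w - time j v| + 2 * r.
  move: h1 h2; rewrite -h3; move: (loop_point _ _ m c i) (loop_point _ _ m (~~ c) i) => p q.
  have := ler_normD (p - time j w) (time j w - time j v).
  have := ler_normD (p - time j w + (time j w - time j v)) (time j v - q).
  rewrite (distrC p); set X := `|_ + (_ - q)|; have -> : X = `|p - q|.
    by rewrite /X; congr `|_|; ring.
  by clear; lra.
move: h4; rewrite timeB normrM (gtr0_norm (x := (L%:R ^+ depth j)^-1)) ?invr_gt0 // => h4.
have : (1 / L%:R ^+ m.+1) * L%:R ^+ depth j <=
    (`|w - v| / L%:R ^+ depth j + 2 * r) * L%:R ^+ depth j by rewrite ler_wpM2r // ltW.
have -> : (`|w - v| / L%:R ^+ depth j + 2 * r) * L%:R ^+ depth j =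
    `|w - v| + 2 * (r * L%:R ^+ depth j) by field; rewrite lt0r_neq0.
move=> h; apply: le_trans h.
have -> : depth j = (m.+1 + (j + (block j - (m + j).+1 + (gap j).+1)))%N.
  by rewrite /depth; move: mj; clear; lia.
rewrite exprD mul1r mulKf ?expf_neq0 ?lt0r_neq0 //.
by apply: ler_weXn2l; [have := L13; lra|exact: leq_addr].
Qed.

Lemma coarse_loop_generic j m c i r : (m + j < block j)%N ->
  (forall P : int, 2 ^+ j / L%:R ^+ block j < `|t0 - P%:~R / L%:R ^+ (block j - j)|) ->
  `|t0 - loop_point R L m c i| <= r -> 2 ^+ j < r * L%:R ^+ block j.
Proof.
move=> mj H h; have L0 := L_gt0.
rewrite -ltr_pdivrMr ?exprn_gt0 //; apply: lt_le_trans h.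
have := H ((c.+1%:Z + L%:Z * i) * L%:Z ^+ (block j - j - m.+1)).
suff <- : loop_point R L m c i = ((c.+1%:Z + L%:Z * i) * L%:Z ^+ (block j - j - m.+1))%:~R /
  L%:R ^+ (block j - j) by [].
rewrite /loop_point; have {2}-> : (block j - j)%N = (m.+1 + (block j - j - m.+1))%N.
  by move: mj; clear; lia.
rewrite exprD !intrM intrD intrM rmorphXn /=; field.
by rewrite !expf_neq0 // lt0r_neq0.
Qed.

End Rescaling.

(** * Blow-ups of the path *)

Section BlowUps.
Variables (N L : nat) (s C K : RR) (f : RR -> 'rV[RR]_N) (t0 : RR).
Hypothesis s1 : 1 < s.
Hypothesis L13 : 13 <= L%:R :> RR.
Hypothesis C_ge0 : 0 <= C.
Hypothesis K_gt0 : 0 < K.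
Hypothesis f_holder : scaled_holder s C f.
Hypothesis f_separated : loop_separated L loop_scale s K f.
Implicit Types (j k : nat) (w v : RR).

Let L_gt0 : 0 < L%:R :> RR. Proof. exact: lt_le_trans L13. Qed.
Let s_gt0 : 0 < s. Proof. exact: lt_trans s1. Qed.

Definition radius (l : nat) : RR := (L%:R ^+ l)^-1 `^ s^-1.

Definition blown_up j w : 'rV[RR]_N :=
  (radius (block j))^-1 *: (f (time L t0 j w) - f t0).

Lemma Lexp_gt0 l : 0 < L%:R ^+ l :> RR.
Proof. exact: exprn_gt0. Qed.

Lemma radius_gt0 l : 0 < radius l.
Proof. by apply: powR_gt0; rewrite invr_gt0; exact: Lexp_gt0. Qed.

Lemma radius_powR l : radius l `^ s = (L%:R ^+ l)^-1.
Proof.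
rewrite /radius -powRrM mulVf; last by apply: lt0r_neq0.
by rewrite powRr1 // invr_ge0 ltW // Lexp_gt0.
Qed.

Lemma edist_blown_up j w v : edist (blown_up j w) (blown_up j v) =
  (radius (block j))^-1 * edist (f (time L t0 j w)) (f (time L t0 j v)).
Proof.
rewrite /blown_up edist_scale ?edistB //.
by rewrite invr_ge0 ltW // radius_gt0.
Qed.

Lemma blown_up_base j : blown_up j (base L t0 j) = 0.
Proof. by rewrite /blown_up (time_base t0 L13) subrr scaler0. Qed.

Lemma blown_up_holder j w v :
  edist (blown_up j w) (blown_up j v) <= C * `|w - v| `^ s^-1.
Proof.
have r0 := radius_gt0 (block j).
rewrite edist_blown_up ler_pdivrMl //; apply: le_trans (f_holder _ _) _.
rewrite mulrCA; apply: ler_wpM2l => //.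
have iL : 0 <= (L%:R ^+ block j)^-1 :> RR by rewrite invr_ge0 ltW // Lexp_gt0.
rewrite /radius -(powRM _ iL (normr_ge0 _)).
have iLw : 0 <= (L%:R ^+ block j)^-1 * `|w - v| by exact: mulr_ge0.
apply: ge0_ler_powR; rewrite ?nnegrE //; first by rewrite invr_ge0 ltW.
rewrite timeB normrM mulrC; apply: ler_wpM2r => //.
rewrite ger0_norm; last by rewrite invr_ge0 ltW // Lexp_gt0.
rewrite lef_pV2 ?posrE ?Lexp_gt0 //; apply: ler_weXn2l; last exact: leq_addr.
by have := L13; lra.
Qed.

(** The error that [loop_separated] allows, in rescaled time. Space is blown up at scale [block j]
    but time at scale [depth j]; for [gap j = k.+1] this costs the factor [L ^+ k.+2], which does
    not depend on j. *)
Definition looseness k j w v : RR :=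
  K * L%:R ^+ k.+2 * edist (blown_up j w) (blown_up j v) `^ s.

Lemma looseness_ge0 k j w v : 0 <= looseness k j w v.
Proof.
apply: mulr_ge0; last exact: powR_ge0.
by apply: mulr_ge0; apply: ltW => //; exact: Lexp_gt0.
Qed.

Lemma blown_up_separated k j w v : gap j = k.+1 ->
  `|w - v| <= L%:R ^+ depth j / 4 -> let rho := looseness k j w v in
  `|w - v| <= rho \/
    near_loop L loop_scale (rho / L%:R ^+ depth j) (time L t0 j w) (time L t0 j v).
Proof.
move=> jk wv rho; have L0 := Lexp_gt0 (depth j).
have rE : K * edist (f (time L t0 j w)) (f (time L t0 j v)) `^ s = rho / L%:R ^+ depth j.
  have r0 := radius_gt0 (block j).
  have -> : edist (f (time L t0 j w)) (f (time L t0 j v)) =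
      radius (block j) * edist (blown_up j w) (blown_up j v).
    by rewrite edist_blown_up mulVKf // lt0r_neq0.
  rewrite powRM ?edist_ge0 ?(ltW r0) // radius_powR /rho /looseness /depth jk exprD.
  have E1 := lt0r_neq0 (Lexp_gt0 (block j)); have E2 := lt0r_neq0 (Lexp_gt0 k.+2).
  by field; rewrite E1 E2.
have small : `|time L t0 j w - time L t0 j v| <= 1 / 4.
  rewrite timeB normrM [X in _ * X]gtr0_norm ?invr_gt0 // ler_pdivrMr //.
  by move: wv; clear jk; lra.
have := f_separated small; rewrite /= rE => -[h|h]; [left|by right].
move: h; rewrite timeB normrM [X in _ * X]gtr0_norm ?invr_gt0 //.
by rewrite ler_pM2r ?invr_gt0.
Qed.

Lemma blown_up_pairs k j w v : gap j = k.+1 -> let rho := looseness k j w v in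
  `|w - v| + 2 * rho < L%:R ^+ j ->
  `|w - v| <= 2 * rho + (L%:R ^+ j)^-1 \/
  exists x y, [/\ loop_pair L (L ^ k) x y \/ loop_pair L (L ^ k) y x,
    `|w - x%:~R| <= rho & `|v - y%:~R| <= rho].
Proof.
move=> jk rho wv; have rho0 : 0 <= rho by exact: looseness_ge0.
have Lj := Lexp_gt0 j; have Ln := Lexp_gt0 (depth j).
have iLj : 0 <= (L%:R ^+ j)^-1 :> RR by rewrite invr_ge0 ltW.
have Ljn : L%:R ^+ j * 4 <= L%:R ^+ depth j :> RR.
  have -> : depth j = (j.+1 + (block j - j + gap j))%N.
    by rewrite /depth; have := block_ge j; clear; lia.
  rewrite exprD exprSr -mulrA; apply: ler_wpM2l; first exact: ltW.
  have l13 := L13; have l1 : 1 <= L%:R :> RR by clear jk; lra.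
  have h1 : 1 <= L%:R ^+ (block j - j + gap j) :> RR by exact: exprn_ege1.
  have h2 : L%:R * 1 <= L%:R * L%:R ^+ (block j - j + gap j) :> RR.
    by apply: ler_wpM2l => //; clear jk; lra.
  by apply: le_trans h2; clear jk; lra.
have [||h] := @blown_up_separated k j w v jk; first by move: wv rho0 Ljn; clear jk; lra.
  by move=> h; left; move: h iLj rho0; rewrite -/rho; clear jk; lra.
have rE : rho / L%:R ^+ depth j * L%:R ^+ depth j = rho by rewrite divfK // lt0r_neq0.
have [[m [c [i [mj h1 h2]]]]|[x [y [xy h1 h2]]]|h3] := rescale_near_loop L13 jk h.
- have := coarse_loop_far L13 mj h1 h2; rewrite -/rho rE => h3.
  by move: (lt_le_trans wv h3); rewrite ltxx.
- by right; exists x, y; rewrite -/rho rE in h1 h2.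
- by left; rewrite -/rho rE in h3.
Qed.

Lemma blown_up_proper k j w : gap j = k.+1 ->
  (forall P : int, 2 ^+ j / L%:R ^+ block j < `|t0 - P%:~R / L%:R ^+ (block j - j)|) ->
  let rho := looseness k j w (base L t0 j) in
  `|w - base L t0 j| <= L%:R ^+ depth j / 4 -> rho <= 2 ^+ j ->
  `|w - base L t0 j| <= (L * L ^ k)%:R + 2 * rho + 1.
Proof.
move=> jk gen rho wb rhoj; have rho0 : 0 <= rho by exact: looseness_ge0.
have Lj := Lexp_gt0 j; have Ln := Lexp_gt0 (depth j); have l13 := L13.
have iLj : (L%:R ^+ j)^-1 <= 1 :> RR.
  by rewrite invf_le1 //; apply: exprn_ege1; clear jk; lra.
have Q0 : 0 <= (L * L ^ k)%:R :> RR by exact: ler0n.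
have rE : rho / L%:R ^+ depth j * L%:R ^+ depth j = rho by rewrite divfK // lt0r_neq0.
have [h|h] := blown_up_separated jk wb.
  by move: h rho0 Q0; rewrite -/rho; clear jk; lra.
have [[m [c [i [mj _ h2]]]]|[x [y [xy h1 h2]]]|h3] := rescale_near_loop L13 jk h.
- have near : exists c', `|t0 - loop_point RR L m c' i| <= rho / L%:R ^+ depth j.
    by exists (~~ c); move: h2; rewrite (time_base t0 L13).
  case: near => c' /(coarse_loop_generic L13 mj gen) h3.
  have : rho / L%:R ^+ depth j * L%:R ^+ block j <= rho.
    rewrite -[leRHS]rE; apply: ler_wpM2l; first by apply: divr_ge0 => //; exact: ltW.
    by apply: ler_weXn2l; [clear jk mj; lra|exact: leq_addr].
  by move: h3 rhoj; clear jk mj; lra.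
- rewrite -/rho rE in h1 h2.
  have xyQ : `|x%:~R - y%:~R| <= (L * L ^ k)%:R :> RR.
    have lL : (13 <= L)%N by rewrite -(ler_nat RR).
    have Lk : (0 < L ^ k)%N by rewrite expn_gt0; clear -lL; lia.
    have H a b : loop_pair L (L ^ k) a b -> `|a%:~R - b%:~R| <= (L * L ^ k)%:R :> RR.
      move=> ab; have /andP[p1 p2] := loop_pair_lt lL Lk ab; rewrite -intrB -intr_norm.
      rewrite [leRHS]pmulrn ler_int; move: p1 p2; clear; lia.
    by case: xy => [/H//|/H]; rewrite distrC.
  by move: h1 h2 xyQ; rewrite !ler_norml; clear jk xy; lra.
- by move: h3 iLj Q0; rewrite -/rho rE; clear jk; lra.
Qed.

End BlowUps.

Lemma coord_le_norm (R : realType) (N : nat) (x : 'rV[R]_N) i : `|x ord0 i| <= `|x|.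
Proof.
by rewrite [leRHS]/Num.Def.normr /= mx_normrE; apply/bigmax_geP; right => /=; exists (ord0, i).
Qed.

Lemma norm_le_edist (N : nat) (x : 'rV[RR]_N) : `|x| <= edist 0 x.
Proof.
rewrite [leLHS]/Num.Def.normr /= mx_normrE; apply: bigmax_le; first exact: edist_ge0.
move=> [i0 i] _ /=; rewrite (ord1 i0); have := coord_le_edist 0 x i.
by rewrite mxE sub0r normrN.
Qed.

Lemma powR_small (R : realType) (C s e : R) : 0 < s -> 0 <= C -> 0 < e ->
  exists2 d, 0 < d & forall z, 0 <= z <= d -> C * z `^ s <= e.
Proof.
move=> s0 C0 e0; have q0 : 0 < e / (C + 1) by apply: divr_gt0 => //; lra.
exists ((e / (C + 1)) `^ s^-1); first exact: powR_gt0.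
move=> z /andP[z0 zd]; apply: le_trans (_ : C * (e / (C + 1)) <= _).
  apply: ler_wpM2l => //.
  have -> : e / (C + 1) = ((e / (C + 1)) `^ s^-1) `^ s.
    by rewrite -powRrM mulVf ?powRr1 ?(ltW q0) // lt0r_neq0.
  by apply: ge0_ler_powR; rewrite ?nnegrE ?powR_ge0 //; exact: ltW.
by rewrite mulrA ler_pdivrMr; nra.
Qed.

Lemma coord_holder_continuous (N : nat) (s C : RR) (h : RR -> 'rV[RR]_N) : 0 < s -> 0 <= C ->
  (forall w v i, `|h w ord0 i - h v ord0 i| <= C * `|w - v| `^ s^-1) -> continuous h.
Proof.
move=> s0 C0 hC w; apply/cvg_ballP => e e0.
have is0 : 0 < s^-1 by rewrite invr_gt0.
have e20 : 0 < e / 2 by rewrite divr_gt0.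
have [d d0 hd] := powR_small is0 C0 e20.
apply/nbhs_ballP; exists d => // v wv; have {}wv : `|w - v| < d by exact: wv.
split=> // i j; rewrite (ord1 i); suff : `|h w ord0 j - h v ord0 j| < e by [].
apply: le_lt_trans (hC w v j) _; apply: le_lt_trans (hd _ _) _.
  by rewrite normr_ge0 ltW.
by lra.
Qed.

Lemma scaled_holder_continuous (N : nat) (s C : RR) (f : RR -> 'rV[RR]_N) : 0 < s -> 0 <= C ->
  scaled_holder s C f -> continuous f.
Proof.
move=> s0 C0 hC; apply: (coord_holder_continuous s0 C0) => w v i.
exact: le_trans (coord_le_edist _ _ i) (hC w v).
Qed.

Lemma exc_le (N : nat) (A B : set 'rV[RR]_N) (e : RR) : 0 <= e ->
  (forall x, A x -> exists2 y, B y & edist x y <= e) -> (exc A B <= e%:E)%E.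
Proof.
move=> e0 H; apply: ge_ereal_sup => _ [->|[x Ax <-]]; first by rewrite lee_fin.
have [y By xy] := H x Ax; apply: le_trans (_ : (edist x y)%:E <= _)%E; last by rewrite lee_fin.
by apply: ereal_inf_lbound; exists y.
Qed.

Lemma exp_arch (R : realType) (X q : R) : 2 <= q -> exists n, forall p, (n <= p)%N -> X < q ^+ p.
Proof.
move=> q2; exists (Num.truncn (Num.max X 0)).+1 => p np.
apply: le_lt_trans (_ : Num.max X 0 < _); first by rewrite le_max lexx.
have : Num.max X 0 < (Num.truncn (Num.max X 0)).+1%:R.
  by apply: truncnS_gt; rewrite le_max lexx orbT.
move=> h; apply: lt_le_trans h _; apply: le_trans (_ : p%:R <= _); first by rewrite ler_nat.
apply: le_trans (_ : 2 ^+ p <= _).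
  by rewrite -natrX ler_nat ltnW // ltn_expl.
by apply: lerXn2r => //; rewrite nnegrE //; exact: le_trans q2.
Qed.

Lemma int_eq_near (R : realType) (z : R) (x y : int) :
  `|z - x%:~R| <= 1 / 4 -> `|z - y%:~R| <= 1 / 4 -> x = y.
Proof.
move=> h1 h2; have h : `|(x - y)%:~R| < 1 :> R.
  by move: h1 h2; rewrite intrB !ler_norml ltr_norml; lra.
by move: h; rewrite -intr_norm (ltr_int _ _ 1); clear; lia.
Qed.

Lemma ler_of_eps (R : realType) (x y c : R) : 0 <= c ->
  (forall e, 0 < e -> x <= y + c * e) -> x <= y.
Proof.
move=> c0 H; apply/ler_addgt0Pr => e e0.
have q0 : 0 < e / (c + 1) by apply: divr_gt0 => //; lra.
apply: le_trans (H _ q0) _; rewrite lerD2l mulrA ler_pdivrMr; nra.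
Qed.

(** * Tangents at generic times *)

Section Tangents.
Variables (N L : nat) (s C K : RR) (f : RR -> 'rV[RR]_N) (t0 : RR) (k : nat).
Hypothesis s1 : 1 < s.
Hypothesis L13 : 13 <= L%:R :> RR.
Hypothesis C_ge0 : 0 <= C.
Hypothesis K_gt0 : 0 < K.
Hypothesis f_holder : scaled_holder s C f.
Hypothesis f_separated : loop_separated L loop_scale s K f.
Hypothesis f_loop : forall m i, loop_scale m -> f (loop_start RR L m i) = f (loop_end RR L m i).
Hypothesis t0_gt0 : 0 < t0.
Hypothesis t0_lt : t0 < 1 / 4.
Hypothesis t0_generic : generic_time L t0.

Let s_gt0 : 0 < s. Proof. exact: lt_trans s1. Qed.
Let is_gt0 : 0 < s^-1. Proof. by rewrite invr_gt0. Qed.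

Local Notation H := (blown_up L s f t0).
Local Notation base := (base L t0).
Local Notation Q := (L * L ^ k)%N.
Local Notation Lam := (L%:R ^+ k.+2 : RR).

Record limit_curve (h : RR -> 'rV[RR]_N) (th : RR) (j : nat -> nat) : Prop := LimitCurve {
  limit_gap : forall m, gap (j m) = k.+1;
  limit_mono : forall m, (j m < j m.+1)%N;
  limit_close : forall e B, 0 < e -> exists M, forall m, (M <= m)%N ->
    `|base (j m) - th| <= e /\
    forall i w, `|w| <= B -> `|H (j m) w ord0 i - h w ord0 i| <= e }.

Lemma limit_curve_exists : exists h th j, limit_curve h th j.
Proof.
pose G j (i : 'I_N) (w : RR) := H j w ord0 i.
have GH j i w v : `|G j i w - G j i v| <= C * `|w - v| `^ s^-1.
  exact: le_trans (coord_le_edist _ _ i) (blown_up_holder t0 s1 L13 C_ge0 f_holder j w v).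
have bb j : gap j = k.+1 -> 0 <= base j <= Lam.
  by move=> jk; have := base_bounds t0 L13 j; rewrite jk.
have [||||h [th [j [j1 j2 j3]]]] :=
    @uniform_subsequence RR _ G base (fun j => gap j = k.+1) Lam.
- by move=> J; exact: gap_infinite.
- move=> e e0; have [d d0 hd] := powR_small is_gt0 C_ge0 e0.
  exists d => // j i w v wv; apply: le_trans (GH _ _ _ _) _.
  by apply: hd; rewrite normr_ge0 wv.
- move=> i w; exists (C * (`|w| + Lam) `^ s^-1) => j jk.
  have G0 : G j i (base j) = 0 by rewrite /G blown_up_base // mxE.
  rewrite -[G j i w]subr0 -G0; apply: le_trans (GH _ _ _ _) _.
  apply: ler_wpM2l => //.
  have /andP[b1 b2] := bb j jk.
  have wl : `|w - base j| <= `|w| + Lam.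
    by apply: le_trans (ler_normB _ _) _; rewrite lerD2l ger0_norm.
  apply: (ge0_ler_powR (ltW is_gt0)) wl; rewrite nnegrE //.
- by move=> j jk; have /andP[b1 b2] := bb j jk; rewrite ger0_norm.
exists (fun w => \row_i h i w), th, j; split=> // e B e0.
have [M HM] := j3 e B e0; exists M => m mM; have [c1 c2] := HM m mM.
by split=> // i w wB; rewrite [X in _ - X]mxE; exact: c2.
Qed.

Section Limit.
Variables (h : RR -> 'rV[RR]_N) (th : RR) (j : nat -> nat).
Hypothesis lim : limit_curve h th j.

Lemma limit_index_ge m : (m <= j m)%N.
Proof. by elim: m => [//|m IH]; exact: leq_ltn_trans IH (limit_mono lim m). Qed.

Lemma limit_edist e B : 0 < e -> exists M, forall m, (M <= m)%N ->
  forall w, `|w| <= B -> edist (H (j m) w) (h w) <= e.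
Proof.
move=> e0; have q0 : 0 < e / N.+1%:R by rewrite divr_gt0.
have [M HM] := limit_close lim B q0; exists M => m mM w wB.
have [_ c] := HM m mM; apply: le_trans (edist_le_coord (ltW q0) (fun i => c i w wB)) _.
rewrite mulrA ler_pdivrMr ?ltr0Sn // mulrC; apply: ler_wpM2l; first exact: ltW.
by rewrite ler_nat.
Qed.

Lemma limit_holder w v i : `|h w ord0 i - h v ord0 i| <= C * `|w - v| `^ s^-1.
Proof.
apply: (@ler_of_eps _ _ _ 2) => // e e0.
have [M HM] := limit_close lim (`|w| + `|v|) e0.
have [_ c] := HM M (leqnn M).
have c1 := c i w (_ : `|w| <= `|w| + `|v|); have c2 := c i v (_ : `|v| <= `|w| + `|v|).
have {}c1 := c1 (ler_wpDr (normr_ge0 v) (lexx _)).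
have {}c2 := c2 (ler_wpDl (normr_ge0 w) (lexx _)).
have := le_trans (coord_le_edist _ _ i) (blown_up_holder t0 s1 L13 C_ge0 f_holder (j M) w v).
move: (C * _) c1 c2 => z; rewrite !ler_norml; lra.
Qed.

Lemma limit_continuous : continuous h.
Proof. exact: coord_holder_continuous s_gt0 C_ge0 limit_holder. Qed.

Lemma limit_base : h th = 0.
Proof.
apply/rowP => i; rewrite mxE; apply/eqP; rewrite -normr_le0.
apply: (@ler_of_eps _ _ _ 2) => // e e0; rewrite add0r.
have [d d0 hd] := powR_small is_gt0 C_ge0 e0.
have m0 : 0 < Num.min d e by rewrite lt_min d0.
have [M HM] := limit_close lim `|th| m0.
have [c1 c2] := HM M (leqnn M); have {}c2 := c2 i th (lexx _).
have c3 := le_trans (coord_le_edist _ _ i)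
  (blown_up_holder t0 s1 L13 C_ge0 f_holder (j M) (base (j M)) th).
rewrite blown_up_base // mxE sub0r normrN in c3.
have c4 : C * `|base (j M) - th| `^ s^-1 <= e.
  by apply: hd; rewrite normr_ge0; apply: le_trans c1 _; rewrite ge_min lexx.
have c5 : `|H (j M) th ord0 i - h th ord0 i| <= e by apply: le_trans c2 _; rewrite ge_min lexx orbT.
have c6 := le_trans c3 c4.
move: c5 c6; rewrite !ler_norml; lra.
Qed.

Lemma limit_glued w v : glued L (L ^ k) w v -> h w = h v.
Proof.
move=> [x [y [xy -> ->]]]; apply/rowP => i; apply/eqP; rewrite -subr_eq0 -normr_le0.
apply: (@ler_of_eps _ _ _ 2) => // e e0; rewrite add0r.
have [M HM] := limit_close lim (`|x%:~R : RR| + `|y%:~R : RR|) e0.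
have [_ c] := HM M (leqnn M).
have c1 := c i _ (ler_wpDr (normr_ge0 (y%:~R : RR)) (lexx `|x%:~R : RR|)).
have c2 := c i _ (ler_wpDl (normr_ge0 (x%:~R : RR)) (lexx `|y%:~R : RR|)).
have [m [i' [lm e1 e2]]] := time_loop t0 L13 (limit_gap lim M) xy.
have E : H (j M) x%:~R = H (j M) y%:~R by rewrite /blown_up e1 e2 f_loop.
move: c1 c2; rewrite E !ler_norml; lra.
Qed.

Lemma limit_exp_ge (q X : RR) : 2 <= q -> exists M, forall m, (M <= m)%N -> X < q ^+ j m.
Proof.
move=> q2; have [n nX] := exp_arch X q2; exists n => m nm; apply: nX.
exact: leq_trans nm (limit_index_ge m).
Qed.

Let L2 : 2 <= L%:R :> RR. Proof. by have := L13; lra. Qed.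

(** If [h w = h v], the looseness of w and v tends to 0 along the sequence, so they are arbitrarily
    near to loop pairs. Integers within 1/4 of a point are unique, hence the pair is always the same
    and equals w, v. *)
Lemma limit_fibres w v : h w = h v <-> [\/ w = v, glued L (L ^ k) w v | glued L (L ^ k) v w].
Proof.
split=> [hwv|[->//|/limit_glued//|/limit_glued//]].
have [->|/eqP wv] := eqVneq w v; first by constructor 1.
have D0 : 0 < `|w - v| by rewrite normr_gt0 subr_eq0; apply/eqP.
have [D DE] : exists D : RR, D = `|w - v| by eexists.
rewrite -DE in D0.
have absurd (e : RR) : e <= D / 8 -> D <= 2 * e + D / 4 -> False.
  by clear hwv; lra.
have near e : 0 < e -> e <= D / 8 -> exists x y,
    [/\ loop_pair L (L ^ k) x y \/ loop_pair L (L ^ k) y x, `|w - x%:~R| <= e & `|v - y%:~R| <= e].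
  move=> e0 eD.
  have K'0 : 0 <= K * L%:R ^+ k.+2 by apply: mulr_ge0; [exact: ltW|exact: ltW (Lexp_gt0 L13 _)].
  have [d d0 hd] := powR_small s_gt0 K'0 e0.
  have q0 : 0 < d / (2 * N.+1%:R) by rewrite divr_gt0 // mulr_gt0.
  have [M1 HM1] := limit_close lim (`|w| + `|v|) q0.
  have [M2 HM2] := @limit_exp_ge L%:R (D + 2 * e) L2.
  have [M3 HM3] := @limit_exp_ge L%:R (4 / D) L2.
  pose m := maxn M1 (maxn M2 M3).
  have [_ c] := HM1 m (leq_maxl _ _).
  have h2 := HM2 m (leq_trans (leq_maxl _ _) (leq_maxr _ _)).
  have h3 := HM3 m (leq_trans (leq_maxr _ _) (leq_maxr _ _)).
  have ed : edist (H (j m) w) (H (j m) v) <= d.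
    apply: le_trans (_ : N%:R * (2 * (d / (2 * N.+1%:R))) <= _).
      apply: edist_le_coord => [|i]; first by rewrite ltW // mulr_gt0.
      have c1 := c i _ (ler_wpDr (normr_ge0 v) (lexx `|w|)).
      have c2 := c i _ (ler_wpDl (normr_ge0 w) (lexx `|v|)).
      move: c1 c2; rewrite hwv; move: (d / _) q0 => q q0; rewrite !ler_norml; lra.
    have -> : 2 * (d / (2 * N.+1%:R)) = d / N.+1%:R :> RR.
      have n0 : N.+1%:R != 0 :> RR by rewrite pnatr_eq0.
      by move: (N.+1%:R : RR) n0 => n n0; field.
    rewrite mulrA ler_pdivrMr ?ltr0Sn // mulrC; apply: ler_wpM2l; first exact: ltW.
    by rewrite ler_nat.
  have rho_e : looseness L s K f t0 k (j m) w v <= e.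
    by apply: hd; rewrite edist_ge0 ed.
  have small : `|w - v| + 2 * looseness L s K f t0 k (j m) w v < L%:R ^+ j m.
    rewrite -DE; apply: le_lt_trans h2; rewrite lerD2l; exact: ler_wpM2l.
  have [h4|[x [y [xy a1 a2]]]] := blown_up_pairs s1 L13 K_gt0 f_separated (limit_gap lim m) small.
    have iL : (L%:R ^+ j m)^-1 <= D / 4 :> RR.
      rewrite -[D / 4]invrK lef_pV2 ?posrE ?invr_gt0 ?divr_gt0 ?(Lexp_gt0 L13) //.
      by rewrite invf_div ltW.
    have {}h4 : D <= 2 * e + D / 4.
      by rewrite DE; apply: le_trans h4 _; rewrite -DE; apply: lerD => //; exact: ler_wpM2l.
    by case: (absurd e eD h4).
  by exists x, y; split=> //; [exact: le_trans a1 _|exact: le_trans a2 _].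
pose e1 := Num.min (D / 8) (1 / 4).
have e10 : 0 < e1 by rewrite lt_min !divr_gt0.
have e1D : e1 <= D / 8 by rewrite ge_min lexx.
have e14 : e1 <= 1 / 4 by rewrite ge_min lexx orbT.
have [x [y [xy a1 a2]]] := near e1 e10 e1D.
have nearby e : 0 < e -> `|w - x%:~R| <= e /\ `|v - y%:~R| <= e.
  move=> e0; have m0 : 0 < Num.min e e1 by rewrite lt_min e0.
  have m1 : Num.min e e1 <= e1 by rewrite ge_min lexx orbT.
  have m2 : Num.min e e1 <= e by rewrite ge_min lexx.
  have [x' [y' [_ b1 b2]]] := near _ m0 (le_trans m1 e1D).
  have -> : x = x'.
    by apply: (int_eq_near (z := w)); [exact: le_trans a1 e14|exact: le_trans b1 (le_trans m1 e14)].
  have -> : y = y'.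
    by apply: (int_eq_near (z := v)); [exact: le_trans a2 e14|exact: le_trans b2 (le_trans m1 e14)].
  by split; [exact: le_trans b1 m2|exact: le_trans b2 m2].
have wx : w = x%:~R.
  apply/eqP; rewrite -subr_eq0 -normr_le0; apply: (@ler_of_eps _ _ _ 1) => // e e0.
  by rewrite add0r mul1r; case: (nearby e e0).
have vy : v = y%:~R.
  apply/eqP; rewrite -subr_eq0 -normr_le0; apply: (@ler_of_eps _ _ _ 1) => // e e0.
  by rewrite add0r mul1r; case: (nearby e e0).
by case: xy => xy; [constructor 2; exists x, y|constructor 3; exists y, x].
Qed.

(** Uniformity in m serves the Attouch-Wets convergence: the points of a blow-up in a fixed ball
    must come from bounded parameters, lest distant parts of the path accumulate there. *)
Lemma limit_proper_uniform r : exists B M, forall m, (M <= m)%N -> forall w,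
  `|w - base (j m)| <= L%:R ^+ depth (j m) / 4 ->
  (forall i, `|H (j m) w ord0 i| <= r) -> `|w| <= B.
Proof.
have K'0 : 0 <= K * L%:R ^+ k.+2 by apply: mulr_ge0; [exact: ltW|exact: ltW (Lexp_gt0 L13 _)].
pose rho1 := K * L%:R ^+ k.+2 * (N%:R * `|r|) `^ s.
have [J HJ] := t0_generic; have [M HM] := limit_exp_ge rho1 (lexx 2).
exists (Q%:R + 2 * rho1 + 1 + Lam), (maxn J M) => m mM w wb wr.
have Jj : (J <= j m)%N by apply: leq_trans (leq_trans _ mM) (limit_index_ge m); exact: leq_maxl.
have r2 := HM m (leq_trans (leq_maxr _ _) mM).
have rho_le : looseness L s K f t0 k (j m) w (base (j m)) <= rho1.
  apply: ler_wpM2l => //.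
  have ed : edist (H (j m) w) (H (j m) (base (j m))) <= N%:R * `|r|.
    apply: edist_le_coord => // i; rewrite blown_up_base // [X in _ - X]mxE subr0.
    exact: le_trans (wr i) (ler_norm r).
  apply: (ge0_ler_powR (ltW s_gt0)) ed; rewrite nnegrE; first exact: edist_ge0.
  by apply: mulr_ge0.
have := blown_up_proper s1 L13 K_gt0 f_separated (limit_gap lim m) (fun P => HJ (j m) P Jj) wb
  (le_trans rho_le (ltW r2)).
have := base_bounds t0 L13 (j m); rewrite (limit_gap lim m) => /andP[b0 b1] h1.
have -> : w = (w - base (j m)) + base (j m) by rewrite subrK.
apply: le_trans (ler_normD _ _) _; rewrite (ger0_norm b0); apply: lerD => //.
apply: le_trans h1 _; rewrite lerD2r lerD2l; exact: ler_wpM2l.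
Qed.

(** [t0] is interior to [0, 1/4], so any bounded range of rescaled times eventually falls inside. *)
Lemma limit_window B : exists M, forall m, (M <= m)%N -> forall w, `|w| <= B ->
  `|w - base (j m)| <= L%:R ^+ depth (j m) / 4 /\ 0 <= time L t0 (j m) w <= 1 / 4.
Proof.
pose g := Num.min t0 (1 / 4 - t0).
have g0 : 0 < g by rewrite lt_min t0_gt0 subr_gt0.
have [M HM] := limit_exp_ge ((B + Lam) / g) L2.
exists M => m mM w wB; have Ln := Lexp_gt0 L13 (depth (j m)).
have := base_bounds t0 L13 (j m); rewrite (limit_gap lim m) => /andP[b0 b1].
have wb : `|w - base (j m)| <= B + Lam.
  by apply: le_trans (ler_normB _ _) _; rewrite (ger0_norm b0); apply: lerD.
have hL : (B + Lam) / g <= L%:R ^+ depth (j m).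
  apply: le_trans (ltW (HM m mM)) _; apply: ler_weXn2l.
    exact: le_trans (ler1n _ 2) L2.
  exact: leq_trans (block_ge _) (leq_addr _ _).
have wg : `|w - base (j m)| <= g * L%:R ^+ depth (j m).
  by apply: le_trans wb _; rewrite mulrC -ler_pdivrMr.
have g1 : g <= t0 by rewrite ge_min lexx.
have g2 : g <= 1 / 4 - t0 by rewrite ge_min lexx orbT.
have g3 : g <= 1 / 4 by apply: le_trans g2 _; rewrite gerBl ltW.
split.
  by apply: le_trans wg _; rewrite mulrC; apply: ler_wpM2l; [exact: ltW|rewrite div1r in g3].
have : `|time L t0 (j m) w - t0| <= g.
  have -> : time L t0 (j m) w - t0 = time L t0 (j m) w - time L t0 (j m) (base (j m)).
    by rewrite (time_base t0 L13).
  rewrite timeB normrM [X in _ * X]gtr0_norm ?invr_gt0 //.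
  by rewrite ler_pdivrMr.
rewrite ler_norml => /andP[h1 h2]; apply/andP; split.
  by move: h1 g1; move: (time _ _ _ _) (g) => z1 z2; lra.
by move: h2 g2; move: (time _ _ _ _) (g) => z1 z2; lra.
Qed.

Lemma limit_proper r : exists B, forall w, `|h w| <= r -> `|w| <= B.
Proof.
have [B [M HM]] := limit_proper_uniform (r + 1); exists B => w wr.
have [M1 HM1] := limit_close lim `|w| ltr01; have [M2 HM2] := limit_window `|w|.
pose m := maxn M (maxn M1 M2).
have [_ c] := HM1 m (leq_trans (leq_maxl _ _) (leq_maxr _ _)).
have [wb _] := HM2 m (leq_trans (leq_maxr _ _) (leq_maxr _ _)) w (lexx _).
apply: (HM m (leq_maxl _ _) w wb) => i.
have := c i w (lexx _); have := le_trans (coord_le_norm (h w) i) wr.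
rewrite !ler_norml; lra.
Qed.

Lemma limit_radius_mono m : radius L s (block (j m.+1)) <= radius L s (block (j m)).
Proof.
have l1 : 1 <= L%:R :> RR by exact: le_trans (ler1n _ 2) L2.
have Lb := Lexp_gt0 L13 (block (j m)); have Lb' := Lexp_gt0 L13 (block (j m.+1)).
apply: ge0_ler_powR; rewrite ?nnegrE ?invr_ge0; [exact: ltW|exact: ltW|exact: ltW|].
rewrite lef_pV2 ?posrE //; apply: ler_weXn2l => //.
by have := limit_mono lim m; rewrite /block; clear; nia.
Qed.

Lemma limit_radius_small e : 0 < e -> exists M, forall m, (M <= m)%N -> radius L s (block (j m)) < e.
Proof.
move=> e0; have e20 : 0 < e / 2 by rewrite divr_gt0.
have [d d0 hd] := powR_small is_gt0 ler01 e20.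
have [M HM] := limit_exp_ge d^-1 L2; exists M => m mM.
have Lb := Lexp_gt0 L13 (block (j m)).
apply: le_lt_trans (_ : e / 2 < e); last by rewrite ltr_pdivrMr // ltr_pMr // ltr1n.
rewrite /radius -[leLHS]mul1r; apply: hd; rewrite invr_ge0 (ltW Lb) /=.
rewrite -[leRHS]invrK lef_pV2 ?posrE ?invr_gt0 //.
apply: le_trans (ltW (HM m mM)) _; apply: ler_weXn2l; last exact: block_ge.
exact: le_trans (ler1n _ 2) L2.
Qed.

Let Gamma := f @` `[0, 1 / 4].

Lemma blowup_closed x r : closed (blowup Gamma x r).
Proof.
have -> : blowup Gamma x r = (fun t => r^-1 *: (f t - x)) @` `[0, 1 / 4].
  by rewrite /blowup /Gamma image_comp.
apply: compact_closed; first exact: (@norm_hausdorff _ 'rV[RR]_N).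
apply: continuous_compact; last exact: segment_compact.
apply: continuous_subspaceT => t; apply: cvgZl_tmp; apply: cvgB; last exact: cvg_cst.
exact: (scaled_holder_continuous s_gt0 C_ge0 f_holder).
Qed.

Lemma time_surj i t : exists w, time L t0 i w = t.
Proof.
exists (L%:R ^+ depth i * t - (anchor L t0 i)%:~R).
have E : L%:R ^+ depth i != 0 :> RR by apply: lt0r_neq0; exact: Lexp_gt0 L13 _.
by rewrite /time addrC subrK mulrC mulKf.
Qed.

Lemma window_of_time i w : 0 <= time L t0 i w <= 1 / 4 ->
  `|w - base i| <= L%:R ^+ depth i / 4.
Proof.
move=> /andP[a b]; have Ln := Lexp_gt0 L13 (depth i).
have : `|time L t0 i w - time L t0 i (base i)| <= 1 / 4.
  by rewrite (time_base t0 L13); move: t0_gt0 t0_lt => c d; rewrite ler_norml; lra.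
rewrite timeB normrM [X in _ * X]gtr0_norm ?invr_gt0 // ler_pdivrMr //.
by rewrite mulrC mulrA mulr1.
Qed.

(** Parameters are bounded by uniform properness for one excess and by properness of [h] for the
    other; on bounded parameters the convergence is uniform. *)
Lemma limit_tangent : is_tangent Gamma (f t0) (range h).
Proof.
have t0I : 0 <= t0 <= 1 / 4 by rewrite !ltW.
split; first exact: (proper_image_closed limit_continuous limit_proper closedT).
split; first by exists th; [|exact: limit_base].
exists (fun m => radius L s (block (j m))); split; first by move=> m; exact: radius_gt0.
split; first exact: limit_radius_mono.
split; first exact: limit_radius_small.
split.
  move=> m; split; first exact: blowup_closed.
  by exists ((radius L s (block (j m)))^-1 *: (f t0 - f t0)), (f t0) => //; exists t0 => //=; rewrite in_itv.
split; first exact: (proper_image_closed limit_continuous limit_proper closedT).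
split; first by exists (h th), th.
move=> r r0; split=> e e0.
  have [B [M1 HM1]] := limit_proper_uniform r; have [M2 HM2] := limit_edist B e0.
  exists (maxn M1 M2) => m mM; apply: exc_le; first exact: ltW.
  move=> x [[_ [t t01 <-] <-] xr].
  have [w wt] := time_surj (j m) t.
  have xH : (radius L s (block (j m)))^-1 *: (f t - f t0) = H (j m) w by rewrite /blown_up wt.
  rewrite xH in xr *; exists (h w); first by exists w.
  apply: HM2; first exact: leq_trans (leq_maxr _ _) mM.
  apply: (HM1 m (leq_trans (leq_maxl _ _) mM)).
    by apply: window_of_time; rewrite wt; move: t01; rewrite /= in_itv.
  move=> i; have := le_trans (coord_le_edist 0 (H (j m) w) i) xr.
  by rewrite mxE sub0r normrN.
have [B HB] := limit_proper r; have [M1 HM1] := limit_window B.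
have [M2 HM2] := limit_edist B e0.
exists (maxn M1 M2) => m mM; apply: exc_le; first exact: ltW.
move=> _ [[w _ <-] wr].
have wB : `|w| <= B by apply: HB; apply: le_trans wr; exact: norm_le_edist.
have [_ t01] := HM1 m (leq_trans (leq_maxl _ _) mM) w wB.
exists (H (j m) w).
  exists (f (time L t0 (j m) w)) => //; exists (time L t0 (j m) w) => //=; rewrite in_itv.
rewrite edistC; apply: HM2 wB; exact: leq_trans (leq_maxr _ _) mM.
Qed.

End Limit.

Lemma tangent_exists : exists T, [/\ Tan (f @` `[0, 1 / 4]) (f t0) T, has_lobe_bases T (L ^ k) &
  forall n, has_lobe_bases T n -> (n <= (L * L ^ k).+1)%N].
Proof.
have L13' : (13 <= L)%N by rewrite -(ler_nat RR).
have Lk0 : (0 < L ^ k)%N by rewrite expn_gt0 (leq_trans _ L13').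
have [h [th [j lim]]] := limit_curve_exists.
exists (range h); split; first exact: limit_tangent lim.
- exact: (lobe_bases_lower L13' Lk0 (limit_continuous lim) (limit_proper lim) (limit_fibres lim)).
- exact: (lobe_bases_upper L13' Lk0 (limit_continuous lim) (limit_proper lim) (limit_fibres lim)).
Qed.

End Tangents.

Lemma tangents_infinite (N L : nat) (s C K : RR) (f : RR -> 'rV[RR]_N) (t0 : RR) :
  1 < s -> 13 <= L%:R :> RR -> 0 <= C -> 0 < K ->
  scaled_holder s C f -> loop_separated L loop_scale s K f ->
  (forall m i, loop_scale m -> f (loop_start RR L m i) = f (loop_end RR L m i)) ->
  0 < t0 < 1 / 4 -> generic_time L t0 ->
  exists Ts : nat -> set 'rV[RR]_N, (forall k, Tan (f @` `[0, 1 / 4]) (f t0) (Ts k)) /\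
    forall i j, i <> j -> ~ homeomorphic (Ts i) (Ts j).
Proof.
move=> s1 L13 C0 K0 fH fS fL /andP[t00 t01] gen.
have L13' : (13 <= L)%N by rewrite -(ler_nat RR).
have /choice[T HT] := fun k => tangent_exists k s1 L13 C0 K0 fH fS fL t00 t01 gen.
exists (fun i => T (4 * i)%N); split=> [k|]; first by have [] := HT (4 * k)%N.
have clT k : closed (T k) by have [[]] := HT k.
(* The count for [4 * i] is at most [L ^ (4 i + 1) + 1], which is below [L ^ (4 i + 2)] and thus
   below [L ^ (4 j)]. *)
have far i j : (i < j)%N -> ~ has_lobe_bases (T (4 * i)%N) (L ^ (4 * j)).
  move=> ij /(let: And3 _ _ H := HT (4 * i)%N in H _); apply/negP; rewrite -ltnNge.
  apply: (@leq_trans (L ^ (4 * i).+2)); last by apply: leq_pexp2l; clear -ij L13'; lia.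
  rewrite !expnS; move: (L ^ (4 * i))%N (expn_gt0 L (4 * i)) => X.
  rewrite (leq_trans _ L13') //= => X0; clear -X0 L13'; nia.
have bases i : has_lobe_bases (T i) (L ^ i) by have [] := HT i.
move=> i j ij [a [b [ab [ba [ba' [ab' [ca cb]]]]]]].
have /orP[lt|lt] : (i < j)%N || (j < i)%N by rewrite -neq_ltn; apply/eqP.
- apply: (far i j lt); apply: (homeomorphism_lobe_bases (clT _) ba ab) (bases (4 * j)%N) => //.
- apply: (far j i lt); apply: (homeomorphism_lobe_bases (clT _) ab ba) (bases (4 * i)%N) => //.
Qed.

Lemma hausdorff_le (N : nat) (s : RR) (A B : set 'rV[RR]_N) : A `<=` B ->
  (hausdorff s A <= hausdorff s B)%E.
Proof.
move=> AB; apply: ge_ereal_sup => _ [d d0 <-].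
apply: le_trans (_ : hausdorff_delta s d B <= _)%E; last by apply: ereal_sup_ubound; exists d.
apply: le_ereal_inf_tmp => _ [F [BF dF] <-]; apply: ereal_inf_lbound; exists F => //; split=> //.
exact: subset_trans BF.
Qed.

Lemma hausdorff_ge0 (N : nat) (s : RR) (A : set 'rV[RR]_N) : (0 <= hausdorff s A)%E.
Proof.
apply: le_trans (_ : (hausdorff_delta s 1 A)%R <= _)%E; last by apply: ereal_sup_ubound; exists 1 => /=.
apply: le_ereal_inf_tmp => _ [F _ <-]; apply: nneseries_ge0 => n _ _.
by rewrite lee_fin powR_ge0.
Qed.

Unset Implicit Arguments.

Theorem theorem1p2 (s : RR) (hs : 1 < s) :
  exists (N : nat) (g : RR -> 'rV[RR]_N),
    holder01 s^-1 g /\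
    let Gamma := g @` `[0, 1] in
    (0 < hausdorff s Gamma)%E /\
    hausdorff s [set x | Gamma x /\
      ~ exists Ts : nat -> set 'rV[RR]_N,
          (forall k, Tan Gamma x (Ts k)) /\
          (forall i j, i <> j -> ~ homeomorphic (Ts i) (Ts j))] = 0%E.
Proof.
have [L [L13 _ /(_ loop_scale)[N [f [C [K [C0 K0 fH fS fL]]]]]]] := curve_exists hs.
have s0 : 0 < s by exact: lt_trans hs.
(* On [0, 1/4] any two times are within the reach of [loop_separated]. *)
exists N, (fun t => f (t / 4)); split.
  exists C => t u _ _; apply: le_trans (fH _ _) _; apply: ler_wpM2l => //.
  apply: ge0_ler_powR; rewrite ?nnegrE // ?invr_ge0; first exact: ltW.
  rewrite -mulrBl normrM; apply: ler_piMr => //.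
  by rewrite gtr0_norm ?invr_gt0 // invf_le1 // ler1n.
have -> : (fun t => f (t / 4)) @` `[0, 1] = f @` `[0, 1 / 4].
  apply/seteqP; split=> _ [t + <-]; rewrite /= in_itv /= => t01.
    by exists (t / 4) => //; rewrite /= in_itv /=; move: t01; clear; lra.
  exists (t * 4); last by rewrite mulfK.
  by rewrite /= in_itv /=; move: t01; clear; lra.
split; first exact: hausdorff_gt0 L13 K0 fS s0.
have [A [mA A0 genA]] := generic_time_ae L13.
apply/eqP; rewrite eq_le hausdorff_ge0 andbT.
(* The end points join the exceptional times, since [tangents_infinite] requires an interior
   time. *)
have E0 : lebesgue_measure (A `|` [set 0; 1 / 4]) = 0%E.
  apply: null_set_setU => //; first by apply: measurableU; exact: measurable_set1.
  by apply: countable_lebesgue_measure0; apply: finite_set_countable; exact: finite_set2.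
rewrite -(hausdorff_image0 s0 fH E0); apply: hausdorff_le => _ [[t t01 <-] bad].
move: t01; rewrite /= in_itv /= => t01.
apply: contrapT => nA; apply: bad.
apply: (tangents_infinite hs L13 C0 K0 fH fS fL).
  have t0 : t != 0 by apply/eqP => t0; apply: nA; exists t => //; right; left.
  have t1 : t != 1 / 4 by apply/eqP => t1; apply: nA; exists t => //; right; right.
  by rewrite !lt_neqAle t1 (eq_sym 0) t0.
by apply: genA => // At; apply: nA; exists t => //; left.
Qed.
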